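(* Let $n\ge 4$ and $k\ge 1$ with $n-k\ge 2$. Then the arrangement graph $A_{n,k}$ is super spanning connected: for every integer $l$ with $1\le l\le k(n-k)$ and every pair of distinct vertices $u,v$ of $A_{n,k}$, there is an $l^*$-container of $A_{n,k}$ between $u$ and $v$.
   Context: For integers $n>k\ge 1$, let $\langle n\rangle=\{1,\dots,n\}$. The arrangement graph $A_{n,k}$ has vertex set the set of all sequences $u=u_1u_2\cdots u_k$ with $u_i\in\langle n\rangle$ and $u_i\ne u_j$ for $i\ne j$, and two vertices are adjacent iff they differ in exactly one position; it is $k(n-k)$-regular with connectivity $k(n-k)$. A $k$-container $C(u,v)$ of a graph $G$ is a set of $k$ internally vertex-disjoint paths between $u$ and $v$. A $k$-container is a $k^*$-container if the union of its paths contains every vertex of $G$. $G$ is $k^*$-connected if there is a $k^*$-container between any two distinct vertices of $G$. A graph $G$ is super spanning connected if it is $l^*$-connected for all $1\le l\le\kappa(G)$, where $\kappa(G)$ is its connectivity. *)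

(* Defs.v *)
From mathcomp Require Import all_boot.
Set Implicit Arguments. Unset Strict Implicit. Unset Printing Implicit Defensive.

Section Graphs.
Variables (V : finType) (adj : rel V).

Definition is_path (u v : V) (p : seq V) : Prop :=
  exists q : seq V, [/\ p = u :: q, last u q = v, path adj u q & uniq p].

Definition is_container (l : nat) (u v : V) (P : 'I_l -> seq V) : Prop :=
  (forall i, is_path u v (P i)) /\
  (forall i j, i != j ->
     P i <> P j /\
     (forall x, x \in P i -> x \in P j -> x = u \/ x = v)).

Definition is_star_container (l : nat) (u v : V) (P : 'I_l -> seq V) : Prop :=
  is_container u v P /\ (forall x : V, exists i, x \in P i).

Definition star_connected (l : nat) : Prop :=
  forall u v : V, u != v -> exists P : 'I_l -> seq V, is_star_container u v P.

End Graphs.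

(* Symbols <n> = {1..n} are represented by 'I_n = {0..n-1}. Vertices are
   k-tuples of pairwise distinct symbols. *)
Definition arr_vertex (n k : nat) := {t : k.-tuple 'I_n | uniq t}.

Definition arr_adj (n k : nat) : rel (arr_vertex n k) :=
  fun u v => #|[set i : 'I_k | tnth (val u) i != tnth (val v) i]| == 1.

(* Main.v *)
Require Import Defs.
From mathcomp Require Import all_boot zify.
Set Implicit Arguments.
Unset Strict Implicit.
Unset Printing Implicit Defensive.

(* With m = n - k >= 2 fixed, induct on k for a statement stronger than the
   existence of containers ([span] below): given u != v and a nonempty set B of
   neighbours of v other than u, the vertices distinct from u and v can be
   partitioned into paths that start at neighbours of u and end exactly at the
   elements of B.  An l-container is then obtained from l neighbours of v, or from
   l - 1 of them together with the edge uv.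

   The vertices with a prescribed symbol at position p induce a copy of
   A_{n-1,k-1}.  If u and v agree at p, the induction hypothesis handles their
   common copy, and the symbols free in u lead to the other copies, where paths are
   linked to the remaining elements of B.  If u and v differ at every position, one
   chooses t in the copy of u so that either t is adjacent to u or the translate s
   of t to the copy of v belongs to B.  The induction hypothesis gives a fan from u
   to t and a fan from s to v; the ends of the first are joined to the heads of the
   second directly or through the other copies, and t and s themselves lie on one
   more path, which starts at t or ends at s.

   The base cases are k = 1, where the graph is complete, and k = 2: for m = 2 this
   is a computation in A_{4,2}, and for m > 2 a symbol z free in both u and v is
   removed, the copies in which z occurs being inserted afterwards into the fan of
   the smaller graph. *)

(** * Disjoint path covers *)

(** Only the ends at [v] are prescribed; the heads at [u] stay free. A fan drawn in one copy can
    therefore be made to stop where other copies are to be entered, at the price that its heads,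
    handed back by the induction hypothesis, must be served whatever they are. Since [span] asks for
    a nonempty [B], every such fan needs an end, if necessary a temporary one that is continued
    elsewhere. No copy may be left unvisited either. A path sweeping several copies is available
    unless it has to start and end in the same one of exactly two copies. This exception is the
    source of the recurring side condition on [#|K|], which matters when there is just one copy more
    than there are paths. For n - k = 1 the graph is bipartite with equal classes, so that no
    Hamiltonian path joins two vertices of one class. For k, m >= 2, moving between two copies while
    avoiding a given vertex in each requires three edges between them, which A_{4,2} alone lacks.
    The choice of [t] next to [u] requires a third position, so that [s] and [v] still differ at two
    positions; hence the separate treatment of k = 2. *)

Lemma perm_map_lift (X Y : eqType) (f : X -> Y) (s : seq X) (t : seq Y) :
  perm_eq (map f s) t -> exists2 s', perm_eq s s' & map f s' = t.
Proof.
elim: t s => [|y t IH] s.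
  by case: s => [|x s] H; [exists [::] | move/perm_nilP: H].
move=> H; have : y \in map f s by rewrite (perm_mem H) mem_head.
case/mapP=> x xs yE; have P := perm_to_rem xs.
have : perm_eq (map f (rem x s)) t.
  rewrite -(perm_cons y) -(permPr H) yE -map_cons perm_sym.
  exact: perm_map.
case/IH=> s' P' E; exists (x :: s'); last by rewrite /= E yE.
by rewrite (permPl P) perm_cons.
Qed.

Lemma enumU_perm (T : finType) (X Z : {set T}) : [disjoint X & Z] ->
  perm_eq (enum (X :|: Z)) (enum X ++ enum Z).
Proof.
move=> dis; rewrite perm_sym; apply: uniq_perm.
- rewrite cat_uniq !enum_uniq /= andbT; apply/hasPn => x; rewrite !mem_enum => x2.
  by apply/negP; move/(disjointFr dis); rewrite x2.
- exact: enum_uniq.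
by move=> x; rewrite mem_cat !mem_enum inE.
Qed.

Lemma enum_imset_perm (T T' : finType) (h : T -> T') (X : {set T}) :
  {in X &, injective h} -> perm_eq (enum (h @: X)) [seq h x | x <- enum X].
Proof.
move=> inj; apply: uniq_perm; rewrite ?enum_uniq //.
  by rewrite map_inj_in_uniq ?enum_uniq // => x y; rewrite !mem_enum; apply: inj.
move=> y; rewrite mem_enum; apply/imsetP/mapP => -[x xX ->]; exists x => //.
  by rewrite mem_enum.
by rewrite mem_enum in xX.
Qed.

Lemma enum_setD1 (T : finType) (X : {set T}) x : x \in X ->
  perm_eq (enum X) (x :: enum (X :\ x)).
Proof.
move=> xX; rewrite -{1}(setD1K xX) (permPl (enumU_perm _)) ?enum_set1 //.
by rewrite disjoints1 !inE eqxx.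
Qed.

Lemma ex_notin (T : finType) (X : {set T}) (s : seq T) :
  size s < #|X| -> exists2 x, x \in X & x \notin s.
Proof.
move=> lt; have [sub|/subsetPn //] := boolP (X \subset s).
by move: lt; rewrite ltnNge (leq_trans (subset_leq_card sub)) ?card_size.
Qed.

Lemma ex_notin_seq (T : finType) (X s : seq T) : uniq X ->
  size s < size X -> exists2 x, x \in X & x \notin s.
Proof.
move=> uX lt; have [|x] := @ex_notin _ [set x in X] s; last by rewrite inE; exists x.
by rewrite cardsE (card_uniqP uX).
Qed.

Lemma ex_subset (T : finType) (X : {set T}) n : n <= #|X| ->
  exists2 Z : {set T}, Z \subset X & #|Z| = n.
Proof.
move=> le; exists [set x | x \in take n (enum X)].
  by apply/subsetP => x; rewrite inE => /mem_take; rewrite mem_enum.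
by rewrite cardsE (card_uniqP _) ?take_uniq ?enum_uniq // size_takel // -cardE.
Qed.

Lemma all2_map_enum (T T' : eqType) (e : rel T) (h k : T' -> T) (X : seq T') :
  (forall x, x \in X -> e (h x) (k x)) -> all2 e (map h X) (map k X).
Proof.
elim: X => //= x X IH H; rewrite H ?mem_head // IH // => y yX.
by apply: H; rewrite inE yX orbT.
Qed.

Lemma all2_mapl (T : eqType) (e : rel T) (h : T -> T) (X : seq T) :
  (forall x, x \in X -> e (h x) x) -> all2 e (map h X) X.
Proof. by move=> H; have := @all2_map_enum T T e h id X H; rewrite map_id. Qed.

Lemma all2_cat (T : Type) (e : T -> T -> bool) (L1 L2 M1 M2 : seq T) :
  all2 e L1 M1 -> all2 e L2 M2 -> all2 e (L1 ++ L2) (M1 ++ M2).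
Proof. by elim: L1 M1 => [|l L1 IH] [|k M1] //= /andP[-> /IH]; apply. Qed.

(** * Systems of distinct representatives *)

Lemma ex_injection (T T' : finType) (X : {set T}) (Z : {set T'}) (z0 : T') : #|X| <= #|Z| ->
  exists h : T -> T', {in X &, injective h} /\ forall x, x \in X -> h x \in Z.
Proof.
move=> le; exists (fun x => nth z0 (enum Z) (index x (enum X))).
have lt x : x \in X -> index x (enum X) < size (enum Z).
  by move=> xX; rewrite -cardE (leq_trans _ le) // cardE index_mem mem_enum.
split=> [x y xX yX /eqP|x xX]; last by rewrite -mem_enum mem_nth ?lt.
rewrite nth_uniq ?lt ?enum_uniq // => /eqP E.
by rewrite -(nth_index x (s := enum X) (x := x)) ?mem_enum // E nth_index ?mem_enum.
Qed.

(** Chooses the copies [L] in which paths start when their ends lie in the copies [Js]; the last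
    clause is the side condition of [linkage]. If [K] has one element more than [Js], the element
    left out is neither [c1] nor the one missing from [Js], which is why three elements are
    needed. *)
Lemma ex_copies (T : finType) (K : {set T}) (c1 : T) (Js : seq T) : 2 < #|K| -> c1 \in K ->
  uniq Js -> {subset Js <= K} -> 0 < size Js -> exists L : {set T},
  [/\ L \subset K, #|L| = size Js, c1 \in L & #|K| = (size Js).+1 -> exists2 c, c \in L & c \notin Js].
Proof.
move=> K3 c1K uJ JK J0; have JE : #|[set c in Js]| = size Js by rewrite cardsE (card_uniqP uJ).
have JK' : [set c in Js] \subset K by apply/subsetP => c; rewrite inE => /JK.
have leJ : size Js <= #|K| by rewrite -JE subset_leq_card.
have [E|NE] := eqVneq #|K| (size Js).+1.
  have [|g gK gJ] := @ex_notin _ K Js; first by rewrite E.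
  have [x xK] := @ex_notin _ K [:: c1; g] K3; rewrite !inE negb_or => /andP[xc xg].
  exists (K :\ x); split.
  - exact: subD1set.
  - by move: E; rewrite (cardsD1 x) xK; clear; lia.
  - by rewrite !inE eq_sym xc.
  by move=> _; exists g; rewrite // !inE eq_sym xg.
have [|Z ZK cZ] := @ex_subset _ (K :\ c1) (size Js).-1.
  by move: leJ; rewrite (cardsD1 c1) c1K; clear; lia.
exists (c1 |: Z); split.
- by rewrite subUset sub1set c1K; apply: subset_trans ZK (subD1set _ _).
- rewrite cardsU1 cZ (_ : c1 \notin Z) ?add1n ?prednK //.
  by apply/negP => /(subsetP ZK); rewrite !inE eqxx.
- exact: setU11.
by move=> E; rewrite E eqxx in NE.
Qed.

(** Only the values of [w] that fall in [D] are redirected, into [C] minus [D]. From [#|D| <= #|C|]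
    this set is at least as large as [D] minus [C], which contains those values, and there is no
    collision with the kept ones because [w] avoids [C]. *)
Lemma assign_all (T T' : finType) (X : {set T}) (w : T -> T') (C D : {set T'}) :
  {in X &, injective w} -> (forall x, x \in X -> w x \notin C) -> #|D| <= #|C| ->
  exists beta : T -> T', [/\ {in X &, injective beta},
    forall x, x \in X -> (beta x == w x) || (beta x \in C) &
    forall x, x \in X -> beta x \notin D].
Proof.
move=> wi wC DC; have [X0|/set0Pn[x1 x1X]] := eqVneq X set0.
  by exists w; rewrite X0; split=> [x y|x|x]; rewrite inE.
pose F := [set x in X | w x \in D].
have FX : F \subset X by apply/subsetP => x; rewrite inE => /andP[].
have cF : #|F| <= #|C :\: D|.
  have -> : #|F| = #|w @: F|.
    by rewrite card_in_imset // => x y /(subsetP FX) xX /(subsetP FX); apply: wi.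
  have : #|w @: F| <= #|D :\: C|.
    apply/subset_leq_card/subsetP => _ /imsetP[x + ->]; rewrite !inE => /andP[xX ->].
    by rewrite wC.
  by have := cardsID C D; have := cardsID D C; rewrite setIC; move: DC; clear; lia.
have [h [hi hC]] := ex_injection (w x1) cF.
have hF z : z \in F -> h z \in C /\ h z \notin D by move/hC; rewrite in_setD => /andP[].
exists (fun x => if x \in F then h x else w x); split=> [x y xX yX|x xX|x xX].
- case: ifP => xF; case: ifP => yF E.
  + exact: hi.
  + by case: (hF _ xF); rewrite E (negPf (wC _ yX)).
  + by case: (hF _ yF); rewrite -E (negPf (wC _ xX)).
  exact: wi.
- by case: ifP => xF; rewrite ?eqxx // (hF _ xF).1 orbT.
case: ifP => xF; first by case: (hF _ xF).
by move: xF; rewrite inE xX /= => ->.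
Qed.

(* Hall's condition fails by at most one, so that a system of distinct representatives exists once [x0] is dropped. *)
Lemma assign (T T' : finType) (X : {set T}) (w : T -> T') (C D : {set T'}) :
  {in X &, injective w} -> (forall x, x \in X -> w x \notin C) -> #|D| <= #|C|.+1 ->
  X != set0 -> exists x0 (beta : T -> T'), [/\ x0 \in X,
    {in X :\ x0 &, injective beta},
    forall x, x \in X :\ x0 -> (beta x == w x) || (beta x \in C) &
    forall x, x \in X :\ x0 -> beta x \notin D].
Proof.
move=> wi wC DC /set0Pn[x1 x1X].
have subX x0 x : x \in X :\ x0 -> x \in X by rewrite in_setD1 => /andP[].
have [/existsP[x0 /andP[x0X x0D]]|/existsPn F0] := boolP [exists x in X, w x \in D]; last first.
  exists x1, w; split=> // [|x|x /subX xX]; rewrite ?eqxx //; first exact: sub_in2 (subX x1) _ wi.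
  by have := F0 x; rewrite xX.
have [|x /subX/wC//||beta [bi bw bD]] := @assign_all _ _ (X :\ x0) w C (D :\ w x0).
- exact: sub_in2 (subX x0) _ wi.
- by move: DC; rewrite (cardsD1 (w x0)) x0D.
exists x0, beta; split=> // x xX; have := bD x xX; rewrite in_setD1 negb_and negbK => /orP[/eqP E|//].
have xX' := subX _ _ xX; move: xX (bw x xX); rewrite in_setD1 E => /andP[xx0 _] /orP[/eqP|].
  by move/(wi x0 x x0X xX') => E'; rewrite E' eqxx in xx0.
by rewrite (negPf (wC _ x0X)).
Qed.

Section PathCovers.
Variables (V : finType) (adj : rel V).
Implicit Types (A : {set V}) (S T : seq V) (p : V * seq V).

Definition verts p := p.1 :: p.2.
Definition endp p := last p.1 p.2.
Definition wfp p := path adj p.1 p.2.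

(** A path is a head with a tail, hence never empty, and a single vertex is a path from itself to
    itself. Starts and ends are recorded only up to permutation: which start is joined to which end
    is left open. *)
Definition dpc A S T := exists ps : seq (V * seq V),
  [/\ all wfp ps, perm_eq (flatten (map verts ps)) (enum A),
      perm_eq (map fst ps) S & perm_eq (map endp ps) T].

Lemma dpc_perm A A' S S' T T' : dpc A S T -> A = A' -> perm_eq S S' ->
  perm_eq T T' -> dpc A' S' T'.
Proof.
case=> ps [w f h l] <- hS hT; exists ps; split=> //.
  by rewrite (permPl h).
by rewrite (permPl l).
Qed.

Lemma dpcU A1 A2 S1 S2 T1 T2 : [disjoint A1 & A2] ->
  dpc A1 S1 T1 -> dpc A2 S2 T2 -> dpc (A1 :|: A2) (S1 ++ S2) (T1 ++ T2).
Proof.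
move=> dis [p1 [w1 f1 h1 l1]] [p2 [w2 f2 h2 l2]]; exists (p1 ++ p2); split.
- by rewrite all_cat w1.
- by rewrite map_cat flatten_cat (permPr (enumU_perm dis)) perm_cat.
- by rewrite map_cat perm_cat.
by rewrite map_cat perm_cat.
Qed.

Definition join pq : V * seq V := (pq.1.1, pq.1.2 ++ verts pq.2).

(* The paths of the first system ending in [R1] are continued by those of the second one starting in [R2]. *)
Lemma dpc_comp A1 A2 S1 S2 T1 T2 R1 R2 : [disjoint A1 & A2] ->
  dpc A1 S1 (T1 ++ R1) -> dpc A2 (R2 ++ S2) T2 -> all2 adj R1 R2 ->
  dpc (A1 :|: A2) (S1 ++ S2) (T1 ++ T2).
Proof.
move=> dis [p1 [w1 f1 h1 l1]] [p2 [w2 f2 h2 l2]] aR.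
have [q1 P1 E1] := perm_map_lift l1; have [q2 P2 E2] := perm_map_lift h2.
pose a1 := take (size T1) q1; pose b1 := drop (size T1) q1.
pose b2 := take (size R2) q2; pose a2 := drop (size R2) q2.
have q1E : q1 = a1 ++ b1 by rewrite cat_take_drop.
have q2E : q2 = b2 ++ a2 by rewrite cat_take_drop.
have a1E : map endp a1 = T1 by rewrite map_take E1 take_size_cat.
have b1E : map endp b1 = R1 by rewrite map_drop E1 drop_size_cat.
have b2E : map fst b2 = R2 by rewrite map_take E2 take_size_cat.
have a2E : map fst a2 = S2 by rewrite map_drop E2 drop_size_cat.
have wq1 : all wfp q1 by rewrite -(perm_all _ P1).
have wq2 : all wfp q2 by rewrite -(perm_all _ P2).
move: wq1 wq2; rewrite q1E q2E !all_cat => /andP[wa1 wb1] /andP[wb2 wa2].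
have hq1 : perm_eq (map fst q1) S1 by rewrite -(permPl (perm_map fst P1)).
have lq2 : perm_eq (map endp q2) T2 by rewrite -(permPl (perm_map endp P2)).
have fq1 : perm_eq (flatten (map verts q1)) (enum A1).
  by rewrite -(permPl (perm_flatten (perm_map verts P1))).
have fq2 : perm_eq (flatten (map verts q2)) (enum A2).
  by rewrite -(permPl (perm_flatten (perm_map verts P2))).
have [J1 J2 J3 J4] : [/\ all wfp (map join (zip b1 b2)),
   perm_eq (flatten (map verts (map join (zip b1 b2))))
           (flatten (map verts b1) ++ flatten (map verts b2)),
   map fst (map join (zip b1 b2)) = map fst b1 &
   map endp (map join (zip b1 b2)) = map endp b2].
  move: aR; rewrite -b1E -b2E {q1E q2E fq1 fq2 E1 E2 hq1 lq2 a1E b1E b2E a2E wa1 wa2}.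
  elim: b1 b2 wb1 wb2 => [|[x s] c1 IH] [|[y t] c2] //= /andP[w1x w1'] /andP[w2y w2'].
  case/andP=> axy /(IH _ w1' w2')[J1 J2 J3 J4]; split.
  - by rewrite J1 andbT /wfp /= cat_path /=; apply/and3P.
  - apply/permP => a; move/permP: J2 => /(_ a); rewrite /= !count_cat /= !count_cat /=; clear; lia.
  - by rewrite J3.
  by rewrite J4 /endp /= last_cat.
exists (a1 ++ map join (zip b1 b2) ++ a2); split.
- by rewrite !all_cat wa1 J1.
- rewrite !map_cat !flatten_cat (permPr (enumU_perm dis)).
  rewrite -(permPr (perm_cat fq1 fq2)) q1E q2E !map_cat !flatten_cat.
  apply/permP => a; move/permP: J2 => /(_ a); rewrite !count_cat; clear; lia.
- by rewrite !map_cat J3 a2E catA perm_cat2r -map_cat -q1E.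
by rewrite !map_cat J4 a1E perm_cat2l -map_cat -q2E.
Qed.

Lemma dpc_single x : dpc [set x] [:: x] [:: x].
Proof. by exists [:: (x, [::])]; split=> //; rewrite /= enum_set1. Qed.

Lemma dpc_path A x y : dpc A [:: x] [:: y] ->
  exists s, [/\ path adj x s, last x s = y & perm_eq (x :: s) (enum A)].
Proof.
case=> ps [w f h l]; have := perm_size h; case: ps w f h l => [|[x' s] [|? ?]] //=.
rewrite andbT cats0 /wfp /verts /endp /= => w f h l _.
have E : x' = x by have := perm_mem h x'; rewrite !inE eqxx => /esym/eqP.
exists s; rewrite -E; split=> //.
by have := perm_mem l (last x' s); rewrite !inE eqxx => /esym/eqP.
Qed.

Lemma path_dpc A x s : path adj x s -> perm_eq (x :: s) (enum A) ->
  dpc A [:: x] [:: last x s].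
Proof. by move=> w f; exists [:: (x, s)]; split; rewrite //= ?andbT ?cats0. Qed.

Lemma dpc_subS A S T : dpc A S T -> {subset S <= A}.
Proof.
case=> ps [w f h l] x; rewrite -(perm_mem h) => /mapP[p pps ->].
rewrite -mem_enum -(perm_mem f); apply/flattenP; exists (verts p).
  exact: map_f.
by rewrite /verts mem_head.
Qed.

Lemma dpc_uniqS A S T : dpc A S T -> uniq S.
Proof.
case=> ps [w f h l]; rewrite -(perm_uniq h).
apply: (subseq_uniq (s2 := flatten (map verts ps))); last by rewrite (perm_uniq f) enum_uniq.
elim: ps {w f h l} => //= p ps IH; rewrite eqxx.
exact: subseq_trans IH (suffix_subseq _ _).
Qed.

Lemma dpc_size A S T : dpc A S T -> size S = size T.
Proof. by case=> ps [w f /perm_size <- /perm_size <-]; rewrite !size_map. Qed.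

(** The path through [z] is cut just before [z], and [x] is the predecessor of [z]. This turns a
    neighbour of [u] that is interior to a path into one more head. *)
Lemma dpc_split A S T z : dpc A S T -> z \in A -> z \notin S ->
  exists x, [/\ adj x z, x \in A & dpc A (z :: S) (x :: T)].
Proof.
case=> ps [w f h l] zA zS.
have: z \in flatten (map verts ps) by rewrite (perm_mem f) mem_enum.
case/flattenP=> _ /mapP[[h0 s0] pps ->]; rewrite inE => /orP[/eqP zh|/= zs].
  by case/negP: zS; rewrite -(perm_mem h) zh; apply: (map_f fst pps).
case/splitPr: zs pps => s1 s2 pps; have P := perm_to_rem pps.
move: w; rewrite (perm_all _ P) /= /wfp /= cat_path /= => /andP[/and3P[w1 w2 w3] w4].
exists (last h0 s1); split=> //.
  rewrite -mem_enum -(perm_mem f); apply/flattenP.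
  exists (verts (h0, s1 ++ z :: s2)); first exact: map_f.
  by rewrite /verts /= -cat_cons mem_cat mem_last.
exists ((z, s2) :: (h0, s1) :: rem (h0, s1 ++ z :: s2) ps); split.
- by rewrite /= /wfp /= w3 w1.
- rewrite -(permPr f) (permPr (perm_flatten (perm_map verts P))) /=.
  apply/permP => a; rewrite /= !count_cat /= !count_cat /=; clear; lia.
- by rewrite perm_cons -(permPr h) (permPr (perm_map fst P)).
have := l; rewrite (permPl (perm_map endp P)) /= /endp /= last_cat /= => /permP E.
by apply/permP => a; have /= := E a; clear; lia.
Qed.

(** * Fans with a common root, and insertions into their edges *)

Fixpoint pairs x s : seq (V * V) :=
  if s is y :: s' then (x, y) :: pairs y s' else [::].

Lemma pairs_cat x s1 s2 : pairs x (s1 ++ s2) = pairs x s1 ++ pairs (last x s1) s2.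
Proof. by elim: s1 x => //= y s1 IH x; rewrite IH. Qed.

Lemma pairs_split x s g g' : (g, g') \in pairs x s ->
  exists s1 s2, s = s1 ++ g' :: s2 /\ last x s1 = g.
Proof.
elim: s x => //= y s IH x; rewrite inE => /orP[/eqP[-> ->]|/IH[s1 [s2 [-> E]]]].
  by exists [::], s.
by exists (y :: s1), s2.
Qed.

(* [u] is the common neighbour from which all the paths emanate. *)
Definition rooted u A T (qs : seq (seq V)) :=
  [/\ all (fun q => (q != [::]) && path adj u q) qs,
      perm_eq (flatten qs) (enum A) & perm_eq (map (last u) qs) T].

Definition redges u (qs : seq (seq V)) := flatten (map (pairs u) qs).

Lemma rooted_dpc u A T qs : rooted u A T qs -> exists2 S, all (adj u) S & dpc A S T.
Proof.
case=> w f l; pose ps := [seq (head u q, behead q) | q <- qs].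
have wq q : q \in qs -> [/\ adj u (head u q), wfp (head u q, behead q),
     verts (head u q, behead q) = q & endp (head u q, behead q) = last u q].
  by move/(allP w); case: q => //= x s /andP[]; split.
exists (map fst ps); first by apply/allP => x /mapP[p /mapP[q /wq[? ? ? ?] -> ->]].
exists ps; split=> //.
- by apply/allP => p /mapP[q /wq[? ? ? ?] ->].
- rewrite -map_comp (_ : map _ qs = qs) //; rewrite -[RHS]map_id.
  by apply/eq_in_map => q /wq[].
rewrite -map_comp (_ : map _ qs = map (last u) qs) //.
by apply/eq_in_map => q /wq[].
Qed.

Lemma dpc_rooted u A S T : all (adj u) S -> dpc A S T -> exists qs, rooted u A T qs.
Proof.
move=> aS [ps [w f h l]]; exists (map verts ps); split=> //.
  apply/allP => q /mapP[p pps ->] /=; apply/andP; split; last exact: (allP w).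
  by apply: (allP aS); rewrite -(perm_mem h) (map_f fst).
by rewrite -map_comp.
Qed.

(** The edge from [g] to [g'] is replaced by a detour through [A2], which leaves the ends of the fan
    unchanged. The final clause keeps the remaining edges available for a second detour. *)
Lemma rooted_insert u A1 A2 T qs g g' x y : [disjoint A1 & A2] ->
  rooted u A1 T qs -> (g, g') \in redges u qs -> dpc A2 [:: x] [:: y] ->
  adj g x -> adj y g' -> exists2 qs', rooted u (A1 :|: A2) T qs' &
  forall e, e \in redges u qs -> e != (g, g') -> e \in redges u qs'.
Proof.
move=> dis [w f l] gg /dpc_path[s [ps <- pfA2]] gx yg.
case/flattenP: gg => _ /mapP[q qqs ->] /pairs_split[q1 [q2 [qE q1E]]].
have P := perm_to_rem qqs; have := w; rewrite (perm_all _ P) /= => /andP[/andP[_ wq] wr].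
pose q' := q1 ++ x :: s ++ g' :: q2.
exists (q' :: rem q qs).
  split.
  - rewrite /= wr andbT; apply/andP; split; first by rewrite /q'; case: (q1).
    move: wq; rewrite qE !cat_path q1E /= => /and3P[-> gg' w2].
    by rewrite gx /= cat_path ps /= yg.
  - rewrite (permPr (enumU_perm dis)) -(permPr (perm_cat f pfA2)).
    apply/permP => a; have /permP/(_ a) := perm_flatten P.
    rewrite /q' /= qE !count_cat /= ?count_cat /= ?count_cat /=; clear; lia.
  rewrite -(permPr l) (permPr (perm_map _ P)) /= /q' qE.
  by rewrite !last_cat /= last_cat /=.
move=> e; rewrite /redges => eq egg.
have : e \in flatten (map (pairs u) (q :: rem q qs)).
  by rewrite -(perm_mem (perm_flatten (perm_map (pairs u) P))).
rewrite /= !mem_cat /q' qE !pairs_cat /= q1E !mem_cat !inE (negPf egg) /=.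
by rewrite pairs_cat /= !mem_cat inE; case/orP=> [/orP[]|] ->; rewrite ?orbT.
Qed.

Lemma dpc_singles (X : {set V}) : dpc X (enum X) (enum X).
Proof.
exists [seq (x, [::]) | x <- enum X]; split.
- by apply/allP => _ /mapP[x _ ->].
- rewrite -map_comp (_ : flatten _ = enum X) //.
  by elim: (enum X) => //= x s ->.
- by rewrite -map_comp map_id.
by rewrite -map_comp map_id.
Qed.

Lemma dpc_cons A S1 x h T : dpc A (h :: S1) T -> x \notin A -> adj x h ->
  dpc (x |: A) (x :: S1) T.
Proof.
move=> dA xA axh; rewrite -cat1s -[T]cat0s.
apply: (@dpc_comp [set x] A [:: x] S1 [::] T [:: x] [:: h]) => //=.
- by rewrite disjoints1.
- exact: dpc_single.
by rewrite axh.
Qed.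

Lemma dpc_rcons A S T1 y b : dpc A S (b :: T1) -> y \notin A -> adj b y ->
  dpc (y |: A) S (y :: T1).
Proof.
move=> dA yA aby; rewrite setUC -[S]cats0.
have d1 : dpc A S (T1 ++ [:: b]).
  by apply: (dpc_perm dA) => //; rewrite perm_sym cats1 perm_rcons.
apply: dpc_perm (@dpc_comp A [set y] S [::] T1 [:: y] [:: b] [:: y] _ d1 _ _) _ _ _ => //=.
- by rewrite disjoint_sym disjoints1.
- exact: dpc_single.
- by rewrite aby.
by rewrite cats1 perm_rcons.
Qed.

Lemma dpc_hp A1 A2 x y z t : [disjoint A1 & A2] -> dpc A1 [:: x] [:: z] ->
  dpc A2 [:: t] [:: y] -> adj z t -> dpc (A1 :|: A2) [:: x] [:: y].
Proof.
move=> dis d1 d2 zt.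
apply: (@dpc_comp A1 A2 [:: x] [::] [::] [:: y] [:: z] [:: t]) => //=.
by rewrite zt.
Qed.

(** A fan with a single end is one path, and adding [u] in front and [v] behind makes it a
    Hamiltonian path of [G]. *)
Lemma dpc_close (G : {set V}) u v S b : u \in G -> v \in G -> u != v -> all (adj u) S ->
  dpc (G :\ u :\ v) S [:: b] -> adj b v -> dpc G [:: u] [:: v].
Proof.
move=> uG vG uv aS d bv; have := dpc_size d; case: S aS d => [|h [|//]] //= /andP[uh _] d _.
have d1 := dpc_cons d _ uh; have d2 := dpc_rcons (d1 _) _ bv.
apply: dpc_perm (d2 _ _) _ _ _ => //; first by rewrite !inE eqxx andbF.
- by rewrite !inE eqxx orbF eq_sym.
by apply/setP => x; rewrite !inE; do 2!case: eqP => [->|].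
Qed.

Lemma pairsP x (s : seq V) g g' : path adj x s -> (g, g') \in pairs x s ->
  [/\ adj g g', g \in x :: s & g' \in s].
Proof.
elim: s x => //= y s IH x /andP[xy ps]; rewrite inE => /orP[/eqP[-> ->]|/(IH _ ps)[ga gy gs]].
  by rewrite xy !mem_head.
by rewrite ga inE gy orbT inE gs orbT.
Qed.

Lemma pairs_const (T : eqType) (h : V -> T) x (s : seq V) :
  (forall g g', (g, g') \in pairs x s -> h g = h g') -> forall y, y \in s -> h y = h x.
Proof.
elim: s x => //= y s IH x H z.
have Exy : h x = h y by apply: H; rewrite mem_head.
rewrite inE => /orP[/eqP->|zs]; first by rewrite Exy.
by rewrite Exy; apply: IH zs => g g' gs; apply: H; rewrite inE gs orbT.
Qed.

(** Follow the path from the root [u] to [f]: since [h] takes different values at its two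
    extremities, it changes along some edge. *)
Lemma rooted_edge (T : eqType) (h : V -> T) u (X : {set V}) T' qs f :
  rooted u X T' qs -> f \in X -> h f != h u ->
  exists g g', [/\ (g, g') \in redges u qs, h g != h g', adj g g', g \in u |: X & g' \in X].
Proof.
case=> w fl l fX hf; have memX y : y \in flatten qs = (y \in X) by rewrite (perm_mem fl) mem_enum.
move: (fX); rewrite -memX => /flattenP[q qqs fq].
have [/hasP[[g g'] gq /= hg]|/hasPn H] := boolP (has (fun e => h e.1 != h e.2) (pairs u q)).
  have /andP[_ pq] := allP w _ qqs; have [ga gu g'q] := pairsP pq gq.
  have qX y : y \in q -> y \in X by move=> yq; rewrite -memX; apply/flattenP; exists q.
  exists g, g'; split=> //; last exact: qX.
    by apply/flattenP; exists (pairs u q) => //; apply: map_f.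
  by move: gu; rewrite !inE => /orP[->//|/qX->]; rewrite orbT.
case/eqP: hf; apply: pairs_const fq => g g' /H /=.
by rewrite negbK => /eqP.
Qed.

Lemma rooted_add u (X1 X2 : {set V}) T1 qs x y : [disjoint X1 & X2] ->
  rooted u X1 T1 qs -> dpc X2 [:: x] [:: y] -> adj u x ->
  exists2 qs', rooted u (X1 :|: X2) (y :: T1) qs' & {subset redges u qs <= redges u qs'}.
Proof.
move=> dis [w f l] /dpc_path[s [ps ls pf]] ux; exists ((x :: s) :: qs).
  split; first by rewrite /= ux ps.
    rewrite (permPr (enumU_perm dis)) -(permPr (perm_cat f pf)) .
    by apply/permP => a; rewrite count_cat /= count_cat; clear; lia.
  by rewrite /= ls perm_cons.
by move=> e eq; rewrite /redges /= inE mem_cat [e \in flatten _]eq !orbT.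
Qed.

Lemma clique_path (X : {set V}) x s : {in X &, forall x y, x != y -> adj x y} ->
  uniq (x :: s) -> {subset x :: s <= X} -> path adj x s.
Proof.
move=> H; elim: s x => //= y s IH x /andP[]; rewrite inE negb_or => /andP[xy _] us sub.
apply/andP; split; first by apply: H; rewrite // sub // !inE eqxx ?orbT.
by apply: IH => // z zs; apply: sub; rewrite inE zs orbT.
Qed.

End PathCovers.

Lemma pairs_mem (T : finType) (e : rel T) x s z : z \in x :: s -> s != [::] -> path e x s ->
  exists k k', [/\ (k, k') \in pairs x s, e k k', k \in x :: s, k' \in x :: s & (z == k) || (z == k')].
Proof.
move=> zs; have [->|zx] := eqVneq z x.
  by case: s zs => //= y s _ _ /andP[xy _]; exists x, y; rewrite !inE !eqxx orbT.
move: zs; rewrite inE (negPf zx) /=; case/splitPr=> s1 s2 _; rewrite cat_path /= => /and3P[_ e1 _].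
exists (last x s1), z; split=> //; last by rewrite eqxx orbT.
- by rewrite pairs_cat mem_cat inE eqxx orbT.
- by rewrite -cat_cons mem_cat mem_last.
by rewrite -cat_cons mem_cat mem_head orbT.
Qed.

(** * Induced copies of arrangement graphs *)

Section Update.
Variables I Sg : finType.
Local Notation V := {ffun I -> Sg}.
Implicit Types (f g h : V) (p q : I) (c d : Sg) (A : {set I}) (Y : {set Sg}).

(** Adjacency is defined on all functions, injective or not, so that every copy lives in one type
    with one adjacency relation and the induction never changes the type. *)
Definition hadj : rel V := fun f g => #|[set i | f i != g i]| == 1.

Definition upd f p c : V := [ffun q => if q == p then c else f q].

Lemma updE f p c q : upd f p c q = if q == p then c else f q.
Proof. by rewrite ffunE. Qed.

Lemma updp f p c : upd f p c p = c.
Proof. by rewrite updE eqxx. Qed.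

Lemma updN f p c q : q != p -> upd f p c q = f q.
Proof. by rewrite updE => /negPf->. Qed.

Lemma updN' f p c q : p != q -> upd f p c q = f q.
Proof. by rewrite eq_sym; apply: updN. Qed.

Lemma upd_id f p : upd f p (f p) = f.
Proof. by apply/ffunP => q; rewrite updE; case: eqP => [->|]. Qed.

Lemma upd_upd f p c d : upd (upd f p c) p d = upd f p d.
Proof. by apply/ffunP => q; rewrite !updE; case: eqP. Qed.

Lemma updC f p q c d : p != q -> upd (upd f p c) q d = upd (upd f q d) p c.
Proof.
move=> npq; apply/ffunP => r; rewrite !updE; case: eqP => [->|//].
by rewrite eq_sym (negPf npq).
Qed.

Lemma hadjP f g : reflect (exists p, f p != g p /\ g = upd f p (g p)) (hadj f g).
Proof.
apply: (iffP cards1P) => [[p E]|[p [n E]]].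
  exists p; have := set11 p; rewrite -E inE => n; split; first by [].
  apply/ffunP => q; rewrite updE; case: (q =P p) => [-> //|/eqP qp].
  apply/esym/eqP; apply: contraNT qp => n'; by rewrite -in_set1 -E inE.
exists p; apply/setP=> q; rewrite !inE; case: (q =P p) => [->|/eqP qp]; first by rewrite n.
by rewrite E updE (negPf qp) eqxx.
Qed.

Lemma hadj_sym : symmetric hadj.
Proof. by move=> f g; rewrite /hadj; congr (#|pred_of_set _| == 1); apply/setP => i; rewrite !inE eq_sym. Qed.

Lemma hadj_irr f : hadj f f = false.
Proof. by apply/negbTE/hadjP => -[p []]; rewrite eqxx. Qed.

Lemma hadj_upd f p c : c != f p -> hadj f (upd f p c).
Proof. by move=> n; apply/hadjP; exists p; rewrite updp eq_sym. Qed.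

Lemma hadj_upd' f p c : c != f p -> hadj (upd f p c) f.
Proof. by rewrite hadj_sym; apply: hadj_upd. Qed.

Lemma hadj_upd2 f p c d : c != d -> hadj (upd f p c) (upd f p d).
Proof. by move=> n; rewrite -(upd_upd f p c d); apply: hadj_upd; rewrite updp eq_sym. Qed.

Lemma hadj_far f g p q : p != q -> f p != g p -> f q != g q -> ~~ hadj f g.
Proof.
move=> pq np nq; apply/hadjP => -[r [_ E]].
have H x : x != r -> f x = g x by move=> xr; rewrite E updE (negPf xr).
have [rp|/H Ep] := eqVneq p r; last by rewrite Ep eqxx in np.
by rewrite H ?eqxx // -?rp 1?eq_sym // in nq.
Qed.

Lemma hadj_upd_both (x s : V) p c : hadj x s -> x p = s p -> hadj (upd x p c) (upd s p c).
Proof.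
case/hadjP=> q [n E] Ep; apply/hadjP; exists q.
have qp : q != p by apply: contraNneq n => ->; rewrite Ep.
by rewrite !updN // E updC ?updp // eq_sym.
Qed.

(** * Copies as sets of functions, and the symbols free in a vertex *)

Fact stage_key : unit. Proof. exact: tt. Qed.

(* The subgraph induced on the functions that agree with [f0] off [A] and are injective from [A] to [Y] is a copy of the arrangement graph A_{#|Y|,#|A|}.
   The definition is locked because unification would otherwise unfold it. *)
Definition stage : {set I} -> {set Sg} -> V -> {set V} := locked_with stage_key
  (fun A Y f0 => [set f : V | [&& [forall q, (q \notin A) ==> (f q == f0 q)],
                              f @: A \subset Y & #|f @: A| == #|A|]]).

Lemma stageP A Y f0 f :
  reflect [/\ forall q, q \notin A -> f q = f0 q,
              forall q, q \in A -> f q \in Y & {in A &, injective f}]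
          (f \in stage A Y f0).
Proof.
rewrite /stage locked_withE inE; apply: (iffP and3P) => [[/forallP a /subsetP b /imset_injP c]|[a b c]].
  split=> // q qA; first by have /implyP/(_ qA)/eqP := a q.
  by apply: b; apply: imset_f.
split; last exact/imset_injP.
  by apply/forallP => q; apply/implyP => /a ->.
by apply/subsetP => _ /imsetP[q qA ->]; apply: b.
Qed.

Definition free : {set I} -> {set Sg} -> V -> {set Sg} :=
  locked_with stage_key (fun A Y f => Y :\: f @: A).

Lemma freeE A Y f : free A Y f = Y :\: f @: A.
Proof. by rewrite /free locked_withE. Qed.

Definition slice : {set I} -> {set Sg} -> V -> I -> {set Sg} -> {set V} :=
  locked_with stage_key (fun A Y f0 p Z => [set f in stage A Y f0 | f p \in Z]).

Lemma in_slice A Y f0 p Z f :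
  (f \in slice A Y f0 p Z) = (f \in stage A Y f0) && (f p \in Z).
Proof. by rewrite /slice locked_withE inE. Qed.

Lemma stage_copy A Y f0 p c : p \in A -> c \in Y ->
  slice A Y f0 p [set c] = stage (A :\ p) (Y :\ c) (upd f0 p c).
Proof.
move=> pA cY; apply/setP => f; rewrite in_slice in_set1.
apply/andP/stageP => [[/stageP[a b d] /eqP fp]|[a b d]].
  split=> [q|q|q r].
  - rewrite !inE negb_and negbK updE; case: eqP => [->//|_ /=]; exact: a.
  - rewrite !inE => /andP[qp qA]; rewrite b // andbT.
    by apply: contraNneq qp => E; apply/eqP/d => //; rewrite fp.
  by rewrite !inE => /andP[_ qA] /andP[_ rA]; apply: d.
have fp : f p = c by rewrite a ?updp // !inE eqxx.
split; last by rewrite fp.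
apply/stageP; split=> [q qA|q qA|q r qA rA E].
- have qp : q != p by apply: contraNneq qA => ->.
  by rewrite a ?updE ?(negPf qp) // !inE negb_and qA orbT.
- have [->|qp] := eqVneq q p; first by rewrite fp.
  by have := b q; rewrite !inE qp qA => /(_ isT) /andP[].
have [qp|qp] := eqVneq q p; have [rp|rp] := eqVneq r p.
- by rewrite qp.
- by have := b r; rewrite !inE rp rA -E qp fp eqxx => /(_ isT).
- by have := b q; rewrite !inE qp qA E rp fp eqxx => /(_ isT).
by apply: d => //; rewrite !inE ?qp ?rp.
Qed.

Section Free.
Variables (A : {set I}) (Y : {set Sg}) (f0 : V).
Local Notation G := (stage A Y f0).
Local Notation fr := (free A Y).

Lemma frP f c : reflect (c \in Y /\ forall q, q \in A -> f q != c) (c \in fr f).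
Proof.
rewrite freeE inE; apply: (iffP andP) => [[n cY]|[cY n]]; split=> //.
  by move=> q qA; apply: contraNneq n => <-; apply: imset_f.
by apply/imsetP => -[q qA E]; move: (n q qA); rewrite E eqxx.
Qed.

Lemma frY f c : c \in fr f -> c \in Y.
Proof. by case/frP. Qed.

Lemma fr_neq f c q : c \in fr f -> q \in A -> c != f q.
Proof. by case/frP=> _ n qA; rewrite eq_sym n. Qed.

Lemma notfr f c : c \in Y -> c \notin fr f -> exists2 q, q \in A & f q = c.
Proof. by move=> cY; rewrite freeE inE cY andbT negbK => /imsetP[q qA ->]; exists q. Qed.

Lemma stage_val f q : f \in G -> q \in A -> f q \in Y.
Proof. by case/stageP=> _ H _; apply: H. Qed.

Lemma stage_inj f q r : f \in G -> q \in A -> r \in A -> (f q == f r) = (q == r).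
Proof.
case/stageP=> _ _ H qA rA; apply/eqP/eqP => [|->//]; exact: H.
Qed.

Lemma stage_fr f q : q \in A -> f q \notin fr f.
Proof. by move=> qA; rewrite freeE inE negb_and negbK imset_f. Qed.

Lemma upd_stage f q c : f \in G -> q \in A -> c \in fr f -> upd f q c \in G.
Proof.
move=> /stageP[a b d] qA /frP[cY n]; apply/stageP; split=> [r rA|r rA|r s rA sA].
- by rewrite updE a //; case: eqP rA => // ->; rewrite qA.
- by rewrite updE; case: eqP => // _; apply: b.
rewrite !updE; case: eqP => [->|_]; case: eqP => [->|_] //.
- by move=> E; move: (n s sA); rewrite -E eqxx.
- by move=> E; move: (n r rA); rewrite E eqxx.
exact: d.
Qed.

Lemma fr_upd f q c : f \in G -> q \in A -> c \in fr f ->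
  fr (upd f q c) = f q |: (fr f :\ c).
Proof.
move=> fG qA cf; apply/setP => d; rewrite [RHS]in_set in_set1 in_setD1.
apply/frP/orP => [[dY n]|[/eqP ->|/andP[dc /frP[dY n]]]].
- have [->|nd] := eqVneq d (f q); [by left|right].
  have := n q qA; rewrite updp eq_sym => -> /=; apply/frP; split=> // r rA.
  by have := n r rA; rewrite updE; case: (r =P q) => // -> _; rewrite eq_sym.
- split; first exact: stage_val fG qA.
  move=> r rA; rewrite updE; case: (r =P q) => [_|/eqP rq]; first exact: fr_neq cf qA.
  by rewrite (stage_inj fG).
split=> // r rA; rewrite updE; case: (r =P q) => _; last exact: n.
by rewrite eq_sym.
Qed.

Lemma card_fr f m : f \in G -> #|Y| = #|A| + m -> #|fr f| = m.
Proof.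
case/stageP=> _ b d cY; rewrite freeE cardsD (setIidPr _); last first.
  by apply/subsetP => _ /imsetP[q qA ->]; apply: b.
by rewrite cY card_in_imset // addKn.
Qed.

Lemma hadj_stage f g : f \in G -> g \in G -> hadj f g ->
  exists q c, [/\ q \in A, c \in fr f & g = upd f q c].
Proof.
move=> fG gG /hadjP[q [n E]]; exists q, (g q).
have qA : q \in A.
  by apply: contraNT n => qA; case/stageP: fG => a _ _; case/stageP: gG => b _ _; rewrite a // b.
split=> //; apply/frP; split; first exact: stage_val gG qA.
move=> r rA; have [->//|rq] := eqVneq r q.
have := stage_inj gG rA qA; rewrite (negPf rq); apply: contraFneq => <-.
by rewrite E updE (negPf rq).
Qed.

Lemma slice_stage p Z f : f \in slice A Y f0 p Z -> f \in G.
Proof. by rewrite in_slice => /andP[]. Qed.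

End Free.
End Update.

(** * The induction step *)

Section Span.
Variables I Sg : finType.
Local Notation V := {ffun I -> Sg}.
Local Notation adj := (@hadj I Sg).
Implicit Types (f g h x y z u v t s : V) (p q : I) (c d : Sg) (B : {set V}).

Definition span (G : {set V}) := forall u v (B : {set V}),
  u \in G -> v \in G -> u != v -> B \subset G -> B != set0 -> u \notin B ->
  (forall b, b \in B -> adj b v) ->
  exists2 S, all (adj u) S & dpc adj (G :\ u :\ v) S (enum B).

Section Stage.
Variables (A : {set I}) (Y : {set Sg}) (f0 : V) (m : nat).
Local Notation G := (stage A Y f0).
Local Notation fr := (free A Y).
Local Notation sl := (slice A Y f0).
Hypotheses (cY : #|Y| = #|A| + m) (m2 : 1 < m) (cA : 1 < #|A|).
Hypothesis cop : forall p c, p \in A -> c \in Y -> span (sl p [set c]).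

(** * Hamiltonian paths and linkages in unions of copies *)

Lemma ex_pos (s : seq I) : size s < #|A| -> exists2 q, q \in A & q \notin s.
Proof. exact: ex_notin. Qed.

Lemma ex_free f (s : seq Sg) : f \in G -> size s < m -> exists2 c, c \in fr f & c \notin s.
Proof. by move=> fG lt; apply: ex_notin; rewrite (card_fr fG cY). Qed.

Lemma in_slice1 p c f : (f \in sl p [set c]) = (f \in G) && (f p == c).
Proof. by rewrite in_slice inE. Qed.

Lemma sliceU p (Z1 Z2 : {set Sg}) : sl p (Z1 :|: Z2) = sl p Z1 :|: sl p Z2.
Proof. by apply/setP => f; rewrite inE !in_slice inE andb_orr. Qed.

Lemma sliceS p (Z1 Z2 : {set Sg}) : Z1 \subset Z2 -> sl p Z1 \subset sl p Z2.
Proof.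
by move=> Z12; apply/subsetP => f; rewrite !in_slice => /andP[-> /(subsetP Z12)].
Qed.

Lemma slice_dis p (Z1 Z2 : {set Sg}) : [disjoint Z1 & Z2] -> [disjoint sl p Z1 & sl p Z2].
Proof.
move=> dis; rewrite disjoint_subset; apply/subsetP => f; rewrite !inE !in_slice.
by case/andP=> -> /= f1; rewrite (disjointFr dis f1).
Qed.

(** Apply the induction hypothesis with one prescribed end, a neighbour of [y]. The condition
    [e != x q] keeps this neighbour different from [x]. *)
Lemma copy_hp p c x y : p \in A -> x \in sl p [set c] -> y \in sl p [set c] -> x != y ->
  dpc adj (sl p [set c]) [:: x] [:: y].
Proof.
move=> pA xc yc xy; have [|q qA] := @ex_pos [:: p]; first exact: cA.
rewrite inE => qp; have yG := slice_stage yc.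
have [|e ey] := @ex_free y [:: x q] yG; first exact: m2.
rewrite inE => ex.
have cY' : c \in Y by move: xc; rewrite in_slice1 => /andP[xG /eqP <-]; apply: (stage_val xG).
have [||||S aS d] := cop pA cY' (B := [set upd y q e]) xc yc xy.
- rewrite sub1set in_slice1 upd_stage // updN' //.
  by move: yc; rewrite in_slice1 => /andP[].
- by apply/set0Pn; exists (upd y q e); rewrite inE.
- by rewrite inE; apply: contraNneq ex => ->; rewrite updp.
- by move=> b /set1P->; apply: hadj_upd'; apply: fr_neq ey qA.
move: d; rewrite enum_set1 => d.
by apply: dpc_close aS d _ => //; apply: hadj_upd'; apply: fr_neq ey qA.
Qed.

Lemma ex_copy f p c : f \in G -> p \in A -> c \in Y -> exists2 g, g \in G & g p = c.
Proof.
move=> fG pA cYY; have [cf|/(notfr cYY)[q qA fq]] := boolP (c \in fr f).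
  by exists (upd f p c); rewrite ?upd_stage ?updp.
have [qp|qp] := eqVneq q p; first by exists f => //; rewrite -qp.
have [e ef _] := @ex_free f [::] fG (ltnW m2).
have c1 : c \in fr (upd f q e) by rewrite (fr_upd fG) // fq setU11.
exists (upd (upd f q e) p c); last by rewrite updp.
by rewrite upd_stage // upd_stage.
Qed.

(* [d] can be freed by changing a single entry at the position where it occurs. *)
Lemma ex_copy_free f p d (s : seq Sg) : f \in G -> p \in A -> d \in Y -> f p != d ->
  size s < m -> exists g, [/\ g \in G, g p = f p, d \in fr g &
    forall c, c \in s -> c \in fr f -> c \in fr g].
Proof.
move=> fG pA dY fd ls; have [df|/(notfr dY)[q qA fq]] := boolP (d \in fr f); first by exists f.
have qp : p != q by apply: contraNneq fd => ->; rewrite fq.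
have [e ef es] := @ex_free f s fG ls.
exists (upd f q e); split; rewrite ?upd_stage ?updN //.
  by rewrite (fr_upd fG) // fq setU11.
move=> c cs cf; rewrite (fr_upd fG) // in_setU1 in_setD1 cf andbT.
by rewrite (_ : c != e) ?orbT //; apply: contraNneq es => <-.
Qed.

Hypothesis big : (2 < #|A|) || (2 < m).

(** An edge between the copies [c] and [d] that avoids a given vertex in each. Two vertices of the
    copy [c] are forbidden, [x] and the translate of [y], so three candidates suffice: [h], a
    modification of it at [q], and a third one obtained at another position or with another symbol.
    This last choice is what [big] provides. *)
Lemma cross p c d x y : x \in G -> p \in A -> c \in Y -> d \in Y -> c != d ->
  exists z, [/\ z \in G, z p = c, d \in fr z, z != x & upd z p d != y].
Proof.
move=> xG pA cYY dY cd; have [g gG gp] := ex_copy xG pA cYY.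
have [||h [hG hp dh _]] := @ex_copy_free g p d [::] gG pA dY; rewrite ?gp //; first exact: ltnW.
have [|q qA] := @ex_pos [:: p]; first exact: cA.
rewrite inE => qp; have [|e eh] := @ex_free h [:: d] hG; first exact: m2.
rewrite inE => ed.
have key r e' : r \in A -> r != p -> e' \in fr h -> e' != d ->
  [/\ upd h r e' \in G, upd h r e' p = c & d \in fr (upd h r e')].
  move=> rA rp e'h e'd; rewrite upd_stage // updN' // hp gp (fr_upd hG) //.
  by rewrite in_setU1 in_setD1 dh (eq_sym d e') e'd orbT.
have [h2 [[h2G h2p h2d] u2]] : exists h2, [/\ h2 \in G, h2 p = c & d \in fr h2] /\
     uniq [:: h; upd h q e; h2].
  case/orP: big => [A3|m3].
    have [|r rA] := @ex_pos [:: p; q]; first exact: A3.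
    rewrite !inE negb_or => /andP[rp rq]; exists (upd h r e); split; first exact: key.
    have he := fr_neq eh rA; have he' := fr_neq eh qA.
    rewrite /= !inE negb_or andbT -andbA; apply/and3P; split.
    - by apply: contraNneq he' => {1}->; rewrite updp.
    - by apply: contraNneq he => {1}->; rewrite updp.
    by apply/eqP => /ffunP/(_ q); rewrite !updE eqxx eq_sym (negPf rq) => E; rewrite E eqxx in he'.
  have [|e' e'h] := @ex_free h [:: d; e] hG; first exact: m3.
  rewrite !inE negb_or => /andP[e'd e'e]; exists (upd h q e'); split; first exact: key.
  rewrite /= !inE negb_or andbT -andbA; apply/and3P; split.
  - by apply: contraNneq (fr_neq eh qA) => {1}->; rewrite updp.
  - by apply: contraNneq (fr_neq e'h qA) => {1}->; rewrite updp.
  by apply: contraNneq e'e => /ffunP/(_ q); rewrite !updp => ->.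
have [z] := ex_notin_seq (s := [:: x; upd y p c]) u2 isT.
have K w : [/\ w \in G, w p = c & d \in fr w] -> w \notin [:: x; upd y p c] ->
   [/\ w \in G, w p = c, d \in fr w, w != x & upd w p d != y].
  case=> wG wp wd; rewrite !inE negb_or => /andP[wx wy]; split=> //.
  by apply: contraNneq wy => <-; rewrite upd_upd -wp upd_id.
move=> zin nz; exists z; apply: K nz; move: zin; rewrite !inE.
by case/or3P=> /eqP->; [rewrite hp gp|apply: key|].
Qed.

Lemma slice_split p (Z : {set Sg}) c : c \in Z ->
  sl p Z = sl p [set c] :|: sl p (Z :\ c) /\ [disjoint sl p [set c] & sl p (Z :\ c)].
Proof.
move=> cZ; rewrite -sliceU setD1K //; split=> //; apply: slice_dis.
by rewrite disjoints1 !inE eqxx.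
Qed.

(** The copies are swept one at a time, beginning with that of [x]. The next copy [f] is that of [y]
    only when no other is left, so that the induction always meets ends in different copies. *)
Lemma hp_diff p (Z : {set Sg}) x y : p \in A -> Z \subset Y -> x \in sl p Z ->
  y \in sl p Z -> x p != y p -> dpc adj (sl p Z) [:: x] [:: y].
Proof.
move=> pA; have [n] := ubnP #|Z|; elim: n Z x => // n IH Z x cZ ZY xZ yZ xy.
move: (xZ) (yZ); rewrite !in_slice => /andP[xG xpZ] /andP[yG ypZ].
have [-> dis] := slice_split p xpZ.
have [f /andP[fZ fx] fy] : exists2 f, (f \in Z) && (f != x p) & f = y p /\ #|Z| <= 2 \/ f != y p.
  have [Z3|Z2] := ltnP 2 #|Z|.
    have [f fZ] := @ex_notin _ Z [:: x p; y p] Z3.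
    by rewrite !inE negb_or => /andP[fx fy]; exists f; [rewrite fZ|right].
  by exists (y p); [rewrite ypZ eq_sym|left].
have xf : x p != f by rewrite eq_sym.
have [z [zG zp fz zx zy]] := cross y xG pA (subsetP ZY _ xpZ) (subsetP ZY _ fZ) xf.
have zf : upd z p f \in sl p (Z :\ x p) by rewrite in_slice upd_stage // updp !inE fx fZ.
have yZ' : y \in sl p (Z :\ x p) by rewrite in_slice yG !inE eq_sym xy.
apply: (dpc_hp dis (z := z) (t := upd z p f)).
- by apply: copy_hp; rewrite ?in_slice1 ?xG ?zG ?zp ?eqxx 1?eq_sym.
- case: fy => [[fy Z2]|fy].
    have -> : Z :\ x p = [set f].
      apply/esym/eqP; rewrite eqEcard sub1set !inE fx fZ cards1.
      by move: Z2; rewrite (cardsD1 (x p)) xpZ.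
    apply: copy_hp => //; first by rewrite in_slice1 upd_stage ?updp ?eqxx.
    by rewrite in_slice1 yG fy eqxx.
  apply: IH => //.
  - by move: cZ; rewrite (cardsD1 (x p)) xpZ.
  - exact: subset_trans (subD1set _ _) ZY.
  by rewrite updp.
by apply: hadj_upd; rewrite zp.
Qed.

(** A step from [z] to a neighbour uses up at most one free symbol, so one of [a] and [b] is still
    free in [w]; the other one is kept for [z]. *)
Lemma two_free z w a b : z \in G -> w \in G -> adj z w -> a \in fr z -> b \in fr z -> a != b ->
  exists a' b', [/\ a' \in [:: a; b], b' \in [:: a; b], a' != b', a' \in fr z & b' \in fr w].
Proof.
move=> zG wG zw az bz ab; have [q [c [qA cz ->]]] := hadj_stage zG wG zw.
rewrite (fr_upd zG) //; have [bc|bc] := eqVneq b c.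
  exists b, a; rewrite in_setU1 in_setD1 -bc ab az orbT eq_sym ab bz.
  by rewrite !inE !eqxx ?orbT.
exists a, b; rewrite in_setU1 in_setD1 bc bz orbT ab az.
by rewrite !inE !eqxx ?orbT.
Qed.

(** Take a Hamiltonian path of the common copy and make a detour through all the others at one of
    its edges. The edge is chosen at a vertex [z] in which two symbols [a] and [b] of [Z] are free,
    so that the detour leaves and returns through different copies and [hp_diff] applies to it. This
    is where a third copy is required. *)
Lemma hp_same p (Z : {set Sg}) x y : p \in A -> Z \subset Y -> x \in sl p Z ->
  y \in sl p Z -> x p = y p -> x != y -> 2 < #|Z| -> dpc adj (sl p Z) [:: x] [:: y].
Proof.
move=> pA ZY xZ yZ xyp xy Z3; move: (xZ) (yZ); rewrite !in_slice => /andP[xG xpZ] /andP[yG ypZ].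
have [-> dis] := slice_split p xpZ; set c := x p in xpZ dis *.
have xc : x \in sl p [set c] by rewrite in_slice1 xG eqxx.
have yc : y \in sl p [set c] by rewrite in_slice1 yG -xyp eqxx.
have /dpc_path[s [ps ls perms]] := copy_hp pA xc yc xy.
have s0 : s != [::] by apply: contraNneq xy => s0; rewrite -ls s0.
have [a aZ] := @ex_notin _ Z [:: c] (ltnW Z3); rewrite inE => ac.
have [b bZ] := @ex_notin _ Z [:: c; a] Z3; rewrite !inE negb_or => /andP[bc ba].
have [||z1 [z1G z1p az1 _]] := @ex_copy_free x p a [::] xG pA (subsetP ZY _ aZ).
- by rewrite eq_sym.
- exact: ltnW.
have [||z [zG zp bz /(_ a (mem_head _ _) az1) az]] := @ex_copy_free z1 p b [:: a] z1G pA (subsetP ZY _ bZ).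
- by rewrite z1p eq_sym.
- exact: m2.
have memc w : (w \in x :: s) = (w \in G) && (w p == c) by rewrite (perm_mem perms) mem_enum in_slice1.
have zs : z \in x :: s by rewrite memc zG zp z1p eqxx.
have [k [k' [kk e]]] := pairs_mem zs s0 ps.
rewrite !memc => /andP[kG /eqP kp] /andP[k'G /eqP k'p] zk.
have [a' [b' [a'Z b'Z a'b' a'k b'k']]] : exists a' b',
   [/\ a' \in [:: a; b], b' \in [:: a; b], a' != b', a' \in fr k & b' \in fr k'].
  rewrite eq_sym in ba; case/orP: zk => /eqP E; rewrite E in az bz.
    exact: two_free ba.
  have [|a' [b' [? ? ? ? ?]]] := two_free k'G kG _ az bz ba; first by rewrite hadj_sym.
  by exists b', a'; rewrite eq_sym.
have sub d : d \in [:: a; b] -> d \in Z :\ c.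
  by rewrite !inE => /orP[] /eqP->; rewrite ?aZ ?bZ ?ac ?bc.
have blk : dpc adj (sl p (Z :\ c)) [:: upd k p a'] [:: upd k' p b'].
  apply: hp_diff; rewrite ?updp ?in_slice ?upd_stage ?updp ?sub //.
  exact: subset_trans (subD1set _ _) ZY.
have rx : rooted adj x (sl p [set c] :\ x) [:: y] [:: s].
  split; rewrite /= ?s0 ?ps ?ls ?cats0 //; apply: uniq_perm; rewrite ?enum_uniq //.
    by have := perm_uniq perms; rewrite enum_uniq => /andP[].
  have := perm_uniq perms; rewrite enum_uniq => /andP[xs _] w.
  have := perm_mem perms w; rewrite !mem_enum !inE.
  by have [->|] := eqVneq w x; rewrite //= (negPf xs).
have [||||qs' rq _] := rooted_insert _ rx _ blk (g := k) (g' := k').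
- by apply: disjointWl dis; apply: subD1set.
- by rewrite /redges /= cats0.
- by apply: hadj_upd; rewrite kp; move: (sub _ a'Z); rewrite !inE => /andP[].
- by apply: hadj_upd'; rewrite k'p; move: (sub _ b'Z); rewrite !inE => /andP[].
have [S aS d] := rooted_dpc rq; have := dpc_size d.
case: S aS d => [|h [|//]] //= /andP[xh _] d _.
apply: dpc_perm (dpc_cons d _ xh) _ _ _ => //.
  by rewrite !inE eqxx /=; rewrite (disjointFr dis xc).
by rewrite setUA setD1K.
Qed.

Lemma hp_slice p (Z : {set Sg}) x y : p \in A -> Z \subset Y -> x \in sl p Z ->
  y \in sl p Z -> x != y -> (x p = y p -> #|Z| != 2) -> dpc adj (sl p Z) [:: x] [:: y].
Proof.
move=> pA ZY xZ yZ xy H; have [E|] := eqVneq (x p) (y p); last exact: hp_diff.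
have [Z3|Z2] := ltnP 2 #|Z|; first exact: hp_same.
move: (xZ) (yZ); rewrite !in_slice => /andP[xG xpZ] /andP[yG ypZ].
have ZE : Z = [set x p].
  apply/esym/eqP; rewrite eqEcard sub1set xpZ cards1.
  by have := H E; move: Z2; rewrite leq_eqVlt => /orP[/eqP->|].
by rewrite ZE; apply: copy_hp => //; rewrite in_slice1 ?xG ?yG ?E eqxx.
Qed.

(** A start and an end lying in one copy are joined inside it; if no start shares a copy with an
    end, a pair is joined through its own two copies. The last pair sweeps everything that remains.
    The last hypothesis prevents this pair from facing exactly two copies with both vertices in the
    same one. It is inherited when a shared copy is removed, and holds by itself once starts and
    ends lie in disjoint sets of copies. *)
Lemma linkage p (K : {set Sg}) (Xs Ys : seq V) : p \in A -> K \subset Y ->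
  size Xs = size Ys -> 0 < size Xs ->
  {subset Xs <= sl p K} -> {subset Ys <= sl p K} ->
  uniq [seq f p | f : V <- Xs] -> uniq [seq f p | f : V <- Ys] ->
  {in Xs & Ys, forall x y, x != y} ->
  (#|K| = (size Xs).+1 -> exists2 x, x \in Xs & x p \notin [seq f p | f : V <- Ys]) ->
  dpc adj (sl p K) Xs Ys.
Proof.
move=> pA; have [n] := ubnP (size Xs); elim: n K Xs Ys => // n IH K Xs Ys sn KY sXY s0 XK YK uX uY XY H.
have permP' (L : seq V) l : l \in L -> perm_eq (l :: rem l L) L by move=> lL; rewrite perm_sym perm_to_rem.
have [/hasP[x xX /mapP[y yYs xyp]]|/hasPn dXY] := boolP (has (fun x : V => x p \in [seq f p | f : V <- Ys]) Xs).
  have xK := XK _ xX; have yK := YK _ yYs.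
  move: (xK) (yK); rewrite !in_slice => /andP[xG xpK] /andP[yG ypK].
  have [Xs0|Xs0] := posnP (size (rem x Xs)).
    have Ys0 : size (rem y Ys) = 0 by rewrite size_rem // -sXY -(size_rem xX).
    have XE : perm_eq [:: x] Xs by rewrite -(permPr (permP' _ _ xX)) (size0nil Xs0).
    have YE : perm_eq [:: y] Ys by rewrite -(permPr (permP' _ _ yYs)) (size0nil Ys0).
    apply: (dpc_perm _ erefl XE YE); apply: hp_slice => //; first exact: XY.
    move=> _; apply/negP => /eqP K2; have := perm_size XE; rewrite /= => sX1.
    have [|x' x'X] := H; first by rewrite K2 -sX1.
    have : x' \in [:: x] by rewrite (perm_mem XE).
    rewrite inE => /eqP ->; rewrite xyp; case/negP; exact: map_f.
  have [-> dis] := slice_split p xpK.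
  apply: (dpc_perm _ erefl (permP' _ _ xX) (permP' _ _ yYs)).
  rewrite -cat1s -[y :: _]cat1s; apply: dpcU => //.
    by apply: copy_hp; rewrite ?in_slice1 ?xG ?yG ?xyp ?eqxx //; apply: XY.
  have uX' : uniq [seq f p | f : V <- x :: rem x Xs].
    by rewrite (perm_uniq (perm_map _ (permP' _ _ xX))).
  have uY' : uniq [seq f p | f : V <- y :: rem y Ys].
    by rewrite (perm_uniq (perm_map _ (permP' _ _ yYs))).
  case/andP: uX' => nX uX'; case/andP: uY' => nY uY'.
  apply: IH => //.
  - by rewrite size_rem // -ltnS prednK.
  - exact: subset_trans (subD1set _ _) KY.
  - by rewrite !size_rem // sXY.
  - move=> w wX; move: (XK _ (mem_rem wX)); rewrite !in_slice in_setD1 => /andP[-> ->]; rewrite andbT.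
    by apply: contraNneq nX => <-; apply: map_f.
  - move=> w wX; move: (YK _ (mem_rem wX)); rewrite !in_slice in_setD1 => /andP[-> ->]; rewrite andbT.
    by rewrite xyp; apply: contraNneq nY => <-; apply: map_f.
  - by move=> w w' /mem_rem wX /mem_rem wY; apply: XY.
  move=> cK; have [|w wX wY] := H.
    by rewrite (cardsD1 (x p) K) xpK cK size_rem // prednK.
  have wx : w != x by apply: contraNneq wY => ->; rewrite xyp; apply: map_f.
  exists w; first by have := perm_mem (permP' _ _ xX) w; rewrite wX inE (negPf wx).
  by apply: contraNN wY => /mapP[w' /mem_rem w'Y ->]; apply: map_f.
case: Xs Ys s0 sXY sn XK YK uX uY XY H dXY => // x Xs [//|y Ys] _ [sXY] sn XK YK.
case/andP=> nX uX /andP[nY uY] XY H dXY.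
have xK := XK _ (mem_head _ _); have yK := YK _ (mem_head _ _).
have xyp : x p != y p by have := dXY _ (mem_head _ _); rewrite /= inE negb_or => /andP[].
have [Xs0|Xs0] := posnP (size Xs).
  have -> : Xs = [::] by apply: size0nil.
  have -> : Ys = [::] by apply: size0nil; rewrite -sXY.
  exact: hp_diff.
have KE : K = [set x p; y p] :|: (K :\: [set x p; y p]).
  apply/setP => c; rewrite !inE; case: eqP => [->|_] /=; first by move: xK; rewrite in_slice => /andP[_ ->].
  by case: eqP => [->|_] //=; move: yK; rewrite in_slice => /andP[_ ->].
have memX w : w \in Xs -> [/\ w p != x p & w p != y p].
  move=> wX; split; first by apply: contraNneq nX => <-; apply: map_f.
  have : w \in x :: Xs by rewrite inE wX orbT.
  by move/dXY; rewrite /= inE negb_or => /andP[].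
have memY w : w \in Ys -> [/\ w p != x p & w p != y p].
  move=> wY; split; last by apply: contraNneq nY => <-; apply: map_f.
  have := dXY _ (mem_head _ _); rewrite /= inE negb_or => /andP[_].
  by apply: contraNneq => <-; apply: map_f.
have dis : [disjoint [set x p; y p] & K :\: [set x p; y p]].
  by rewrite disjoint_sym disjoints_subset; apply/subsetP => c; rewrite !inE => /andP[].
rewrite KE sliceU -cat1s -[y :: _]cat1s; apply: dpcU; first exact: slice_dis.
  move: xK yK; rewrite !in_slice => /andP[xG xpK] /andP[yG ypK].
  apply: hp_diff => //; rewrite ?in_slice ?xG ?yG ?inE ?eqxx ?orbT //.
  by apply/subsetP => c; rewrite !inE => /orP[] /eqP->; apply: (subsetP KY).
apply: IH => //.
- exact: subset_trans (subsetDl _ _) KY.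
- move=> w wX; have [w1 w2] := memX _ wX.
  have := XK w; rewrite inE wX orbT => /(_ isT); rewrite !in_slice in_setD => /andP[-> ->].
  by rewrite !inE (negPf w1) (negPf w2).
- move=> w wX; have [w1 w2] := memY _ wX.
  have := YK w; rewrite inE wX orbT => /(_ isT); rewrite !in_slice in_setD => /andP[-> ->].
  by rewrite !inE (negPf w1) (negPf w2).
- by move=> w w' wX wY; apply: XY; rewrite inE ?wX ?wY orbT.
move=> _; case: Xs Xs0 dXY {XK nX uX XY H memX sXY sn} => // w Xs _ dXY.
exists w; first exact: mem_head.
have /dXY : w \in [:: x, w & Xs] by rewrite !inE eqxx orbT.
by rewrite /= inE negb_or => /andP[].
Qed.

(** * A position at which the two vertices agree *)

Lemma stage_slice p : p \in A -> sl p Y = G.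
Proof.
by move=> pA; apply/setP => f; rewrite in_slice; apply: andb_idr => fG; apply: (stage_val fG).
Qed.

Lemma sub_fr f : fr f \subset Y.
Proof. by apply/subsetP => c; apply: frY. Qed.

Definition dirs p v (B : {set V}) := [set d in fr v | upd v p d \in B].

Lemma dirs_fr p v B d : d \in dirs p v B -> d \in fr v.
Proof. by rewrite inE => /andP[]. Qed.

Lemma uniq_upd p v (D : {set Sg}) : uniq [seq upd v p d | d <- enum D].
Proof.
by rewrite map_inj_uniq ?enum_uniq // => c d /(congr1 (fun f : V => f p)); rewrite !updp.
Qed.

Lemma upd_coord p (v : V) (D : seq Sg) : [seq f p | f : V <- [seq upd v p d | d <- D]] = D.
Proof. by rewrite -map_comp -[RHS]map_id; apply: eq_map => d /=; rewrite updp. Qed.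

Lemma nbhd_perm p v (B : {set V}) : p \in A -> v \in G -> B \subset G ->
  (forall b, b \in B -> adj b v) ->
  perm_eq (enum (B :&: sl p [set v p]) ++ [seq upd v p d | d <- enum (dirs p v B)]) (enum B).
Proof.
move=> pA vG BG Bv; apply: uniq_perm; rewrite ?enum_uniq //.
  rewrite cat_uniq enum_uniq uniq_upd andbT /=; apply/hasPn => f /mapP[d + ->].
  rewrite mem_enum => /dirs_fr dv; rewrite mem_enum inE in_slice1 updp negb_and.
  by rewrite (negPf (fr_neq dv pA)) andbF orbT.
move=> b; rewrite mem_cat !mem_enum inE in_slice1; apply/orP/idP => [[/andP[]//|]|bB].
  by case/mapP=> d dD ->; move: dD; rewrite mem_enum inE => /andP[].
have bG := subsetP BG _ bB; have vb : adj v b by rewrite hadj_sym Bv.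
have [q [c [qA cv bE]]] := hadj_stage vG bG vb.
have [qp|qp] := eqVneq q p; last by left; rewrite bB bG bE updN' ?eqxx.
right; apply/mapP; exists c; rewrite ?mem_enum ?inE ?cv -?qp -?bE //.
Qed.

Lemma upd_inj_val u v p c d : upd u p c = upd v p d -> u p = v p -> u = v.
Proof.
by move=> E Ep; rewrite -(upd_id u p) -(upd_id v p) -(upd_upd u p c) E upd_upd Ep.
Qed.

Lemma map_upd_slice p v (D K : {set Sg}) : p \in A -> v \in G -> D \subset fr v -> D \subset K ->
  {subset [seq upd v p d | d <- enum D] <= sl p K}.
Proof.
move=> pA vG Dv DK f /mapP[d + ->]; rewrite mem_enum => dD.
by rewrite in_slice upd_stage ?(subsetP Dv) // updp (subsetP DK).
Qed.

Lemma stage_neq u v : u \in G -> v \in G -> u != v -> exists2 q, q \in A & u q != v q.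
Proof.
move=> uG vG uv; have [/existsP[q /andP[]]|/existsPn H] := boolP [exists q in A, u q != v q].
  by exists q.
case/eqP: uv; apply/ffunP => q; have [qA|qA] := boolP (q \in A); last first.
  by case/stageP: uG => a _ _; case/stageP: vG => b _ _; rewrite a // b.
by have := H q; rewrite qA negbK => /eqP.
Qed.

Lemma all_upd_adj u p (D : {set Sg}) : p \in A -> D \subset fr u ->
  all (adj u) [seq upd u p d | d <- enum D].
Proof.
move=> pA Du; apply/allP => f /mapP[d + ->]; rewrite mem_enum => /(subsetP Du) du.
by apply: hadj_upd; apply: fr_neq du pA.
Qed.

Lemma stage_split p c : p \in A -> c \in Y ->
  G = sl p [set c] :|: sl p (Y :\ c) /\ [disjoint sl p [set c] & sl p (Y :\ c)].
Proof. by move=> pA cYY; rewrite -[G in G = _](stage_slice pA); apply: slice_split. Qed.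

(** In the common copy the induction hypothesis covers all but the ends [upd v p d] with [d] in [D];
    these are reached from [u] through the copies in [K]. If one of the two kinds of ends is absent,
    its share of the vertices must be absorbed by a path of the other kind. *)
Lemma span_agree p u v (B : {set V}) : p \in A -> u p = v p ->
  u \in G -> v \in G -> u != v -> B \subset G -> B != set0 -> u \notin B ->
  (forall b, b \in B -> adj b v) ->
  exists2 S, all (adj u) S & dpc adj (G :\ u :\ v) S (enum B).
Proof.
move=> pA uvp uG vG uv BG B0 uB Bv.
have iY : v p \in Y := stage_val vG pA.
have PB := nbhd_perm pA vG BG Bv; set D := dirs p v B in PB.
set Bin := B :&: _ in PB; set i := v p in iY Bin PB uvp *.
have [GE dis] := stage_split pA iY; set K := Y :\ i in GE dis.
have uI : u \in sl p [set i] by rewrite in_slice1 uG uvp eqxx.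
have vI : v \in sl p [set i] by rewrite in_slice1 vG eqxx.
have GE' : G :\ u :\ v = (sl p [set i] :\ u :\ v) :|: sl p K.
  apply/setP => x; rewrite {1}GE !inE; case: eqP => [->|_] /=; first by rewrite (disjointFr dis vI).
  by case: eqP => [->|_] //=; rewrite (disjointFr dis uI).
have dis' : [disjoint sl p [set i] :\ u :\ v & sl p K].
  by apply: disjointWl dis; apply: subset_trans (subD1set _ _); apply: subD1set.
have BinB : Bin \subset B by apply: subsetIl.
have BinI : Bin \subset sl p [set i] by apply: subsetIr.
have uBin : u \notin Bin by apply: contraNN uB; apply: (subsetP BinB).
have Binv b : b \in Bin -> adj b v by move=> bB; apply: Bv; apply: (subsetP BinB).
have KY : K \subset Y by apply: subD1set.
have Dv : D \subset fr v by apply/subsetP => d; apply: dirs_fr.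
have frK f : f p = i -> fr f \subset K.
  move=> fp; apply/subsetP => c cf; rewrite !inE (frY cf) andbT -fp.
  exact: fr_neq cf pA.
have Dm : #|D| <= m by rewrite -(card_fr vG cY) subset_leq_card.
have cK : #|K| = #|A| + m - 1 by move: cY; rewrite (cardsD1 i) iY /K; clear; lia.
have [Bin0|Bin0] := eqVneq Bin set0; last first.
  have [S aS dS] := cop pA iY uI vI uv BinI Bin0 uBin Binv.
  (* Without ends in [K], one path of the inner fan is preceded by a tour of all the outer copies:
     from [u] into [K], then back to the head [z]. *)
  have [D0|D0] := eqVneq D set0.
    have : 0 < size S by rewrite (dpc_size dS) -cardE card_gt0.
    case: S aS dS => [|z S] //= /andP[uz aS] dS _.
    have := dpc_subS dS (mem_head _ _); rewrite !inE => /and3P[zv zu zI].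
    move: (zI); rewrite in_slice1 => /andP[zG /eqP zp].
    have [g1 g1u _] := @ex_free u [::] uG (ltnW m2).
    have [g2 g2z] := @ex_free z [:: g1] zG m2; rewrite inE => g21.
    exists (upd u p g1 :: S); first by rewrite /= aS hadj_upd // (fr_neq g1u).
    have blk : dpc adj (sl p K) [:: upd u p g1] [:: upd z p g2].
      apply: hp_diff => //; rewrite ?in_slice ?upd_stage ?updp //=.
      - by apply: subsetP g1u; apply: frK.
      - by apply: subsetP g2z; apply: frK.
      by rewrite eq_sym.
    rewrite GE' setUC.
    have d1 := @dpc_comp _ adj (sl p K) (sl p [set i] :\ u :\ v) [:: upd u p g1] S [::] _ [:: upd z p g2] [:: z] _ blk dS.
    apply: dpc_perm (d1 _ _) _ _ _ => //; first by rewrite disjoint_sym.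
      by rewrite /= hadj_upd' // (fr_neq g2z).
    by rewrite -(permPr PB) D0 enum_set0 cats0.
  have [C Cu cC] : exists2 C : {set Sg}, C \subset fr u & #|C| = #|D|.
    by apply: ex_subset; rewrite (card_fr uG cY).
  exists (S ++ [seq upd u p c | c <- enum C]); first by rewrite all_cat aS all_upd_adj.
  rewrite GE'; apply: dpc_perm (dpcU dis' dS _) _ (perm_refl _) PB => //.
  apply: linkage => //.
  - by rewrite !size_map -!cardE.
  - by rewrite size_map -cardE cC card_gt0.
  - by apply: map_upd_slice => //; apply: subset_trans Cu _; apply: frK.
  - by apply: map_upd_slice => //; apply: subset_trans Dv _; apply: frK.
  - by rewrite upd_coord enum_uniq.
  - by rewrite upd_coord enum_uniq.
  - move=> _ _ /mapP[c _ ->] /mapP[d _ ->]; apply: contraNneq uv => E.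
    by apply/eqP; apply: upd_inj_val E _; rewrite uvp.
  (* Here [#|K|] is [#|A| + m - 1] and [C] has at most [m] elements, so the critical case forces two
     positions and [C = fr u]. The witness is then the entry of [v] at the other position [q]: it is
     free in [u], but not in [v], hence not in [D]. *)
  rewrite size_map -cardE => cKC.
  have [q qA nq] := stage_neq uG vG uv.
  have qp : q != p by apply: contraNneq nq => ->; rewrite uvp.
  have AE : A = [set p; q].
    apply/esym/eqP; rewrite eqEcard cards2 (eq_sym p) qp; apply/andP; split.
      by apply/subsetP => r; rewrite !inE => /orP[] /eqP->.
    by move: cKC cK Dm; rewrite cC; clear; lia.
  have CE : C = fr u.
    by apply/eqP; rewrite eqEcard Cu (card_fr uG cY); move: cKC cK cA; clear; lia.
  exists (upd u p (v q)).
    apply: map_f; rewrite mem_enum CE; apply/frP; split; first exact: stage_val vG qA.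
    move=> r; rewrite AE !inE => /orP[] /eqP-> //.
    by rewrite uvp /i (stage_inj vG) // eq_sym.
  rewrite upd_coord updp mem_enum; apply/negP => /dirs_fr vq.
  by have := stage_fr Y v qA; rewrite vq.
have DB : perm_eq [seq upd v p d | d <- enum D] (enum B).
  by rewrite -(permPr PB) Bin0 enum_set0.
have D0 : 0 < #|D| by move: (perm_size DB); rewrite size_map -!cardE => ->; rewrite card_gt0.
have [|q qA] := @ex_pos [:: p]; first exact: cA.
(* No end lies in the common copy, so [b] serves as a temporary one. It is left through the symbol
   [v q], which is free in [b] but not in [v]; thus [v q] is outside [D], which also settles the
   side condition of [linkage]. *)
rewrite inE => qp; have [|e ev] := @ex_free v [:: u q] vG; first exact: m2.
rewrite inE => eu; pose b := upd v q e.
have bG : b \in G by apply: upd_stage.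
have bI : b \in sl p [set i] by rewrite in_slice1 bG updN' ?eqxx.
have bu : u != b by apply: contraNneq eu => ->; rewrite updp.
have [||||S aS dS] := cop pA iY (B := [set b]) uI vI uv.
- by rewrite sub1set.
- by apply/set0Pn; exists b; rewrite inE.
- by rewrite inE.
- by move=> x /set1P->; apply: hadj_upd'; apply: fr_neq ev qA.
rewrite enum_set1 in dS.
have gb : v q \in fr b by rewrite (fr_upd vG) // setU11.
have gD : v q \notin D by apply/negP => /dirs_fr; apply/negP/stage_fr.
have [C Cu cC] : exists2 C : {set Sg}, C \subset fr u :\ v q & #|C| = #|D|.-1.
  apply: ex_subset; move: (card_fr uG cY); rewrite (cardsD1 (v q)).
  by move: Dm; case: (v q \in _) => /=; clear; lia.
have Cu' : C \subset fr u := subset_trans Cu (subD1set _ _).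
have gC : v q \notin C by apply/negP => /(subsetP Cu); rewrite !inE eqxx.
exists (S ++ [seq upd u p c | c <- enum C]); first by rewrite all_cat aS all_upd_adj.
have link : dpc adj (sl p K) (upd b p (v q) :: [seq upd u p c | c <- enum C])
                             [seq upd v p d | d <- enum D].
  apply: linkage => //.
  - by rewrite /= !size_map -!cardE cC prednK.
  - move=> f; rewrite inE => /orP[/eqP->|].
      rewrite in_slice upd_stage // updp; apply: subsetP gb; apply: frK.
      by rewrite /b updN'.
    by apply: map_upd_slice => //; apply: subset_trans Cu' _; apply: frK.
  - by apply: map_upd_slice => //; apply: subset_trans Dv _; apply: frK.
  - by rewrite /= upd_coord enum_uniq updp mem_enum gC.
  - by rewrite upd_coord enum_uniq.
  - move=> f _ + /mapP[d dD ->]; rewrite inE => /orP[/eqP->|/mapP[c _ ->]].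
      apply: contraNneq gD => /(congr1 (fun f : V => f p)); rewrite !updp => ->.
      by rewrite mem_enum in dD.
    apply: contraNneq uv => E.
    by apply/eqP; apply: upd_inj_val E _; rewrite uvp.
  move=> _; exists (upd b p (v q)); first exact: mem_head.
  by rewrite upd_coord updp mem_enum.
rewrite GE'.
have d1 := @dpc_comp _ adj _ _ S [seq upd u p c | c <- enum C] [::] _ [:: b] [:: upd b p (v q)] dis' dS link.
by apply: dpc_perm (d1 _) _ _ DB; rewrite //= andbT hadj_upd // (fr_neq gb).
Qed.

(** * Gluing fans when the two vertices differ at every position *)

(* The fan from [u] to [t] inside the copy of [u], prolonged to the copies indexed by [L]: a copy [c] free in [u] is entered directly from [u], any other from the fan end [upd t (r c) j]. *)
Lemma fan_link p u t j (E1 : {set V}) (K L : {set Sg}) (r : Sg -> I) (Ys : seq V) :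
  let i := u p in let Ln := L :\: fr u in
  p \in A -> u \in G -> t \in G -> t p = i -> u != t -> i != j -> j \in fr t ->
  K \subset Y -> i \notin K -> j \notin K -> L \subset K ->
  E1 \subset sl p [set i] -> u \notin E1 -> (forall b, b \in E1 -> adj b t) ->
  (forall c, c \in Ln -> [/\ r c \in A, r c != p, c \in fr (upd t (r c) j),
     upd t (r c) j != u & upd t (r c) j \notin E1]) ->
  {in Ln &, injective r} -> E1 != set0 \/ Ln != set0 ->
  size Ys = #|L| -> 0 < #|L| -> {subset Ys <= sl p K} -> uniq [seq f p | f : V <- Ys] ->
  (forall y, y \in Ys -> i \notin fr y \/ j \in fr y /\ exists2 q, q != p & y q != u q) ->
  (#|K| = #|L|.+1 -> exists2 c, c \in L & c \notin [seq f p | f : V <- Ys]) ->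
  exists2 S, all (adj u) S &
    dpc adj ((sl p [set i] :\ u :\ t) :|: sl p K) S (enum E1 ++ Ys).
Proof.
move=> i Ln pA uG tG tp ut ij jt KY iK jK LK E1i uE1 E1t rP rinj Ene sY L0 YK uY Yd H.
have iY : i \in Y := stage_val uG pA.
have uI : u \in sl p [set i] by rewrite in_slice1 uG eqxx.
have tI : t \in sl p [set i] by rewrite in_slice1 tG tp eqxx.
pose e c := upd t (r c) j; pose Lf := L :&: fr u.
have rt c : c \in Ln -> t (r c) != j by case/rP=> rA _ _ _ _; rewrite eq_sym; apply: fr_neq jt rA.
have einj : {in Ln &, injective e}.
  move=> c d cL dL E; apply: rinj => //; apply/eqP; apply: contraNT (rt c cL) => rcd.
  by have := congr1 (fun f : V => f (r c)) E; rewrite /e updp updN // => <-.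
have eG c : c \in Ln -> e c \in G by case/rP=> rA _ _ _ _; apply: upd_stage.
have disE : [disjoint E1 & e @: Ln].
  rewrite disjoint_sym disjoints_subset; apply/subsetP => _ /imsetP[c cL ->].
  by rewrite inE; case: (rP c cL).
have [||||S0 aS0 d0] := cop pA iY (B := E1 :|: e @: Ln) uI tI ut.
- rewrite subUset E1i; apply/subsetP => _ /imsetP[c cL ->]; rewrite in_slice1 eG //.
  by case: (rP c cL) => _ rp _ _ _; rewrite /e updN' // tp eqxx.
- by rewrite setU_eq0 negb_and; case: Ene => [->//|/set0Pn[c cL]]; apply/orP; right; apply/set0Pn; exists (e c); apply: imset_f.
- rewrite inE negb_or uE1; apply/imsetP => -[c cL E].
  by case: (rP c cL) => _ _ _; rewrite E eqxx.
- move=> b; rewrite inE => /orP[/E1t//|/imsetP[c cL ->]].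
  by apply: hadj_upd'; rewrite eq_sym rt.
have Lfu : Lf \subset fr u by apply: subsetIr.
have LfK : Lf \subset K by apply: subset_trans LK; apply: subsetIl.
have LnK c : c \in Ln -> c \in K by rewrite inE => /andP[_]; apply: (subsetP LK).
pose X1 := [seq upd u p c | c <- enum Lf]; pose X2 := [seq upd (e c) p c | c <- enum Ln].
have x2G c : c \in Ln -> upd (e c) p c \in G.
  by move=> cL; rewrite upd_stage ?eG //; case: (rP c cL).
have cx1 : [seq f p | f : V <- X1] = enum Lf by rewrite upd_coord.
have cx2 : [seq f p | f : V <- X2] = enum Ln.
  by rewrite -map_comp -[RHS]map_id; apply: eq_map => c /=; rewrite updp.
have ci : i \notin [:: j] by rewrite inE.
have sX : size (X2 ++ X1) = #|L|.
  by rewrite size_cat !size_map -!cardE addnC -(cardsID (fr u) L).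
have link : dpc adj (sl p K) (X2 ++ X1) Ys.
  apply: linkage => //.
  - by rewrite sX.
  - by rewrite sX.
  - move=> f; rewrite mem_cat => /orP[/mapP[c + ->]|].
      by rewrite mem_enum => cL; rewrite in_slice x2G // updp LnK.
    exact: map_upd_slice.
  - rewrite map_cat cx1 cx2 cat_uniq !enum_uniq andbT /=; apply/hasPn => c.
    by rewrite !mem_enum !inE => /andP[_ ->].
  (* Starts differ from ends: every start has [i] free and either contains [j] or agrees with [u]
     away from [p], and [Yd] excludes both combinations. *)
  - move=> f y; rewrite mem_cat => /orP[/mapP[c + ->]|/mapP[c + ->]]; rewrite mem_enum => cL /Yd[iy|[jy [q qp yq]]].
    + apply: contraNneq iy => <-; have cK := LnK c cL.
      have [rA rp cf _ _] := rP c cL; apply/frP; split=> // q qA.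
      have [->|qp] := eqVneq q p; first by rewrite updp; apply: contraNneq iK => <-.
      rewrite updN // /e; have [->|qr] := eqVneq q (r c); first by rewrite updp eq_sym.
      by rewrite updN // -tp (stage_inj tG).
    + apply: contraTneq jy => <-; have [rA rp cf _ _] := rP c cL.
      apply/negP => /frP[_ /(_ _ rA)]; rewrite updN // /e updp eqxx //.
    + apply: contraNneq iy => <-; apply/frP; split=> // q qA.
      have [->|qp] := eqVneq q p; first by rewrite updp; apply: contraNneq iK => <-; apply: (subsetP LfK).
      by rewrite updN // /i (stage_inj uG).
    by apply: contraNneq yq => <-; rewrite updN.
  rewrite sX => /H[c cL cY']; have [cu|cu] := boolP (c \in fr u).
    exists (upd u p c); last by rewrite updp.
    by rewrite mem_cat; apply/orP; right; apply: map_f; rewrite mem_enum inE cL.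
  exists (upd (e c) p c); last by rewrite updp.
  by rewrite mem_cat; apply/orP; left; apply: (map_f (fun c => upd (e c) p c)); rewrite mem_enum inE cL cu.
exists (S0 ++ X1).
  by rewrite all_cat aS0 /=; apply: all_upd_adj pA Lfu.
apply: (@dpc_comp _ adj _ _ S0 X1 _ _ [seq e c | c <- enum Ln] X2) => //.
- apply: disjointWl (slice_dis p (Z1 := [set i]) _); last by rewrite disjoints1.
  by apply: subset_trans (subD1set _ _); apply: subD1set.
- apply: dpc_perm d0 _ (perm_refl _) _ => //.
  by rewrite (permPl (enumU_perm disE)) perm_cat2l enum_imset_perm.
apply: all2_map_enum => c; rewrite mem_enum => cL; apply: hadj_upd.
by case: (rP c cL) => _ _ cf _ _; apply: fr_neq cf pA.
Qed.

(* [E1] is the mirror image in the copy [i] of the sources [X1] of a fan in the copy [j]; the source [upd u p j], if present, is adjacent to [u] itself. *)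
Lemma fan_join p u j (A1 A2 : {set V}) (X1 X2 : {set V}) (S T' T1 T2 R1 R2 : seq V) (beta : V -> Sg) :
  let i := u p in let E1 := [set upd x p i | x in X1 :\ upd u p j] in
  p \in A -> i != j ->
  [disjoint A1 & A2] -> all (adj u) S ->
  dpc adj A1 S (T1 ++ enum E1 ++ [seq upd x p (beta x) | x <- enum X2] ++ R1) ->
  dpc adj A2 T' T2 -> perm_eq T' (enum X1 ++ enum X2 ++ R2) -> all2 adj R1 R2 ->
  (forall x, x \in X1 -> x p = j) -> (forall x, x \in X2 -> beta x \in fr x) ->
  exists2 S', all (adj u) S' & dpc adj (A1 :|: A2) S' (T1 ++ T2).
Proof.
move=> i E1 pA ij dis aS d1 d2 PT aR X1j bX2.
pose S2 := if upd u p j \in X1 then [:: upd u p j] else [::].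
exists (S ++ S2).
  by rewrite all_cat aS /S2; case: ifP => //= _; rewrite andbT hadj_upd // eq_sym.
pose X1' := X1 :\ upd u p j.
apply: (@dpc_comp _ adj _ _ S S2 T1 T2 ([seq upd x p i | x <- enum X1'] ++ [seq upd x p (beta x) | x <- enum X2] ++ R1)
   (enum X1' ++ enum X2 ++ R2)) => //.
- apply: dpc_perm d1 _ _ _ => //; rewrite perm_cat2l perm_cat2r.
  apply: enum_imset_perm => x y; rewrite !inE => /andP[_ /X1j xj] /andP[_ /X1j yj] E.
  by apply: (upd_inj_val E); rewrite xj.
- apply: dpc_perm d2 _ _ (perm_refl _) => //; rewrite (permPl PT).
  have P : perm_eq (enum X1) (enum X1' ++ S2).
    rewrite /S2 /X1'; have [uX|uX] := boolP (upd u p j \in X1).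
      rewrite perm_sym perm_catC perm_sym -(enum_set1 (upd u p j)) -{1}(setD1K uX).
      by apply: enumU_perm; rewrite disjoints1 !inE eqxx.
    rewrite cats0 (_ : X1 :\ _ = X1) //; apply/setDidPl.
    by rewrite disjoint_sym disjoints1.
  apply/permP => a; move/permP: P => /(_ a); rewrite !count_cat => ->.
  by rewrite -!addnA; congr (_ + _); rewrite addnC -addnA.
apply: all2_cat; last apply: all2_cat => //.
  apply: all2_mapl => x; rewrite mem_enum !inE => /andP[_ /X1j xj].
  by apply: hadj_upd'; rewrite xj.
apply: all2_mapl => x; rewrite mem_enum => /bX2 bx.
by apply: hadj_upd'; apply: fr_neq bx pA.
Qed.

(* The heads of a fan in the copy [j] between [v] and the translate of [t]: those in [X1] have a mirror image in the copy [i], those in [X2] contain [i] and can be reached from the copies indexed by [w x] or by [fr t :\ j]. *)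
Lemma far_fan p t v B : let i := t p in let j := v p in let s := upd t p j in
  p \in A -> t \in G -> v \in G -> i != j -> j \in fr t -> s != v ->
  B \subset sl p [set j] -> B != set0 -> s \notin B -> (forall b, b \in B -> adj b v) ->
  exists T' (X1 X2 : {set V}) (w : V -> Sg),
  [/\ dpc adj (sl p [set j] :\ s :\ v) T' (enum B),
      perm_eq T' (enum X1 ++ enum X2), T' != [::],
      forall x, x \in X1 :|: X2 -> [/\ x \in G, x p = j, adj s x, x != v &
                 [/\ w x \in fr x, w x \notin fr t, w x != i & w x != j]] &
   [/\ forall x, x \in X1 -> i \in fr x,
      forall x, x \in X2 -> i \notin fr x /\ fr t :\ j \subset fr x &
      {in X2 &, injective w}]].
Proof.
move=> i j s pA tG vG ij jt sv BI B0 sB Bv.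
have sG : s \in G by apply: upd_stage.
have sj : s \in sl p [set j] by rewrite in_slice1 sG /s updp eqxx.
have vj : v \in sl p [set j] by rewrite in_slice1 vG eqxx.
have [T' aT d] := cop pA (stage_val vG pA) sj vj sv BI B0 sB Bv.
pose X := [set x in T']; pose X1 := [set x in X | i \in fr x].
(* The symbol of [s] overwritten in [x]; the default [p] is not reached for a head [x], which
   differs from [s]. A head loses the free symbol [i] only if [i] is the symbol written, and then
   [w x] together with [fr t :\ j] is all that is free in it. *)
pose w x := s (odflt p [pick q | x q != s q]).
have XP x : x \in T' -> exists q c, [/\ q \in A, q != p, c \in fr s, x = upd s q c & w x = s q].
  move=> xT; have := dpc_subS d xT; rewrite !inE => /and3P[_ _]; rewrite in_slice1 => /andP[xG /eqP xp].
  have [q [c [qA cs xE]]] := hadj_stage sG xG (allP aT _ xT).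
  have qp : q != p.
    apply: contraNneq (fr_neq cs qA) => E; move: xp; rewrite xE E updp => ->.
    by rewrite /s updp.
  exists q, c; split=> //; rewrite /w; case: pickP => [r|/(_ q)] /=.
    by rewrite xE; have [->//|rq] := eqVneq r q; rewrite updN // eqxx.
  by rewrite xE updp (fr_neq cs qA).
have fs : fr s = i |: (fr t :\ j) by rewrite (fr_upd tG).
have it : i \notin fr t by apply: stage_fr.
exists T', X1, (X :\: X1), w; split=> //.
- apply: uniq_perm; first exact: dpc_uniqS d.
    rewrite cat_uniq !enum_uniq andbT; apply/hasPn => x.
    by rewrite !mem_enum !inE => /andP[/negPf->].
  by move=> x; rewrite mem_cat !mem_enum !inE; case: (x \in T') => //=; case: (i \in fr x).
- by rewrite -size_eq0 (dpc_size d) -cardE cards_eq0.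
- move=> x xX; have xT : x \in T' by move: xX; rewrite !inE => /orP[/andP[]|/andP[]].
  have := dpc_subS d xT; rewrite !inE => /and3P[-> _]; rewrite in_slice1 => /andP[xG /eqP xp].
  have [q [c [qA qp cs xE ->]]] := XP x xT.
  split=> //; first exact: (allP aT).
  have sq : s q = t q by rewrite /s updN.
  rewrite xE (fr_upd sG) // setU11 {1}sq (negPf (stage_fr Y t qA)) sq; split=> //.
    by rewrite /i (stage_inj tG).
  by rewrite eq_sym; apply: fr_neq jt qA.
split=> [x|x|x y]; first by rewrite inE => /andP[].
- rewrite !inE => /andP[+ xT]; rewrite xT /= => ix; split=> //.
  have [q [c [qA qp cs xE _]]] := XP x xT; move: ix; rewrite xE (fr_upd sG) // => ix.
  have ci : c = i.
    apply/eqP; apply: contraNT ix => ci; rewrite in_setU1 in_setD1 (eq_sym i c) ci fs setU11 orbT //.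
  apply/subsetP => d' d't; rewrite in_setU1 in_setD1 fs in_setU1 d't orbT andbT ci.
  by rewrite (_ : d' != i) ?orbT //; apply: contraNneq it => <-; move: d't; rewrite inE => /andP[].
have key z : z \in X :\: X1 -> exists2 q, q \in A & z = upd s q i /\ w z = s q.
  rewrite !inE => /andP[+ zT]; rewrite zT /= => iz.
  have [q [c [qA qp cs zE ->]]] := XP z zT; exists q; rewrite // zE; split=> //.
  congr (upd s q _); apply/eqP; move: iz; rewrite zE (fr_upd sG) //; apply: contraNT => ci.
  by rewrite in_setU1 in_setD1 (eq_sym i c) ci fs setU11 orbT.
move=> /key[q qA [-> ->]] /key[q' q'A [-> ->]] /eqP.
by rewrite (stage_inj sG) // => /eqP->.
Qed.

Lemma stage_split2 p u v t s : let i := u p in let j := v p in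
  p \in A -> u \in G -> v \in G -> t \in sl p [set i] -> s \in sl p [set j] ->
  u != t -> s != v -> i != j ->
  let K := Y :\ i :\ j in
  G :\ u :\ v = (((sl p [set i] :\ u :\ t) :|: sl p K) :|: [set t; s]) :|: (sl p [set j] :\ s :\ v)
  /\ [/\ [disjoint (sl p [set i] :\ u :\ t) :|: sl p K & [set t; s]],
       [disjoint ((sl p [set i] :\ u :\ t) :|: sl p K) :|: [set t; s] & (sl p [set j] :\ s :\ v)]
     & #|K| = #|A| + m - 2].
Proof.
move=> i j pA uG vG ti sj ut sv ij K.
have iY : i \in Y := stage_val uG pA.
have jY : j \in Y := stage_val vG pA.
move: (ti) (sj); rewrite !in_slice1 => /andP[tG /eqP tp] /andP[sG /eqP sp].
have ji : j != i by rewrite eq_sym.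
have cK : #|K| = #|A| + m - 2.
  by move: cY; rewrite (cardsD1 i) iY (cardsD1 j (Y :\ i)) !inE ji jY /K; clear; lia.
(* All that the three set identities use about a single vertex, as Boolean facts: what follows is a
   finite case analysis. *)
have F x : [/\ (x == u) ==> (x p == i), (x == t) ==> (x p == i), (x == v) ==> (x p == j),
    (x == s) ==> (x p == j) & [/\ ~~ ((x p == i) && (x p == j)), ~~ ((x == u) && (x == t)),
    ~~ ((x == s) && (x == v)), (x == t) || (x == s) ==> (x \in G) & (x \in G) ==> (x p \in Y)]].
  do !split; try (by apply/implyP => /eqP->; rewrite ?tp ?sp).
  - by apply/negP => /andP[/eqP->]; rewrite (negPf ij).
  - by apply/negP => /andP[/eqP->]; rewrite (negPf ut).
  - by apply/negP => /andP[/eqP->]; rewrite (negPf sv).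
  - by apply/implyP => /orP[] /eqP->.
  by apply/implyP => xG; apply: (stage_val xG pA).
split; [|split=> //].
- apply/setP => x; rewrite !inE !in_slice1 in_slice !in_setD1.
  case: (F x) => + + + + []; case: (x == u); case: (x == v); case: (x == t); case: (x == s) => //=;
  by case: (x p == i); case: (x p == j); case: (x \in G); case: (x p \in Y).
- rewrite disjoint_subset; apply/subsetP => x; rewrite !inE !in_slice1 in_slice !in_setD1.
  case: (F x) => + + + + []; case: (x == u); case: (x == v); case: (x == t); case: (x == s) => //=;
  by case: (x p == i); case: (x p == j); case: (x \in G); case: (x p \in Y).
rewrite disjoint_subset; apply/subsetP => x; rewrite !inE !in_slice1 in_slice !in_setD1.
case: (F x) => + + + + []; case: (x == u); case: (x == v); case: (x == t); case: (x == s) => //=;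
by case: (x p == i); case: (x p == j); case: (x \in G); case: (x p \in Y).
Qed.

(** Prepares [t := upd u q e]: the symbol [v p] must be free in [t], and [t] must still differ from
    [v] everywhere. If [v p] occurs in [u], its position is the one to overwrite. Otherwise two
    candidate positions suffice, since [e] equals at most one entry of [v]. *)
Lemma ex_pivot p u v : 2 < #|A| -> p \in A -> u \in G -> v \in G ->
  (forall q, q \in A -> u q != v q) ->
  exists q e, [/\ q \in A, q != p, e \in fr u, e != v q /\ e != v p & v p \in fr u \/ u q = v p].
Proof.
move=> A3 pA uG vG uv; have [ju|/(notfr (stage_val vG pA))[q qA uq]] := boolP (v p \in fr u).
  have [e eu] := @ex_free u [:: v p] uG m2; rewrite inE => ej.
  have [q1 q1A] := @ex_pos [:: p] (ltnW A3); rewrite inE => q1p.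
  have [q2 q2A] := @ex_pos [:: p; q1] A3; rewrite !inE negb_or => /andP[q2p q21].
  have [E|N] := eqVneq e (v q1); last by exists q1, e; split=> //; left.
  exists q2, e; split=> //; last by left.
  by split=> //; rewrite E (stage_inj vG) // eq_sym.
have [e eu] := @ex_free u [:: v q] uG m2; rewrite inE => ej.
exists q, e; split=> //; last by right.
  by apply: contraNneq (uv p pA) => E; rewrite -E uq E.
by split=> //; rewrite -uq; apply: fr_neq eu qA.
Qed.

(** Here [t] is a neighbour of [u], and its translate [s] takes over one head of the fan in the copy
    of [v]. As [u p] is not in [dirs p v B], no end lies in the copy of [u]: all ends outside the
    copy of [v] are in the copies [K]. *)
Lemma span_far p u v B : 2 < #|A| -> p \in A -> u \in G -> v \in G ->
  (forall q, q \in A -> u q != v q) -> B \subset G ->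
  (forall b, b \in B -> adj b v) -> B :&: sl p [set v p] != set0 ->
  u p \notin dirs p v B ->
  exists2 S, all (adj u) S & dpc adj (G :\ u :\ v) S (enum B).
Proof.
move=> A3 pA uG vG uv BG Bv Bin0 iD.
have [q0 [e [q0A q0p eu [evq ej] ju]]] := ex_pivot A3 pA uG vG uv.
have PB := nbhd_perm pA vG BG Bv.
set Bin := B :&: _ in Bin0 PB; set D := dirs p v B in iD PB.
have jY := stage_val vG pA; have iY := stage_val uG pA.
have ij : u p != v p := uv p pA.
set j := v p in Bin0 PB ej ju jY ij *; set i := u p in iD ij iY.
pose t := upd u q0 e; pose s := upd t p j.
have tG : t \in G by apply: upd_stage.
have tp : t p = i by rewrite /t updN' // eq_sym.
have ft : fr t = u q0 |: (fr u :\ e) by rewrite (fr_upd uG).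
have jt : j \in fr t.
  by rewrite ft in_setU1 in_setD1 (eq_sym j e) ej; case: ju => ->; rewrite ?eqxx ?orbT.
have ut : u != t by apply: contraNneq (fr_neq eu q0A) => ->; rewrite updp.
have sG : s \in G by apply: upd_stage.
have sp : s p = j by rewrite updp.
have tv q : q \in A -> t q != v q.
  move=> qA; have [->|qq] := eqVneq q q0; first by rewrite updp.
  by rewrite updN // uv.
have [q1 q1A] := @ex_pos [:: p; q0] A3; rewrite !inE negb_or => /andP[q1p q10].
have sv' q : q \in A -> q != p -> s q != v q by move=> qA qp; rewrite updN // tv.
have sv : s != v by apply: contraNneq (sv' _ q1A q1p) => ->.
(* The third position enters here: [s] and [v] differ at both [q0] and [q1], so they are not
   adjacent. *)
have sB : s \notin Bin.
  apply/negP; rewrite inE => /andP[/Bv + _]; apply/negP.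
  by apply: (@hadj_far _ _ s v q1 q0) => //; apply: sv'.
have ij' : t p != v p by rewrite tp.
have Binv b : b \in Bin -> adj b v by rewrite inE => /andP[/Bv].
have := far_fan pA tG vG ij' jt sv (subsetIr _ _) Bin0 sB Binv.
rewrite tp -/j -/s; case=> T' [X1 [X2 [w [dF PT T0 XP [X1i X2i wi]]]]].
pose K := Y :\ i :\ j.
have ti : t \in sl p [set i] by rewrite in_slice1 tG tp eqxx.
have sj : s \in sl p [set j] by rewrite in_slice1 sG sp eqxx.
have [GE [dis1 dis2 cK]] := stage_split2 pA uG vG ti sj ut sv ij.
rewrite -/i -/j -/K in GE dis1 dis2 cK.
have K3 : 2 < #|K| by rewrite cK; move: A3 m2; clear; lia.
have KY : K \subset Y by apply: subset_trans (subD1set _ _) (subD1set _ _).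
have Dfr : D \subset fr v by apply/subsetP => d; apply: dirs_fr.
(* The set [D] may have [m] elements and [fr t :\ j] has [m - 1], so one head may remain without a
   copy of its own. This head, [a0], is the one joined to [s]. *)
have Dm : #|D| <= (#|fr t :\ j|).+1.
  have := subset_leq_card Dfr; rewrite (card_fr vG cY).
  by have := card_fr tG cY; rewrite (cardsD1 j) jt; clear; lia.
have [a0 [X1' [X2' [beta [PT' X1s X2s binj bP]]]]] : exists a0 (X1' X2' : {set V}) (beta : V -> Sg),
   [/\ perm_eq T' (enum X1' ++ enum X2' ++ [:: a0]), X1' \subset X1, X2' \subset X2,
      {in X2' &, injective beta} & forall x, x \in X2' -> beta x \in fr x /\ beta x \notin D].
  have PX (X : {set V}) x : x \in X -> perm_eq (enum X) (enum (X :\ x) ++ [:: x]).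
    move=> xX; rewrite -{1}(setD1K xX) perm_sym perm_catC perm_sym -(enum_set1 x).
    by apply: enumU_perm; rewrite disjoints1 !inE eqxx.
  have [X20|X20] := eqVneq X2 set0.
    have [a0 a0X1] : exists a0, a0 \in X1.
      apply/set0Pn; apply: contraNneq T0 => X10; rewrite -size_eq0 (perm_size PT).
      by rewrite X10 X20 enum_set0.
    exists a0, (X1 :\ a0), set0, w; split=> //; rewrite ?subD1set ?sub0set //.
    - by rewrite (permPl PT) X20 enum_set0 cats0 PX.
    - by move=> x y; rewrite inE.
    by move=> x; rewrite inE.
  have wC x : x \in X2 -> w x \notin fr t :\ j.
    move=> xX; have [|_ _ _ _ [_ wt _ _]] := XP x; first by rewrite inE xX orbT.
    by rewrite inE (negPf wt) andbF.
  have [a0 [beta [a0X2 bi bw bD]]] := assign wi wC Dm X20.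
  exists a0, X1, (X2 :\ a0), beta; split=> //; rewrite ?subD1set //.
    by rewrite (permPl PT) perm_cat2l PX.
  move=> x xX; have x2 : x \in X2 by apply: subsetP xX; apply: subD1set.
  split; last exact: bD.
  have [|_ _ _ _ [wx _ _ _]] := XP x; first by rewrite inE x2 orbT.
  by case/orP: (bw x xX) => [/eqP->//|]; apply: (subsetP (X2i x x2).2).
have XP' x : x \in a0 :: enum X1' ++ enum X2' -> [/\ x \in G, x p = j, adj s x &
   [/\ w x \in fr x, w x \notin fr t & w x != i]].
  move=> xX; have : x \in T' by rewrite (perm_mem PT') catA mem_cat inE orbC -in_cons.
  rewrite (perm_mem PT) mem_cat !mem_enum -in_setU => /XP[xG xp sx _ [w1 w2 w3 _]].
  by split.
have X1P x : x \in X1' -> [/\ x \in G, x p = j, adj s x & i \in fr x].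
  move=> xX; have [|xG xp sx _] := XP' x; first by rewrite inE mem_cat mem_enum xX orbT.
  by split=> //; apply: X1i; apply: (subsetP X1s).
have X2P x : x \in X2' -> [/\ x \in G, x p = j, beta x \in fr x, beta x \notin D & i \notin fr x].
  move=> xX; have [|xG xp _ _] := XP' x; first by rewrite inE mem_cat !mem_enum xX !orbT.
  have [b1 b2] := bP x xX; split=> //; apply: (X2i x _).1; exact: (subsetP X2s).
pose E1 := [set upd x p i | x in X1' :\ upd u p j].
have E1P b : b \in E1 -> [/\ b \in G, b p = i, b != u, adj b t & j \in fr b].
  case/imsetP=> x; rewrite !inE => /andP[xu /X1P[xG xp sx ix]] ->.
  rewrite upd_stage // updp (fr_upd xG) // xp setU11; split=> //.
    by apply: contraNneq xu => <-; rewrite upd_upd -xp upd_id.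
  have -> : t = upd s p i by rewrite /s upd_upd -tp upd_id.
  by apply: hadj_upd_both; rewrite 1?hadj_sym // sp.
have E1i : E1 \subset sl p [set i].
  by apply/subsetP => b /E1P[bG bp _ _ _]; rewrite in_slice1 bG bp eqxx.
have uE1 : u \notin E1 by apply/negP => /E1P[_ _]; rewrite eqxx.
have E1t b : b \in E1 -> adj b t by case/E1P.
pose r c := odflt p [pick q in A | u q == c].
have rP c : c \in K -> c \notin fr u -> [/\ r c \in A, u (r c) = c & r c != p].
  rewrite !inE => /and3P[cj ci cY'] /(notfr cY')[q qA uq].
  have [rA ur] : r c \in A /\ u (r c) = c.
    by rewrite /r; case: pickP => [q' /andP[q'A /eqP]|/(_ q)] //=; rewrite qA uq eqxx.
  by split=> //; apply: contraNneq ci => rp; rewrite -ur rp.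
have rQ c : c \in K -> c \notin fr u -> [/\ r c \in A, r c != p, c \in fr (upd t (r c) j),
     upd t (r c) j != u & upd t (r c) j \notin E1].
  move=> cK' cu; have [rA ur rp] := rP c cK' cu; split=> //.
  - rewrite (fr_upd tG) //; have [E|N] := eqVneq (r c) q0.
      rewrite in_setU1 in_setD1 ft in_setU1 -E ur eqxx andbT.
      by move: cK'; rewrite !inE => /and3P[-> _ _]; rewrite orbT.
    by rewrite in_setU1 /t updN // ur eqxx.
  - apply: contraTneq cK' => E; rewrite -ur -E updp !inE eqxx //.
  apply/negP => /E1P[_ _ _ _] /frP[_ /(_ _ rA)]; by rewrite updp eqxx.
(* A copy that cannot be entered from [u] directly: it is entered from an end of the fan between [u]
   and [t], which therefore has an end even if [E1] is empty. *)
have [q2 [q2A q2p q2j]] : exists q2, [/\ q2 \in A, q2 != p & u q2 != j].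
  exists q1; split=> //; case: ju => [ju|<-]; first by rewrite eq_sym; apply: fr_neq ju q1A.
  by rewrite (stage_inj uG).
have q2K : u q2 \in K by rewrite !inE q2j (stage_val uG q2A) andbT (stage_inj uG).
have q2u : u q2 \notin fr u by apply: stage_fr.
have ts : dpc adj [set t; s] [:: t] [:: s].
  apply: dpc_cons (dpc_single _ s) _ _.
    by rewrite inE; apply: contraNneq ij => E; rewrite -tp -sp E.
  by apply: hadj_upd; apply: fr_neq jt pA.
have sa0 : adj s a0 by case: (XP' a0); rewrite ?mem_head.
pose Ys := [seq upd v p d | d <- enum D] ++ [seq upd x p (beta x) | x <- enum X2'].
have cYs : [seq f p | f : V <- Ys] = enum D ++ [seq beta x | x <- enum X2'].
  by rewrite map_cat upd_coord -map_comp; congr (_ ++ _); apply: eq_map => x /=; rewrite updp.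
have iK : i \notin K by rewrite !inE eqxx andbF.
have jK : j \notin K by rewrite !inE eqxx.
have YsK : {subset Ys <= sl p K}.
  move=> f; rewrite mem_cat => /orP[/mapP[d + ->]|/mapP[x + ->]]; rewrite mem_enum.
    move=> dD; have dv := subsetP Dfr _ dD; rewrite in_slice upd_stage // updp !inE (frY dv).
    by rewrite (fr_neq dv pA) andbT; apply: contraNneq iD => <-.
  move=> /X2P[xG xp bx _ ix]; rewrite in_slice upd_stage // updp !inE (frY bx) andbT -xp.
  by rewrite (fr_neq bx pA); apply: contraNneq ix => <-.
have uYs : uniq [seq f p | f : V <- Ys].
  rewrite cYs cat_uniq enum_uniq map_inj_in_uniq ?enum_uniq ?andbT.
    by apply/hasPn => d /mapP[x + ->]; rewrite !mem_enum => /X2P[].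
  by move=> x y; rewrite !mem_enum; apply: binj.
have Yd y : y \in Ys -> i \notin fr y \/ j \in fr y /\ exists2 q, q != p & y q != u q.
  rewrite mem_cat => /orP[/mapP[d + ->]|/mapP[x + ->]]; rewrite mem_enum.
    move=> dD; have dv := subsetP Dfr _ dD; right; rewrite (fr_upd vG) // setU11; split=> //.
    by exists q1; rewrite // updN // eq_sym uv.
  move=> /X2P[xG xp bx _ ix]; left; rewrite (fr_upd xG) // in_setU1 in_setD1 negb_or negb_and.
  by rewrite xp ij ix orbT.
have X1j x : x \in X1' -> x p = j by case/X1P.
have bX2 x : x \in X2' -> beta x \in fr x by case/X2P.
(* With nothing to link in [K], its copies are swept between [s] and [a0]. The extra end [b] makes
   the fan in the copy of [u] nonempty and is continued by [t], so that [t] is not a head in this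
   case. *)
have [/size0nil Y0|Y0] := posnP (size Ys).
  have /eqP : size Ys = 0 by rewrite Y0.
  rewrite size_cat !size_map -!cardE addn_eq0 !cards_eq0 => /andP[/eqP D0 /eqP X20].
  have [a0G a0p _ [wa wt wI]] := XP' a0 (mem_head _ _).
  have [c1 c1t] := @ex_free t [:: j] tG m2; rewrite inE => c1j.
  have c1s : c1 \in fr s by rewrite (fr_upd tG) // in_setU1 in_setD1 c1j c1t orbT.
  pose b := upd t q2 j.
  have [_ _ _ bu bE1] := rQ _ q2K q2u.
  have ru : r (u q2) = q2.
    by have [rA ur _] := rP _ q2K q2u; apply/eqP; rewrite -(stage_inj uG) ?ur.
  rewrite ru -/b in bu bE1.
  have bG : b \in G by apply: upd_stage.
  have bt : adj b t by apply: hadj_upd'; apply: fr_neq jt q2A.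
  have uI : u \in sl p [set i] by rewrite in_slice1 uG eqxx.
  have [||||S0 aS0 d0] := cop pA iY (B := b |: E1) uI ti ut.
  - by rewrite subUset E1i sub1set in_slice1 bG /b updN' ?tp ?eqxx.
  - by apply/set0Pn; exists b; apply: setU11.
  - by rewrite in_setU1 negb_or uE1 eq_sym bu.
  - by move=> x; rewrite in_setU1 => /orP[/eqP->//|/E1t].
  have blk : dpc adj (sl p K) [:: upd s p c1] [:: upd a0 p (w a0)].
    apply: hp_diff => //.
    - rewrite in_slice upd_stage // updp !inE c1j (frY c1t) andbT.
      by rewrite -tp; apply: fr_neq c1t pA.
    - by rewrite in_slice upd_stage // updp !inE wI (frY wa) -a0p (fr_neq wa pA).
    by rewrite !updp; apply: contraNneq wt => <-.
  have dis3 : [disjoint [set t; s] & sl p K].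
    rewrite disjoints_subset; apply/subsetP => x; rewrite !inE in_slice => /orP[] /eqP->.
      by rewrite tp (negPf iK) andbF.
    by rewrite sp (negPf jK) andbF.
  have d2 := dpc_hp dis3 ts blk (hadj_upd (fr_neq c1s pA)).
  have dis4 : [disjoint sl p [set i] :\ u :\ t & [set t; s] :|: sl p K].
    rewrite disjoint_sym disjoints_subset; apply/subsetP => x; rewrite !inE in_slice1 in_slice.
    case/orP=> [/orP[] /eqP->|/andP[_ xK]]; rewrite ?eqxx //.
      by rewrite sp (eq_sym j) (negPf ij) !andbF.
    by rewrite (_ : _ == i = false) ?andbF //; apply: contraNF iK => /eqP<-.
  have d3 : dpc adj (sl p [set i] :\ u :\ t :|: sl p K :|: [set t; s]) S0
      ([::] ++ enum E1 ++ [seq upd x p (beta x) | x <- enum X2'] ++ [:: upd a0 p (w a0)]).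
    rewrite X20 enum_set0 /= -setUA [_ :|: [set t; s]]setUC -[S0]cats0.
    apply: (@dpc_comp _ adj _ _ S0 [::] (enum E1) [:: upd a0 p (w a0)] [:: b] [:: t] dis4 _ d2).
      apply: dpc_perm d0 _ (perm_refl _) _ => //.
      rewrite (permPl (enumU_perm _)) ?disjoints1 // enum_set1 perm_catC //.
    by rewrite /= bt.
  have aR : all2 adj [:: upd a0 p (w a0)] [:: a0].
    by rewrite /= andbT; apply: hadj_upd'; apply: fr_neq wa pA.
  have [S aS d4] := fan_join pA ij dis2 aS0 d3 dF PT' aR X1j bX2.
  exists S => //; rewrite GE; apply: dpc_perm d4 _ (perm_refl _) _ => //.
  by rewrite -(permPr PB) D0 enum_set0 cats0.
have sYs : size [seq f p | f : V <- Ys] = size Ys by rewrite size_map.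
have [||L [LK cL q2L LH]] := ex_copies K3 q2K uYs.
- by move=> c /mapP[f /YsK + ->]; rewrite in_slice => /andP[].
- by rewrite sYs.
rewrite sYs in cL LH.
have rQ' c : c \in L :\: fr u -> [/\ r c \in A, r c != p, c \in fr (upd t (r c) j),
     upd t (r c) j != u & upd t (r c) j \notin E1].
  by rewrite inE => /andP[cu /(subsetP LK) cK']; apply: rQ.
have rinj : {in L :\: fr u &, injective r}.
  move=> c d; rewrite !inE => /andP[cu /(subsetP LK) cK'] /andP[du /(subsetP LK) dK'] E.
  by case: (rP _ cK' cu) => _ <- _; case: (rP _ dK' du) => _ <- _; rewrite E.
have Ln0 : E1 != set0 \/ L :\: fr u != set0.
  by right; apply/set0Pn; exists (u q2); rewrite inE q2u.
have L0 : 0 < #|L| by rewrite cL.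
have [|S0 aS0 d0] := fan_link pA uG tG tp ut ij jt KY iK jK LK E1i uE1 E1t rQ' rinj Ln0 (esym cL) L0 YsK uYs Yd.
  by rewrite cL.
have d1 := dpcU dis1 d0 ts.
have d3 : dpc adj (sl p [set i] :\ u :\ t :|: sl p K :|: [set t; s]) (S0 ++ [:: t])
      ([seq upd v p d | d <- enum D] ++ enum E1 ++ [seq upd x p (beta x) | x <- enum X2'] ++ [:: s]).
  apply: dpc_perm d1 _ (perm_refl _) _ => //.
  by rewrite -!catA perm_catCA.
have aS1 : all (adj u) (S0 ++ [:: t]).
  by rewrite all_cat aS0 /= andbT; apply: hadj_upd; apply: fr_neq eu q0A.
have aR : all2 adj [:: s] [:: a0] by rewrite /= sa0.
have [S aS d4] := fan_join pA ij dis2 aS1 d3 dF PT' aR X1j bX2.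
exists S => //; rewrite GE; apply: dpc_perm d4 _ (perm_refl _) _ => //.
by rewrite -(permPr PB) perm_catC.
Qed.

(** Now the translate [vi] of [v] to the copy of [u] always belongs to [B], so it must be an end of
    the fan around [t] and hence adjacent to [t]. This dictates [t] as the translate of a neighbour
    [s] of [v]. Such a [t] need not be adjacent to [u]; its path is entered from a fan end [b]
    instead and stops at [s], which is chosen in [B]. *)
Lemma span_disjoint u v B : 2 < #|A| -> u \in G -> v \in G ->
  (forall q, q \in A -> u q \in fr v) -> B \subset G ->
  (forall b, b \in B -> adj b v) -> (forall q, q \in A -> upd v q (u q) \in B) ->
  exists2 S, all (adj u) S & dpc adj (G :\ u :\ v) S (enum B).
Proof.
move=> A3 uG vG uv BG Bv uB.
have vu q : q \in A -> v q \in fr u.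
  move=> qA; apply/frP; split=> [|r rA]; first exact: (stage_val vG qA).
  by apply: fr_neq (uv r rA) qA.
have uvn q : q \in A -> u q != v q by move=> qA; apply: fr_neq (uv q qA) qA.
have mA : #|A| <= m.
  rewrite -(card_fr vG cY) -(@card_in_imset _ _ u) => [|q r qA rA /eqP].
    by apply/subset_leq_card/subsetP => _ /imsetP[q qA ->]; apply: uv.
  by rewrite (stage_inj uG) // => /eqP.
(* Either some [d0] free in [v] gives no end in its copy, which leaves room in [K], or [B] consists
   of all neighbours of [v]. In the latter case [q1 != q2] makes [s] differ from [upd u p j] at two
   positions, so that this vertex is not a head of the fan from [s]. *)
have [p [q1 [q2 [[pA q1A q2A q1p q2p] cases]]]] : exists p q1 q2,
   [/\ p \in A, q1 \in A, q2 \in A, q1 != p & q2 != p] /\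
   [/\ upd v q1 (u q2) \in B &
    (q1 = q2 /\ exists2 d0, d0 \in fr v & upd v p d0 \notin B) \/
    (q1 != q2 /\ forall q c, q \in A -> c \in fr v -> upd v q c \in B)].
  have [/existsP[p /andP[pA /existsP[d0 /andP[d0v d0B]]]]|full] :=
    boolP [exists p in A, [exists d in fr v, upd v p d \notin B]].
    have [q qA] := @ex_pos [:: p] (ltnW A3); rewrite inE => qp.
    by exists p, q, q; split=> //; split; [exact: uB|left; split=> //; exists d0].
  have H q c : q \in A -> c \in fr v -> upd v q c \in B.
    move=> qA cv; apply: contraNT full => n; apply/existsP; exists q; rewrite qA.
    by apply/existsP; exists c; rewrite cv.
  have [p pA _] := @ex_pos [::] (ltnW (ltnW A3)).
  have [q1 q1A] := @ex_pos [:: p] (ltnW A3); rewrite inE => q1p.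
  have [q2 q2A] := @ex_pos [:: p; q1] A3; rewrite !inE negb_or => /andP[q2p q21].
  exists p, q1, q2; split=> //; split; first by apply: H => //; apply: uv.
  by right; split=> //; rewrite eq_sym.
move: cases; set i := u p; set j := v p => -[sB cases].
have jY : j \in Y := stage_val vG pA; have iY : i \in Y := stage_val uG pA.
have ij : i != j := uvn p pA.
have iv : i \in fr v := uv p pA.
have ju : j \in fr u := vu p pA.
pose e := u q2; pose s := upd v q1 e; pose t := upd s p i.
have ev : e \in fr v := uv q2 q2A.
have sG : s \in G by apply: upd_stage.
have sp : s p = j by rewrite /s updN' // eq_sym.
have fs : fr s = v q1 |: (fr v :\ e) by rewrite (fr_upd vG).
have ie : i != e by rewrite (stage_inj uG) // eq_sym.
have is' : i \in fr s by rewrite fs in_setU1 in_setD1 ie iv orbT.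
have tG : t \in G by apply: upd_stage.
have tp : t p = i by rewrite updp.
have ft : fr t = j |: (fr s :\ i) by rewrite (fr_upd sG) // sp.
have jt : j \in fr t by rewrite ft setU11.
have sE : s = upd t p j by rewrite /t upd_upd -sp upd_id.
have [q3 q3A] := @ex_pos [:: p; q1] A3; rewrite !inE negb_or => /andP[q3p q31].
have t3 : t q3 = v q3 by rewrite /t updN // /s updN.
have ut : u != t by apply: contraNneq (uvn q3 q3A) => ->; rewrite t3.
have sv : s != v.
  by apply: contraNneq (fr_neq ev q1A) => E; rewrite -{1}E /s updp.
pose Bj := B :&: sl p [set j]; pose B0 := Bj :\ s.
have B0I : B0 \subset sl p [set j] by apply: subset_trans (subD1set _ _) (subsetIr _ _).
have B0n : B0 != set0.
  apply/set0Pn; exists (upd v q3 (u q3)); rewrite !inE in_slice1 uB //.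
  rewrite upd_stage ?uv // updN' // eqxx !andbT.
  apply: contraNneq (uvn q3 q3A) => /(congr1 (fun f : V => f q3)).
  by rewrite updp /s updN // => ->.
have sB0 : s \notin B0 by rewrite !inE eqxx.
have B0v b : b \in B0 -> adj b v by rewrite !inE => /and3P[_ /Bv].
have ij' : t p != v p by rewrite tp.
have jt' : v p \in fr t by [].
have sv' : upd t p (v p) != v by rewrite -/j -sE.
have sB0' : upd t p (v p) \notin B0 by rewrite -/j -sE.
have := far_fan pA tG vG ij' jt' sv' B0I B0n sB0' B0v.
rewrite tp -/j -sE; case=> T' [X1 [X2 [w [dF PT T0 XP [X1i X2i wi]]]]].
pose K := Y :\ i :\ j.
have ti : t \in sl p [set i] by rewrite in_slice1 tG tp eqxx.
have sj : s \in sl p [set j] by rewrite in_slice1 sG sp eqxx.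
have uI : u \in sl p [set i] by rewrite in_slice1 uG eqxx.
have [GE [dis1 dis2 cK]] := stage_split2 pA uG vG ti sj ut sv ij.
rewrite -/i -/j -/K in GE dis1 dis2 cK.
have KY : K \subset Y by apply: subset_trans (subD1set _ _) (subD1set _ _).
have iK : i \notin K by rewrite !inE eqxx andbF.
have jK : j \notin K by rewrite !inE eqxx.
have ts : dpc adj [set t; s] [:: t] [:: s].
  apply: dpc_cons (dpc_single _ s) _ _.
    by rewrite inE; apply: contraNneq ij => E; rewrite -tp -sp E.
  by rewrite sE; apply: hadj_upd; apply: fr_neq jt pA.
(* Both sides are [m - 1]: since [i] is always a direction of an end and its copy is not in [K], no
   head is left over this time. *)
have cC : #|fr v :\ i| <= #|fr t :\ j|.
  have := card_fr vG cY; have := card_fr tG cY.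
  by rewrite (cardsD1 j) jt (cardsD1 i (fr v)) iv; clear; lia.
have wC x : x \in X2 -> w x \notin fr t :\ j.
  move=> xX; have [|_ _ _ _ [_ wt _ _]] := XP x; first by rewrite inE xX orbT.
  by rewrite inE (negPf wt) andbF.
have [beta [binj bw bD]] := assign_all wi wC cC.
have X2P x : x \in X2 -> [/\ x \in G, x p = j, beta x \in fr x, beta x \notin fr v :\ i & i \notin fr x].
  move=> xX; have [|xG xp _ _ [wx _ _ _]] := XP x; first by rewrite inE xX orbT.
  have [ix sub] := X2i x xX; split=> //; last exact: bD.
  by case/orP: (bw x xX) => [/eqP->//|/(subsetP sub)].
have X1P x : x \in X1 -> [/\ x \in G, x p = j, adj s x, x != v & i \in fr x].
  move=> xX; have [|xG xp sx xv _] := XP x; first by rewrite inE xX.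
  by split=> //; apply: X1i.
pose z := upd u p j.
have zG : z \in G by apply: upd_stage.
pose E1 := [set upd x p i | x in X1 :\ z].
pose vi := upd v p i.
have E1P b : b \in vi |: E1 -> [/\ b \in G, b p = i, b != u, adj b t & j \in fr b].
  rewrite in_setU1 => /orP[/eqP->|/imsetP[x]].
    rewrite upd_stage // updp (fr_upd vG) // setU11; split=> //.
      apply: contraNneq (uvn q3 q3A) => E; rewrite -E updN //.
    by rewrite /t /s updC // /vi; apply: hadj_upd; rewrite updN //; apply: fr_neq ev q1A.
  rewrite !inE => /andP[xu /X1P[xG xp sx xv ix]] ->.
  rewrite upd_stage // updp (fr_upd xG) // xp setU11; split=> //.
    by apply: contraNneq xu => E; rewrite /z -E upd_upd -xp upd_id.
  by rewrite /t; apply: hadj_upd_both; rewrite 1?hadj_sym // sp.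
have viE : vi \notin E1.
  apply/imsetP => -[x]; rewrite !inE => /andP[_ /X1P[xG xp _ xv _]] E.
  by case/eqP: xv; apply/esym; apply: (upd_inj_val E).
(* The symbol [u q2] sits in [t] at [q1] and is freed by overwriting [q1]. If [q1 != q2], the symbol
   [u q1] is already free in [t], so any position serves it; it receives [q2] to keep the assignment
   injective. *)
pose pi q := if q == q1 then q2 else if q == q2 then q1 else q.
have piK : involutive pi.
  move=> q; rewrite /pi; have [->|n1] := eqVneq q q1.
    by rewrite eqxx; case: eqVneq.
  have [->|n2] := eqVneq q q2; first by rewrite eqxx.
  by rewrite (negPf n1) (negPf n2).
have piA q : q \in A -> q != p -> pi q \in A /\ pi q != p.
  by move=> qA qp; rewrite /pi; case: eqP => // _; case: eqP.
have pit q : q \in A -> q != p -> u q \in fr (upd t (pi q) j).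
  move=> qA qp; have [piqA piqp] := piA q qA qp.
  rewrite (fr_upd tG) //; have [E|N] := eqVneq q q2.
    have -> : pi q = q1 by rewrite /pi E eqxx; case: eqVneq.
    by rewrite in_setU1 /t updN // /s updp E eqxx.
  rewrite in_setU1 in_setD1 ft in_setU1 in_setD1 fs in_setU1 in_setD1 uv // andbT.
  by rewrite !(stage_inj uG) // N qp !orbT andbT (fr_neq (uv q qA) pA) !orbT.
pose pos c := odflt p [pick q in A | u q == c].
have posP c : c \in K -> c \notin fr u -> [/\ pos c \in A, u (pos c) = c & pos c != p].
  rewrite !inE => /and3P[cj ci cY'] /(notfr cY')[q qA uq].
  have [rA ur] : pos c \in A /\ u (pos c) = c.
    by rewrite /pos; case: pickP => [q' /andP[q'A /eqP]|/(_ q)] //=; rewrite qA uq eqxx.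
  by split=> //; apply: contraNneq ci => rp; rewrite -ur rp.
(* Everything outside the copy of [v], with [K1] the copies still to be covered. The position
   [pi q0] is reserved for the end [b] that leads to [t] and [s]; excluding [u q0] from [L] keeps
   [b] different from the exits towards the copies in [L]. *)
have core (K1 D1 L : {set Sg}) q0 : q0 \in A -> q0 != p -> K1 \subset K -> L \subset K1 ->
    u q0 \notin L -> D1 \subset fr v :\ i -> D1 \subset K1 ->
    (forall x, x \in X2 -> beta x \in K1) ->
    #|L| = #|D1| + #|X2| -> (#|L| = 0 -> K1 = K) ->
    (#|K1| = #|L|.+1 -> exists2 c, c \in L & c \notin D1 /\ forall x, x \in X2 -> beta x != c) ->
    exists2 S, all (adj u) S & dpc adj ((sl p [set i] :\ u :\ t :|: sl p K1) :|: [set t; s]) S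
      ((vi :: s :: [seq upd v p d | d <- enum D1]) ++ enum E1 ++ [seq upd x p (beta x) | x <- enum X2] ++ [::]).
  move=> q0A q0p K1K LK uL D1v D1K bK cL L0K LH.
  have [pq0A pq0p] := piA q0 q0A q0p.
  have K1Y : K1 \subset Y := subset_trans K1K KY.
  have iK1 : i \notin K1 by apply: contraNN iK; apply: (subsetP K1K).
  have jK1 : j \notin K1 by apply: contraNN jK; apply: (subsetP K1K).
  have nu q : q \in A -> upd t q j != u.
    move=> qA; apply: contraTneq ju => <-; apply/negP => /frP[_ /(_ q qA)].
    by rewrite updp eqxx.
  have nE q : q \in A -> upd t q j \notin vi |: E1.
    by move=> qA; apply/negP => /E1P[_ _ _ _ /frP[_ /(_ q qA)]]; rewrite updp eqxx.
  pose b := upd t (pi q0) j.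
  have bG : b \in G by apply: upd_stage.
  have bt : adj b t by apply: hadj_upd'; apply: fr_neq jt pq0A.
  have bp : b p = i by rewrite /b updN' // tp.
  pose E := b |: (vi |: E1).
  have EI : E \subset sl p [set i].
    apply/subsetP => x; rewrite in_setU1 in_slice1 => /orP[/eqP->|/E1P[-> -> _ _ _]//].
      by rewrite bG bp eqxx.
    exact: eqxx.
  have uE : u \notin E.
    by rewrite in_setU1 negb_or eq_sym nu //=; apply/negP => /E1P[_ _]; rewrite eqxx.
  have Et x : x \in E -> adj x t by rewrite in_setU1 => /orP[/eqP->//|/E1P[]].
  have E0 : E != set0 by apply/set0Pn; exists b; apply: setU11.
  have EP : perm_eq (enum E) (b :: vi :: enum E1).
    rewrite /E (permPl (enumU_perm _)) ?disjoints1 ?nE // enum_set1 perm_cons.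
    by rewrite (permPl (enumU_perm _)) ?disjoints1 // enum_set1.
  have D1fr : D1 \subset fr v := subset_trans D1v (subD1set _ _).
  pose Ys := [seq upd v p d | d <- enum D1] ++ [seq upd x p (beta x) | x <- enum X2].
  have aT S L' M : dpc adj ((sl p [set i] :\ u :\ t :|: sl p K1) :|: [set t; s]) S
      (L' ++ M ++ [:: s]) -> perm_eq L' (vi :: enum E1) -> M = Ys ->
      dpc adj ((sl p [set i] :\ u :\ t :|: sl p K1) :|: [set t; s]) S
       ((vi :: s :: [seq upd v p d | d <- enum D1]) ++ enum E1 ++ [seq upd x p (beta x) | x <- enum X2] ++ [::]).
    move=> d P ME; apply: dpc_perm d _ (perm_refl _) _ => //; rewrite ME.
    apply/permP => a; move/permP: P => /(_ a) P; rewrite !count_cat P /Ys /= ?count_cat /=.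
    by clear; lia.
  have disK : [disjoint sl p K1 & [set t; s]].
    rewrite disjoint_sym disjoints_subset; apply/subsetP => x; rewrite !inE in_slice => /orP[] /eqP->.
      by rewrite tp (negPf iK1) andbF.
    by rewrite sp (negPf jK1) andbF.
  have disI : [disjoint sl p [set i] :\ u :\ t & sl p K1 :|: [set t; s]].
    rewrite disjoint_sym disjoints_subset; apply/subsetP => x; rewrite !inE in_slice1 in_slice.
    case/orP=> [/andP[_ xK]|/orP[] /eqP->]; rewrite ?eqxx //.
      by rewrite (_ : _ == i = false) ?andbF //; apply: contraNF iK1 => /eqP<-.
    by rewrite sp (eq_sym j) (negPf ij) !andbF.
  (* With no copy to link, the path leaving [b] sweeps the whole of [K] before it reaches [t]. *)
  have [L0|L0] := posnP #|L|.
    have [D10 X20] : D1 = set0 /\ X2 = set0.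
      by move/eqP: cL; rewrite L0 eq_sym addn_eq0 !cards_eq0 => /andP[/eqP-> /eqP->].
    have [c1 c1t] := @ex_free t [:: j] tG m2; rewrite inE => c1j.
    have tb : t (pi q0) \in fr b by rewrite (fr_upd tG) // setU11.
    have blk : dpc adj (sl p K1) [:: upd b p (t (pi q0))] [:: upd t p c1].
      apply: hp_diff => //.
      - rewrite in_slice upd_stage // updp L0K // !inE (stage_val tG pq0A) andbT -tp.
        by rewrite (stage_inj tG) // pq0p andbT eq_sym; apply: fr_neq jt pq0A.
      - rewrite in_slice upd_stage // updp L0K // !inE c1j (frY c1t) andbT -tp.
        exact: fr_neq c1t pA.
      by rewrite !updp eq_sym; apply: fr_neq c1t pq0A.
    have d2 := dpc_hp disK blk ts (hadj_upd' (fr_neq c1t pA)).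
    have [S0 aS0 d0] := cop pA iY uI ti ut EI E0 uE Et.
    exists S0 => //; apply: (aT _ (vi :: enum E1) [::]) => //.
      rewrite -setUA -[S0]cats0.
      apply: (@dpc_comp _ adj _ _ S0 [::] (vi :: enum E1) [:: s] [:: b] [:: upd b p (t (pi q0))] disI _ d2).
        apply: dpc_perm d0 _ (perm_refl _) _ => //.
        by rewrite (permPl EP) perm_sym cats1 perm_rcons.
      by rewrite /= andbT; apply: hadj_upd; apply: fr_neq tb pA.
    by rewrite /Ys D10 X20 !enum_set0.
  have LP c : c \in L :\: fr u -> [/\ pos c \in A, u (pos c) = c, pos c != p & pos c != q0].
    rewrite inE => /andP[cu cL']; have [pA' up pp] := posP c (subsetP K1K _ (subsetP LK _ cL')) cu.
    by split=> //; apply: contraNneq uL => <-; rewrite up.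
  have rQ c : c \in L :\: fr u -> [/\ pi (pos c) \in A, pi (pos c) != p, c \in fr (upd t (pi (pos c)) j),
     upd t (pi (pos c)) j != u & upd t (pi (pos c)) j \notin E].
    move=> /LP[pcA upc pcp pcq]; have [pipA pipp] := piA _ pcA pcp.
    rewrite -{3}upc pit // nu //; split=> //; rewrite in_setU1 negb_or nE // andbT.
    apply: contraNneq (fr_neq jt pipA) => /(congr1 (fun f : V => f (pi (pos c)))).
    rewrite updp /b updN; first by move=> ->.
    by apply: contraNneq pcq => /(congr1 pi); rewrite !piK => ->.
  have rinj : {in L :\: fr u &, injective (fun c => pi (pos c))}.
    move=> c d /LP[_ uc _ _] /LP[_ ud _ _] E'; rewrite -uc -ud; congr (u _).
    by apply: (can_inj piK).
  have sYs : size Ys = #|L| by rewrite size_cat !size_map -!cardE.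
  have cYs : [seq f p | f : V <- Ys] = enum D1 ++ [seq beta x | x <- enum X2].
    by rewrite map_cat upd_coord -map_comp; congr (_ ++ _); apply: eq_map => x /=; rewrite updp.
  have YsK : {subset Ys <= sl p K1}.
    move=> f; rewrite mem_cat => /orP[/mapP[d + ->]|/mapP[x + ->]]; rewrite mem_enum.
      by move=> dD; rewrite in_slice upd_stage ?(subsetP D1fr) // updp (subsetP D1K).
    by move=> xX; have [xG xp bx _ ix] := X2P x xX; rewrite in_slice upd_stage // updp bK.
  have uYs : uniq [seq f p | f : V <- Ys].
    rewrite cYs cat_uniq enum_uniq map_inj_in_uniq ?enum_uniq ?andbT.
      apply/hasPn => d /mapP[x + ->]; rewrite !mem_enum => /X2P[_ _ _ + _].
      by apply: contraNN; apply: (subsetP D1v).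
    by move=> x y; rewrite !mem_enum; apply: binj.
  have Yd y : y \in Ys -> i \notin fr y \/ j \in fr y /\ exists2 q, q != p & y q != u q.
    rewrite mem_cat => /orP[/mapP[d + ->]|/mapP[x + ->]]; rewrite mem_enum.
      move=> dD; have dv := subsetP D1fr _ dD; right; rewrite (fr_upd vG) // setU11; split=> //.
      by exists q3; rewrite // updN // eq_sym uvn.
    move=> /X2P[xG xp bx _ ix]; left; rewrite (fr_upd xG) // in_setU1 in_setD1 negb_or negb_and.
    by rewrite xp ij ix orbT.
  have LH' : #|K1| = #|L|.+1 -> exists2 c, c \in L & c \notin [seq f p | f : V <- Ys].
    move/LH=> [c cL' [cD cb]]; exists c => //; rewrite cYs mem_cat mem_enum (negPf cD) /=.
    by apply/mapP => -[x]; rewrite mem_enum => /cb + E'; rewrite E' eqxx.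
  have [S0 aS0 d0] := fan_link pA uG tG tp ut ij jt K1Y iK1 jK1 LK EI uE Et rQ rinj (or_introl E0) sYs L0 YsK uYs Yd LH'.
  exists S0 => //; apply: (aT _ (vi :: enum E1) Ys) => //.
  rewrite catA -[S0]cats0.
  apply: (@dpc_comp _ adj _ _ S0 [::] (((vi :: enum E1) ++ Ys)) [:: s] [:: b] [:: t] _ _ ts).
  - by apply: disjointWl dis1; apply: setUS; apply: sliceS.
  - apply: dpc_perm d0 _ (perm_refl _) _ => //.
    apply/permP => a; have /permP/(_ a) := EP; rewrite !count_cat => -> /=; clear; lia.
  by rewrite /= bt.
have iD : i \in dirs p v B by rewrite inE iv uB.
have sBj : s \in Bj by rewrite inE sB sj.
have PB := nbhd_perm pA vG BG Bv; rewrite -/j -/Bj in PB; set D := dirs p v B in iD PB.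
have Dfr : D \subset fr v by apply/subsetP => d; apply: dirs_fr.
have PBj : perm_eq (enum Bj) (s :: enum B0) by apply: enum_setD1.
have K3 : 3 < #|K| by rewrite cK; move: A3 mA; clear; lia.
have frK d : d \in fr v -> d != i -> d \in K.
  by move=> dv di; rewrite !inE di (frY dv) (fr_neq dv pA).
have bK x : x \in X2 -> beta x \in K.
  move=> /X2P[xG xp bx _ ix]; rewrite !inE (frY bx) -xp (fr_neq bx pA) andbT /=.
  by apply: contraNneq ix => <-.
have bX x : x \in X2 -> beta x \in fr x by case/X2P.
have X1j x : x \in X1 -> x p = j by case/X1P.
have bv x : x \in X2 -> beta x != i -> beta x \notin fr v.
  by move=> /X2P[_ _ _ + _] bi; apply: contraNN => bfr; rewrite !inE bi.
have bi x : x \in X2 -> beta x != i by move=> /bK; apply: contraTneq => ->.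
have cJ (D1 : {set Sg}) : D1 \subset fr v -> #|D1 :|: beta @: X2| = #|D1| + #|X2|.
  move=> D1v; rewrite cardsU (_ : D1 :&: _ = set0) ?cards0 ?subn0 ?card_in_imset //.
  apply/setP => c; rewrite !inE; apply/negP => /andP[/(subsetP D1v) cv /imsetP[x xX E]].
  by have := bv x xX (bi x xX); rewrite -E cv.
case: cases => [[q12 [d0 d0v d0B]]|[q12 full]].
  have d0i : d0 != i by apply: contraNneq d0B => ->; apply: uB.
  have d0K := frK d0 d0v d0i.
  have [q0 [q0A q0p q0d]] : exists q0, [/\ q0 \in A, q0 != p & d0 != u q0].
    have [E|N] := eqVneq d0 (u q1); last by exists q1.
    by exists q3; split=> //; rewrite E (stage_inj uG) // eq_sym.
  have uqK : u q0 \in K by rewrite frK ?uv // (stage_inj uG).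
  (* The copy [d0] contains no end, so there are fewer ends than copies in [K]. This makes room for
     an [L] that omits [u q0], and containing [d0] it satisfies the side condition. *)
  have JK : (D :\ i) :|: beta @: X2 \subset K :\ d0.
    apply/subsetP => c; rewrite in_setU => /orP[|/imsetP[x xX ->]].
      rewrite in_setD1 => /andP[ci cD]; rewrite in_setD1 frK ?(subsetP Dfr) // andbT.
      by apply: contraNneq d0B => <-; move: cD; rewrite inE => /andP[].
    rewrite in_setD1 bK // andbT; apply: contraNneq (bv x xX (bi x xX)) => ->; exact: d0v.
  have D1fr : D :\ i \subset fr v := subset_trans (subD1set _ _) Dfr.
  have := subset_leq_card JK; rewrite cJ // => leJ.
  have [L [LK cL d0L]] : exists L : {set Sg}, [/\ L \subset K :\ u q0,
      #|L| = #|D :\ i| + #|X2| & 0 < #|L| -> d0 \in L].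
    have [n0|n0] := posnP (#|D :\ i| + #|X2|).
      by exists set0; rewrite sub0set cards0 n0.
    have d0K' : d0 \in K :\ u q0 by rewrite in_setD1 q0d.
    have [|Z ZK cZ] := @ex_subset _ (K :\ u q0 :\ d0) (#|D :\ i| + #|X2|).-1.
      have e1 := cardsD1 d0 K; have e2 := cardsD1 (u q0) K.
      have e3 := cardsD1 d0 (K :\ u q0).
      by move: leJ n0 e1 e2 e3; rewrite d0K uqK d0K'; clear; lia.
    exists (d0 |: Z); split.
    - by rewrite subUset sub1set d0K' (subset_trans ZK) ?subD1set.
    - rewrite cardsU1 cZ (_ : d0 \notin Z) ?add1n ?prednK //.
      by apply/negP => /(subsetP ZK); rewrite !inE eqxx.
    by move=> _; apply: setU11.
  have uL : u q0 \notin L by apply/negP => /(subsetP LK); rewrite !inE eqxx.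
  have LK' : L \subset K := subset_trans LK (subD1set _ _).
  have D1K : D :\ i \subset K.
    by apply/subsetP => d; rewrite in_setD1 => /andP[di dD]; apply: frK => //; apply: (subsetP Dfr).
  have LH : #|K| = #|L|.+1 -> exists2 c, c \in L & c \notin D :\ i /\ forall x, x \in X2 -> beta x != c.
    move=> KL; exists d0; first by apply: d0L; move: KL K3; clear; lia.
    split; first by apply/negP => dD; move/subsetP/(_ d0): JK; rewrite in_setU dD !inE eqxx => /(_ isT).
    by move=> x xX; apply: contraNneq (bv x xX (bi x xX)) => ->; exact: d0v.
  have [S aS d1] := core K (D :\ i) L q0 q0A q0p (subxx _) LK' uL (setSD _ Dfr) D1K bK cL (fun _ => erefl) LH.
  have PT' : perm_eq T' (enum X1 ++ enum X2 ++ [::]) by rewrite cats0.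
  have [S' aS' d2] := fan_join pA ij dis2 aS d1 dF PT' (isT : all2 adj [::] [::]) X1j bX.
  exists S' => //; rewrite GE; apply: dpc_perm d2 _ (perm_refl _) _ => //.
  rewrite -(permPr PB); apply/permP => a; have /permP/(_ a) E1' := PBj.
  have /permP/(_ a) := perm_map (fun d => upd v p d) (enum_setD1 iD); rewrite !count_cat E1' => -> /=.
  by rewrite -/vi; clear; lia.
(* Nothing now prevents the ends from occupying every copy of [K], so one of them is served
   differently. The vertex [z], adjacent to [u], lies inside a path of the fan in the copy of [v].
   Cutting that path before [z] produces a free end [y], which is continued through the whole copy
   [g] to the end [upd v p g]; then [g] is removed from [K]. *)
have zs : z != s.
  by apply: contraNneq (uvn q3 q3A) => /(congr1 (fun f : V => f q3)); rewrite /z /s !updN // => ->.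
have zv : z != v.
  by apply: contraNneq (uvn q3 q3A) => /(congr1 (fun f : V => f q3)); rewrite /z !updN // => ->.
have zI : z \in sl p [set j] :\ s :\ v by rewrite !inE zv zs in_slice1 zG updp eqxx.
have zT : z \notin T'.
  rewrite (perm_mem PT) mem_cat !mem_enum -in_setU; apply/negP => /XP[_ _ + _ _]; apply/negP.
  apply: (@hadj_far _ _ s z q3 q1) => //.
    by rewrite /s /z !updN // eq_sym uvn.
  by rewrite /s /z updp updN // (stage_inj uG) // eq_sym.
have [y [yz yI dF']] := dpc_split dF zI zT.
move: yI; rewrite !inE in_slice1 => /and4P[yv ys yG /eqP yp].
have zy : adj z y by rewrite hadj_sym.
have [p' [c [p'A cz yE]]] := hadj_stage zG yG zy.
have p'p : p' != p.
  apply: contraNneq (fr_neq cz p'A) => E; move: yp; rewrite yE E updp => ->.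
  by rewrite /z updp.
pose g := u p'.
have zp' : z p' = g by rewrite /z updN.
have gy : g \in fr y by rewrite yE (fr_upd zG) // zp' setU11.
(* The position [p'] at which [y] departs from [z] plays the part of [q0] in [core]: the omitted
   symbol [u p'] is [g], already absent from [K1]. *)
have gv : g \in fr v := uv p' p'A.
have gi : g != i by rewrite (stage_inj uG).
have gK : g \in K := frK g gv gi.
have [q4 q4A] := @ex_pos [:: p; p'] A3; rewrite !inE negb_or => /andP[q4p q4p'].
have blk : dpc adj (sl p [set g]) [:: upd y p g] [:: upd v p g].
  apply: copy_hp; rewrite ?in_slice1 ?upd_stage ?updp ?eqxx //.
  apply: contraNneq (uvn q4 q4A) => /(congr1 (fun f : V => f q4)).
  by rewrite !(updN _ _ q4p) // yE updN // /z updN // => ->.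
pose K1 := K :\ g; pose D1 := D :\ i :\ g.
have gD : g \in D :\ i by rewrite !inE gi gv full.
have dis5 : [disjoint sl p [set j] :\ s :\ v & sl p [set g]].
  rewrite disjoint_subset; apply/subsetP => x; rewrite !inE !in_slice1 => /and4P[_ _ -> /eqP->].
  by rewrite andTb; apply: contraNneq jK => ->.
have dF2 : dpc adj ((sl p [set j] :\ s :\ v) :|: sl p [set g]) (z :: T') (enum B0 ++ [:: upd v p g]).
  rewrite -[z :: T']cats0.
  apply: (@dpc_comp _ adj _ _ (z :: T') [::] (enum B0) [:: upd v p g] [:: y] [:: upd y p g] dis5 _ blk).
    apply: dpc_perm dF' _ (perm_refl _) _ => //.
    by rewrite perm_sym cats1 perm_rcons.
  by rewrite /= andbT; apply: hadj_upd; apply: fr_neq gy pA.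
have zX1 : z \notin X1.
  by apply: contraNN zT => zX; rewrite (perm_mem PT) mem_cat mem_enum zX.
have X1z : (z |: X1) :\ z = X1 :\ z.
  by apply/setP => x; rewrite !inE; case: eqVneq.
have PT2 : perm_eq (z :: T') (enum (z |: X1) ++ enum X2 ++ [::]).
  rewrite cats0 perm_sym.
  have P : perm_eq (enum (z |: X1)) (z :: enum X1).
    by rewrite (permPl (enumU_perm _)) ?enum_set1 // disjoints1.
  by rewrite (permPl (perm_cat P (perm_refl _))) /= perm_cons perm_sym.
have K1K : K1 \subset K by apply: subD1set.
have D1fr : D1 \subset fr v := subset_trans (subD1set _ _) (subset_trans (subD1set _ _) Dfr).
have D1vi : D1 \subset fr v :\ i := subset_trans (subD1set _ _) (setSD _ Dfr).
have D1K : D1 \subset K1.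
  apply/subsetP => d; rewrite in_setD1 => /andP[dg]; rewrite in_setD1 => /andP[di dD].
  by rewrite in_setD1 dg; apply: frK => //; apply: (subsetP Dfr).
have bK1 x : x \in X2 -> beta x \in K1.
  move=> xX; rewrite in_setD1 bK // andbT; apply: contraNneq (bv x xX (bi x xX)) => ->; exact: gv.
have cK1 : 2 < #|K1| by move: K3; rewrite (cardsD1 g) gK.
have [c1 c1K _] := @ex_notin _ K1 [::] (ltnW (ltnW cK1)).
have D10 : 0 < #|D1|.
  rewrite card_gt0; apply/set0Pn; exists (u q4).
  by rewrite !in_setD1 inE uv // full ?uv // !(stage_inj uG) // q4p q4p'.
pose Js := enum D1 ++ [seq beta x | x <- enum X2].
have sJs : size Js = #|D1| + #|X2| by rewrite size_cat size_map -!cardE.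
have uJs : uniq Js.
  rewrite cat_uniq enum_uniq map_inj_in_uniq ?enum_uniq ?andbT.
    apply/hasPn => d /mapP[x + ->]; rewrite !mem_enum => xX.
    by apply: contraNN (bv x xX (bi x xX)); apply: (subsetP D1fr).
  by move=> x x'; rewrite !mem_enum; apply: binj.
have [||L [LK cL _ LH]] := ex_copies cK1 c1K uJs.
- move=> d; rewrite mem_cat mem_enum => /orP[/(subsetP D1K)//|/mapP[x + ->]].
  by rewrite mem_enum; apply: bK1.
- by rewrite sJs; move: D10; clear; lia.
rewrite sJs in cL LH.
have uL : u p' \notin L by apply/negP => /(subsetP LK); rewrite !inE eqxx.
have LH' : #|K1| = #|L|.+1 -> exists2 c, c \in L & c \notin D1 /\ forall x, x \in X2 -> beta x != c.
  rewrite cL => /LH[d dL]; rewrite mem_cat mem_enum negb_or => /andP[dD db]; exists d => //; split=> // x xX.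
  by apply: contraNneq db => <-; apply: map_f; rewrite mem_enum.
have L0 : #|L| = 0 -> K1 = K by rewrite cL; move: D10; case: #|D1|.
have [S aS d1] := core K1 D1 L p' p'A p'p K1K LK uL D1vi D1K bK1 cL L0 LH'.
have KE : K = K1 :|: [set g] by rewrite setUC setD1K.
have dis6 : [disjoint sl p [set i] :\ u :\ t :|: sl p K1 :|: [set t; s] & (sl p [set j] :\ s :\ v) :|: sl p [set g]].
  rewrite disjoint_sym disjoints_subset subUset -!disjoints_subset.
  apply/andP; split; rewrite disjoint_sym.
    by apply: disjointWl dis2; apply: setSU; apply: setUS; apply: sliceS.
  rewrite disjoint_sym disjoints_subset; apply/subsetP => x; rewrite in_slice1 => /andP[_ /eqP xg].
  rewrite !inE in_slice1 in_slice xg (negPf gi) !andbF /= in_setD1 eqxx andbF /=.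
  apply/negP => /orP[] /eqP E; move: xg gi gK; rewrite E ?tp ?sp => <-.
    by rewrite eqxx.
  by rewrite (negPf jK).
have X1zj x : x \in z |: X1 -> x p = j by rewrite in_setU1 => /orP[/eqP->|/X1j//]; rewrite updp.
rewrite /E1 -X1z in d1.
have [S' aS' d2] := fan_join pA ij dis6 aS d1 dF2 PT2 (isT : all2 adj [::] [::]) X1zj bX.
exists S' => //; apply: dpc_perm d2 _ (perm_refl _) _ => //.
  rewrite GE KE sliceU; apply/setP => x; rewrite !in_setU.
  by case: (x \in sl p [set g]); rewrite ?orbT ?orbF.
rewrite -(permPr PB); apply/permP => a; have /permP/(_ a) E1' := PBj.
have /permP/(_ a) := perm_map (fun d => upd v p d) (enum_setD1 iD); rewrite !count_cat E1' => -> /=.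
have /permP/(_ a) := perm_map (fun d => upd v p d) (enum_setD1 gD); rewrite -/D1 => -> /=.
by rewrite -/vi; clear; lia.
Qed.

(** * Two positions: removing a symbol free in both vertices *)

Section Symbol.
Variables (p q : I).
Hypotheses (AE : A = [set p; q]) (pq : p != q).

Let pA : p \in A. Proof. by rewrite AE !inE eqxx. Qed.
Let qA : q \in A. Proof. by rewrite AE !inE eqxx orbT. Qed.

(** With [b] true, the copy becomes a new path of the fan, from a neighbour of [u] to the end
    [upd v p z]. With [b] false, it is inserted into a fan edge that changes the entry at [q], so
    that the two translates into the copy are distinct. *)
Lemma absorb (u v : V) (z : Sg) (X : {set V}) T qs (b : bool) g g' : u \in G -> v \in G -> z \in fr u -> z \in fr v ->
  u q != v q -> z \in fr g -> z \in fr g' -> g \in G -> g' \in G -> adj g g' -> g q != g' q ->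
  [disjoint X & sl p [set z]] -> rooted adj u X T qs -> (g, g') \in redges u qs ->
  exists2 qs', rooted adj u (X :|: sl p [set z]) (nseq b (upd v p z) ++ T) qs' &
    forall e, e \in redges u qs -> e != (g, g') -> e \in redges u qs'.
Proof.
move=> uG vG zu zv uv zg zg' gG g'G gg' nq dis rt ge.
have hp x y : x \in G -> y \in G -> z \in fr x -> z \in fr y -> x q != y q ->
    dpc adj (sl p [set z]) [:: upd x p z] [:: upd y p z].
  move=> xG yG zx zy xy; apply: copy_hp; rewrite ?in_slice1 ?upd_stage ?updp ?eqxx //.
  by apply: contraNneq xy => /(congr1 (fun f : V => f q)); rewrite !updN' // => ->.
case: b.
  have [qs' r sub] := rooted_add dis rt (hp u v uG vG zu zv uv) (hadj_upd (fr_neq zu pA)).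
  by exists qs' => // e /sub.
apply: rooted_insert dis rt ge (hp g g' gG g'G zg zg' nq) _ _.
  exact: hadj_upd (fr_neq zg pA).
exact: hadj_upd' (fr_neq zg' pA).
Qed.

End Symbol.

Section Two.
Hypothesis m3 : 2 < m.
Hypothesis A2 : #|A| = 2.
Hypothesis IHz : forall z : Sg, z \in Y -> span (stage A (Y :\ z) f0).

Lemma in_avoid (z : Sg) f : z \in Y -> (f \in stage A (Y :\ z) f0) = (f \in G) && (z \in fr f).
Proof.
move=> zY; apply/stageP/andP => [[a b d]|[fG zf]].
  split; first by apply/stageP; split=> // r rA; have := b r rA; rewrite in_setD1 => /andP[].
  by apply/frP; split=> // r rA; have := b r rA; rewrite in_setD1 => /andP[].
case/stageP: (fG) => a b d; split=> // r rA; rewrite in_setD1 b // andbT eq_sym.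
exact: fr_neq zf rA.
Qed.

Lemma span_two u v B : u \in G -> v \in G -> (forall q, q \in A -> u q != v q) ->
  B \subset G -> B != set0 -> u \notin B -> (forall b, b \in B -> adj b v) ->
  exists2 S, all (adj u) S & dpc adj (G :\ u :\ v) S (enum B).
Proof.
move=> uG vG uv BG B0 uB Bv.
(* The two sets of free symbols have [m] elements each inside [Y], of size [m + 2], so they meet
   once [m > 2]. *)
have [z zu zv] : exists2 z : Sg, z \in fr u & z \in fr v.
  have UY : fr u :|: fr v \subset Y by rewrite subUset !sub_fr.
  have : 0 < #|fr u :&: fr v|.
    have := cardsUI (fr u) (fr v); have := subset_leq_card UY.
    rewrite (card_fr vG cY) (card_fr uG cY) cY A2; move: m3; clear; lia.
  by rewrite card_gt0 => /set0Pn[z]; rewrite inE => /andP[zu zv]; exists z.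
have zY := frY zu.
pose V0 := stage A (Y :\ z) f0.
have V0E f : (f \in V0) = (f \in G) && (z \in fr f) by apply: in_avoid.
have uV : u \in V0 by rewrite V0E uG.
have vV : v \in V0 by rewrite V0E vG.
have uvn : u != v.
  have [q qA _] := @ex_pos [::] (ltnW cA).
  by apply: contraNneq (uv q qA) => ->.
pose B1 := B :&: V0.
have inB1 x : (x \in B1) = (x \in B) && (x \in V0) by rewrite in_setI.
have B1B : B1 \subset B by apply: subsetIl.
have VG : V0 \subset G by apply/subsetP => f; rewrite V0E => /andP[].
have out r f : r \in A -> f r = z -> f \notin V0.
  by move=> rA fr'; rewrite V0E negb_and; apply/orP; right; apply/negP => /fr_neq/(_ rA); rewrite fr' eqxx.
have disV r (X : {set V}) : r \in A -> X \subset V0 -> [disjoint X & sl r [set z]].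
  move=> rA XV; rewrite disjoint_subset; apply/subsetP => f /(subsetP XV) fV.
  by rewrite inE in_slice1 negb_and; apply/orP; right; apply: contraTneq fV => /(out r)->.
have fr_neq' f r : z \in fr f -> r \in A -> f r != z by move=> zf rA; rewrite eq_sym; apply: fr_neq zf rA.
have nbB b : b \in B -> b \in V0 \/ exists2 r, r \in A & b = upd v r z.
  move=> bB; have bG := subsetP BG _ bB; have vb : adj v b by rewrite hadj_sym Bv.
  have [r [c [rA cv bE]]] := hadj_stage vG bG vb.
  have [cz|cz] := eqVneq c z; first by right; exists r; rewrite // bE cz.
  by left; rewrite V0E bG bE (fr_upd vG) // in_setU1 in_setD1 (eq_sym z c) cz zv orbT.
have GE r r' : A = [set r; r'] -> r != r' ->
    G = V0 :|: sl r [set z] :|: sl r' [set z] /\ [disjoint V0 :|: sl r [set z] & sl r' [set z]].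
  move=> AE rr'; split.
    apply/setP => f; rewrite !inE V0E !in_slice1 -!andb_orr; apply/esym/andb_idr => fG.
    have [//|/(notfr zY)[q]] := boolP (z \in fr f).
    by rewrite AE !inE => /orP[] /eqP-> ->; rewrite eqxx ?orbT.
  rewrite disjoint_subset; apply/subsetP => f; rewrite !inE !in_slice1 => /orP[fV|/andP[fG /eqP fr']].
    by rewrite negb_and; apply/orP; right; apply: contraTneq fV => /(out r')-> //; rewrite AE !inE eqxx orbT.
  rewrite fG /= -fr' (stage_inj fG) ?AE ?inE ?eqxx ?orbT //.
  by rewrite eq_sym.
(* If [B1] is empty, some [upd v r' c] serves as a temporary end of the fan in [V0], which is then continued through the copy [sl r [set z]] to [upd v r z]. *)
have part r r' : A = [set r; r'] -> r != r' -> (B1 != set0 \/ upd v r z \in B) ->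
   exists2 S, all (adj u) S & dpc adj (G :\ u :\ v) S (enum B).
  move=> AE rr' HB.
  have rA : r \in A by rewrite AE !inE eqxx.
  have r'A : r' \in A by rewrite AE !inE eqxx orbT.
  have AE' : A = [set r'; r] by rewrite setUC.
  have r'r : r' != r by rewrite eq_sym.
  have [GE1 dis1] := GE r r' AE rr'.
  pose P := sl r [set z]; pose P' := sl r' [set z].
  have BP : perm_eq (enum B) (nseq (upd v r z \in B) (upd v r z) ++ nseq (upd v r' z \in B) (upd v r' z) ++ enum B1).
    apply: uniq_perm; rewrite ?enum_uniq //.
      have nv r1 b1 : r1 \in A -> uniq (nseq (b1 : bool) (upd v r1 z) ++ enum B1).
        move=> r1A; case: b1; rewrite /= ?enum_uniq // mem_enum andbT inB1 negb_and.
        by rewrite (out r1) ?updp ?orbT.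
      case: (upd v r z \in B) => /=; rewrite nv // andbT mem_cat mem_nseq mem_enum inB1.
      rewrite (negPf (out r _ rA _)) ?updp // andbF orbF negb_and; apply/orP; right.
      by apply: contraNneq (fr_neq zv rA) => /(congr1 (fun f : V => f r)); rewrite updp updN // => ->.
    move=> b; rewrite !mem_cat !mem_nseq !mem_enum inB1 !lt0b.
    apply/idP/idP => [bB|/or3P[/andP[+ /eqP->]|/andP[+ /eqP->]|/andP[]] //].
    have [bV|[r1 + bE]] := nbB b bB; first by rewrite bB bV !orbT.
    by rewrite AE !inE => /orP[] /eqP r1E; rewrite -r1E -bE bB eqxx ?orbT.
  have XV : V0 :\ u :\ v \subset V0 := subset_trans (subD1set _ _) (subD1set _ _).
  have G'E : G :\ u :\ v = (V0 :\ u :\ v :|: P) :|: P'.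
    apply/setP => x; rewrite GE1 !in_setU !in_setD1 !in_setU.
    have [->|] := eqVneq x v; first by rewrite /= !in_slice1 (negPf (fr_neq' v r zv rA)) (negPf (fr_neq' v r' zv r'A)) !andbF.
    by have [->|] := eqVneq x u; rewrite //= !in_slice1 (negPf (fr_neq' u r zu rA)) (negPf (fr_neq' u r' zu r'A)) !andbF.
  have dis' : [disjoint V0 :\ u :\ v :|: P & P'].
    by apply: disjointWl dis1; apply: setSU.
  have [b0 [B2 [B2V B20 uB2 B2v B2E]]] : exists b0 B2, [/\ B2 \subset V0, B2 != set0, u \notin B2,
      (forall b, b \in B2 -> adj b v) & (b0 = false /\ B2 = B1) \/
      [/\ b0 = true, B1 = set0, upd v r z \in B & exists2 c, c \in fr v & c != z /\ B2 = [set upd v r' c]]].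
    have [B10|B10] := eqVneq B1 set0; last first.
      exists false, B1; split=> //; [exact: subsetIr| |by move=> b /(subsetP B1B)/Bv|by left].
      by apply: contraNN uB; apply: (subsetP B1B).
    have vB : upd v r z \in B by case: HB => //; rewrite B10 eqxx.
    have [c cv] := @ex_free v [:: z] vG m2; rewrite inE => cz.
    exists true, [set upd v r' c]; split.
    - rewrite sub1set V0E upd_stage // (fr_upd vG) // in_setU1 in_setD1 (eq_sym z c) cz zv orbT //.
    - by apply/set0Pn; exists (upd v r' c); rewrite inE.
    - by rewrite inE; apply: contraNneq (uv r rA) => ->; rewrite updN.
    - by move=> b /set1P->; apply: hadj_upd'; apply: fr_neq cv r'A.
    by right; split=> //; exists c.
  have [S aS dS] := IHz zY uV vV uvn B2V B20 uB2 B2v.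
  have [qs rt] := dpc_rooted aS dS.
  (* The fan covers [upd v r2 c], whose entry at [r1] is that of [v] and not that of [u]; hence some
     edge of the fan changes the entry at [r1]. Such an edge can take in the copy with [z] at
     [r2]. *)
  have edge r1 r2 : r1 \in A -> r2 \in A -> r1 != r2 -> exists g g', [/\ (g, g') \in redges u qs,
      g r1 != g' r1, adj g g' & [/\ g \in G, z \in fr g, g' \in G & z \in fr g']].
    move=> r1A r2A r12; have [c cv] := @ex_free v [:: z] vG m2; rewrite inE => cz.
    have fX : upd v r2 c \in V0 :\ u :\ v.
      rewrite !in_setD1 V0E upd_stage // (fr_upd vG) // in_setU1 in_setD1 (eq_sym z c) cz zv orbT !andbT.
      apply/andP; split; first by apply: contraNneq (fr_neq cv r2A) => /(congr1 (fun f : V => f r2)); rewrite updp => ->.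
      by apply: contraNneq (uv r1 r1A) => <-; rewrite updN.
    have hf : upd v r2 c r1 != u r1 by rewrite updN // eq_sym uv.
    have [g [g' [ge ng gg gX gX']]] := rooted_edge (h := fun f : V => f r1) rt fX hf.
    exists g, g'; split=> //; move/(subsetP XV): gX'; rewrite V0E => /andP[-> ->].
    have : g \in V0 by move: gX; rewrite in_setU1 => /orP[/eqP->//|/(subsetP XV)].
    by rewrite V0E => /andP[-> ->].
  have [g1 [g1' [e1 n1 a1 [g1G zg1 g1G' zg1']]]] := edge r' r r'A rA r'r.
  have [g2 [g2' [e2 n2 a2 [g2G zg2 g2G' zg2']]]] := edge r r' rA r'A rr'.
  (* An edge changes a single entry, so the two insertions use different edges and the second edge
     survives the first insertion. *)
  have n12 : (g2, g2') != (g1, g1').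
    by apply/eqP => -[E E']; move: a1; apply/negP; apply: (hadj_far rr'); rewrite // -E -E'.
  case: B2E => [[_ B2E]|[_ B10 vB [c cv [cz B2E]]]].
    have d1 : [disjoint V0 :\ u :\ v & P] by apply: disV.
    have [qs1 rt1 keep] := absorb AE rr' (upd v r z \in B) uG vG zu zv (uv r' r'A) zg1 zg1' g1G g1G' a1 n1 d1 rt e1.
    have [qs2 rt2 _] := absorb AE' r'r (upd v r' z \in B) uG vG zu zv (uv r rA) zg2 zg2' g2G g2G' a2 n2 dis' rt1 (keep _ e2 n12).
    have [S' aS' d'] := rooted_dpc rt2; exists S' => //; rewrite G'E.
    apply: dpc_perm d' _ (perm_refl _) _ => //; rewrite perm_sym (permPl BP) B2E.
    by apply/permP => a; rewrite !count_cat; clear; lia.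
  have d1 : [disjoint V0 :\ u :\ v & P'] by apply: disV.
  have [qs1 rt1 _] := absorb AE' r'r (upd v r' z \in B) uG vG zu zv (uv r rA) zg2 zg2' g2G g2G' a2 n2 d1 rt e2.
  have [S' aS' d'] := rooted_dpc rt1; exists S' => //.
  pose b := upd v r' c.
  have bG : b \in G by apply: upd_stage.
  have zb : z \in fr b by rewrite (fr_upd vG) // in_setU1 in_setD1 (eq_sym z c) cz zv orbT.
  have blk : dpc adj P [:: upd b r z] [:: upd v r z].
    apply: copy_hp; rewrite ?in_slice1 ?upd_stage ?updp ?eqxx //.
    apply: contraNneq (fr_neq cv r'A) => /(congr1 (fun f : V => f r')).
    by rewrite !(updN _ _ r'r) /b updp => ->.
  have dis2 : [disjoint V0 :\ u :\ v :|: P' & P].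
    by apply: disjointWl (GE r' r AE' r'r).2; apply: setSU.
  rewrite G'E (_ : _ :|: P :|: P' = V0 :\ u :\ v :|: P' :|: P); last by rewrite -!setUA [P :|: P']setUC.
  apply: dpc_perm (@dpc_comp _ adj _ _ S' [::] (nseq (upd v r' z \in B) (upd v r' z)) [:: upd v r z] [:: b] [:: upd b r z] dis2 _ blk _) _ _ _ => //.
  - by move: d'; rewrite B2E enum_set1.
  - by rewrite /= andbT; apply: hadj_upd; apply: fr_neq zb rA.
  - by rewrite cats0.
  by rewrite perm_sym (permPl BP) vB B10 enum_set0 cats0 /= cats1 perm_sym perm_rcons.
have [q1 q1A _] := @ex_pos [::] (ltnW cA).
have [q2 q2A] := @ex_pos [:: q1] cA; rewrite inE => q21.
have AE : A = [set q1; q2].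
  apply/esym/eqP; rewrite eqEcard A2 cards2 eq_sym q21 andbT.
  by apply/subsetP => r; rewrite !inE => /orP[] /eqP->.
have [B10|B10] := eqVneq B1 set0; last by apply: (part q1 q2) => //; [rewrite eq_sym|left].
have [b bB] := set0Pn _ B0.
have [bV|[r rA bE]] := nbB b bB; first by move/setP/(_ b): B10; rewrite inB1 inE bB bV.
have vB : upd v r z \in B by rewrite -bE.
have : r \in [set q1; q2] by rewrite -AE.
rewrite !inE => /orP[] /eqP E; rewrite E in vB.
  by apply: (part q1 q2) => //; [rewrite eq_sym|right].
by apply: (part q2 q1) => //; [rewrite setUC|right].
Qed.

End Two.
End Stage.
End Span.

(** * Base cases *)

Section Clique.
Variables I Sg : finType.
Local Notation V := {ffun I -> Sg}.
Local Notation adj := (@hadj I Sg).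

(** All ends but [b] are paths by themselves, and the remaining vertices, in any order finishing
    with [b], form one more path. *)
Lemma span_clique (G : {set V}) : {in G &, forall x y, x != y -> adj x y} -> span G.
Proof.
move=> H u v B uG vG uv BG B0 uB Bv; have [b bB] := set0Pn _ B0.
have vB : v \notin B by apply/negP => /Bv; rewrite hadj_irr.
pose R := (G :\ u :\ v) :\: (B :\ b).
have bR : b \in R.
  by rewrite !inE eqxx (subsetP BG _ bB) andbT /=; apply/andP; split; [apply: contraNneq vB => <-|apply: contraNneq uB => <-].
have RG : R \subset G.
  by apply: subset_trans (subsetDl _ _) _; apply: subset_trans (subD1set _ _) (subD1set _ _).
have [h dR] : exists h, dpc adj R [:: h] [:: b].
  have P : perm_eq (rcons (enum (R :\ b)) b) (enum R).
    by rewrite perm_rcons perm_sym; apply: enum_setD1.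
  case E : (rcons (enum (R :\ b)) b) P => [|h s] P; first by move: (congr1 size E); rewrite size_rcons.
  exists h; have <- : last h s = b by move: (congr1 (last b) E); rewrite last_rcons.
  apply: path_dpc => //; apply: (clique_path H); first by rewrite (perm_uniq P) enum_uniq.
  by move=> x; rewrite (perm_mem P) mem_enum; apply: (subsetP RG).
have GE : G :\ u :\ v = (B :\ b) :|: R.
  apply/setP => x; rewrite !inE; have [xb|xb] := boolP ((x != b) && (x \in B)) => //=.
  case/andP: xb => _ xB; rewrite (subsetP BG _ xB) andbT.
  by apply/andP; split; [apply: contraNneq vB => <-|apply: contraNneq uB => <-].
have dis : [disjoint B :\ b & R].
  by rewrite disjoint_subset; apply/subsetP => x; rewrite !inE => ->.
have d := dpcU dis (dpc_singles _ _) dR; exists (enum (B :\ b) ++ [:: h]).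
  apply/allP => x xS; have := dpc_subS d xS; rewrite -GE !inE => /and3P[_ xu xG].
  by apply: H => //; rewrite eq_sym.
rewrite GE; apply: dpc_perm d _ (perm_refl _) _ => //.
by rewrite cats1 perm_rcons perm_sym; apply: enum_setD1.
Qed.

Lemma span_one (A : {set I}) (Y : {set Sg}) f0 : #|A| = 1 -> span (stage A Y f0).
Proof.
move=> A1; apply: span_clique => x y xG yG xy; have [q qA n] := stage_neq xG yG xy.
apply/hadjP; exists q; split=> //; apply/ffunP => r; rewrite updE; case: eqP => [->//|/eqP rq].
have rA : r \notin A.
  by move/eqP/cards1P: A1 => [q' E]; move: qA rq; rewrite E !inE => /eqP->.
by case/stageP: xG => a _ _; case/stageP: yG => b _ _; rewrite a // b.
Qed.

End Clique.

(* A_{4,2} with symbols 0..3, coded so that [v] is [(0, 1)]; [nbrs4] lists the neighbours of [v]. *)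
Definition adj4 (x y : nat * nat) := if x.1 == y.1 then x.2 != y.2 else x.2 == y.2.
Definition verts4 := [seq x <- [seq (a, b) | a <- iota 0 4, b <- iota 0 4] | x.1 != x.2].
Definition nbrs4 := [:: (2, 1); (3, 1); (0, 2); (0, 3)].

Fixpoint first_some (T U : Type) (f : T -> option U) (s : seq T) :=
  if s is x :: s' then (if f x is Some y then Some y else first_some f s') else None.

(** Backtracking search for a fan from [u]: [cur] is the current path reversed and [acc] holds the
    finished ones. A path is closed as soon as it meets a target, since targets must be ends. The
    search needs no correctness proof, because [good4] checks its result. *)
Fixpoint dfs n u (x : nat * nat) left targets cur acc : option (seq (seq (nat * nat))) :=
  if n is n'.+1 then
    let left' := rem x left in
    if x \in targets then
      let targets' := rem x targets in
      let acc' := rev (x :: cur) :: acc in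
      if nilp targets' then (if nilp left' then Some acc' else None)
      else first_some (fun y => dfs n' u y left' targets' [::] acc') [seq y <- left' | adj4 u y]
    else first_some (fun y => dfs n' u y left' targets (x :: cur) acc) [seq y <- left' | adj4 x y]
  else None.

Definition others4 u := [seq x <- verts4 | (x != u) && (x != (0, 1))].

(** For [u] other than [(0, 1)] there are ten vertices to place and each call removes one, so the
    fuel 11 is not exhausted. *)
Definition cover4 u targets :=
  first_some (fun y => dfs 11 u y (others4 u) targets [::] [::]) [seq y <- others4 u | adj4 u y].

Definition good4 u targets := if cover4 u targets is Some ps then
  [&& all (fun q => (q != [::]) && path adj4 u q) ps,
      perm_eq (flatten ps) (others4 u) & perm_eq (map (last u) ps) targets] else false.

Definition bools4 := [seq [:: a.1; a.2; b.1; b.2] | a <- [:: (true,true);(true,false);(false,true);(false,false)],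
   b <- [:: (true,true);(true,false);(false,true);(false,false)]].

Lemma good4_all : all (fun u => (u == (0, 1)) || all (fun m => let t := mask m nbrs4 in
   [|| nilp t, u \in t | good4 u t]) bools4) verts4.
Proof. by vm_compute. Qed.

Section Four.
Variables I Sg : finType.
Local Notation V := {ffun I -> Sg}.
Local Notation adj := (@hadj I Sg).

Lemma span_four (A : {set I}) (Y : {set Sg}) f0 : #|A| = 2 -> #|Y| = 4 -> span (stage A Y f0).
Proof.
move=> A2 Y4 u v B uG vG uv BG B0 uB Bv; set G := stage A Y f0 in uG vG BG *.
have [p [q [pq AE]]] : exists p q, p != q /\ A = [set p; q].
  exact/cards2P/eqP.
have pA : p \in A by rewrite AE !inE eqxx.
have qA : q \in A by rewrite AE !inE eqxx orbT.
have : #|free A Y v| = 2 by apply: (card_fr vG); rewrite Y4 A2.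
rewrite cardE; case E: (enum _) => [|c2 [|c3 [|? ?]]] // _.
have memfr c : (c \in free A Y v) = (c \in [:: c2; c3]) by rewrite -mem_enum E.
pose ys := [:: v p; v q; c2; c3]; pose y a := nth (v p) ys a.
have mem_ys c : (c \in Y) = (c \in ys).
  rewrite /ys in_cons (in_cons (v q)) -memfr.
  apply/idP/or3P => [cY|[/eqP->|/eqP->|/frY//]]; rewrite ?(stage_val vG) //.
  have [cf|/(notfr cY)[r + <-]] := boolP (c \in free A Y v); first by constructor 3.
  by rewrite AE !inE => /orP[] /eqP->; rewrite eqxx; [constructor 1|constructor 2].
have uys : uniq ys.
  have: uniq (enum (free A Y v)) := enum_uniq _.
  rewrite E /= => /andP[-> _]; rewrite !inE andbT !negb_or (stage_inj vG) // pq /=.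
  have c2f : c2 \in free A Y v by rewrite memfr !inE eqxx.
  have c3f : c3 \in free A Y v by rewrite memfr !inE eqxx orbT.
  by rewrite ![v _ == _]eq_sym !(fr_neq c2f) // !(fr_neq c3f).
pose phi (x : nat * nat) : V := upd (upd v p (y x.1)) q (y x.2).
pose psi (f : V) := (index (f p) ys, index (f q) ys).
have phip x : phi x p = y x.1 by rewrite /phi updN // updp.
have phiq x : phi x q = y x.2 by rewrite /phi updp.
have mem4 x : (x \in verts4) = [&& x.1 < 4, x.2 < 4 & x.1 != x.2].
  case: x => a b; rewrite mem_filter andbC; apply/andP/and3P => -[]; last first.
    by move=> a4 b4 ab; split=> //; apply/allpairsP; exists (a, b); rewrite !mem_iota.
  by case/allpairsP=> -[a' b'] [+ + [-> ->]]; rewrite !mem_iota.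
have y_inj a b : a < 4 -> b < 4 -> (y a == y b) = (a == b) by move=> *; rewrite /y nth_uniq.
have phiK : {in verts4, cancel phi psi}.
  move=> [a b]; rewrite mem4 /= => /and3P[a4 b4 _].
  by rewrite /psi phip phiq /y !index_uniq.
have phiG x : x \in verts4 -> phi x \in G.
  rewrite mem4 => /and3P[a4 b4 ab]; case/stageP: (vG) => aux _ _.
  apply/stageP; split=> [r|r|r r'].
  - by rewrite AE !inE negb_or => /andP[rp rq]; rewrite /phi !updN // aux // AE !inE negb_or rp.
  - by rewrite AE !inE => /orP[] /eqP->; rewrite ?phip ?phiq mem_ys mem_nth.
  rewrite AE !inE => /orP[] /eqP-> /orP[] /eqP->; rewrite ?phip ?phiq // => /eqP.
    by rewrite y_inj // (negPf ab).
  by rewrite y_inj // eq_sym (negPf ab).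
have psiK : {in G, cancel psi phi}.
  move=> f fG; apply/ffunP => r; have [->|rp] := eqVneq r p.
    by rewrite phip /y nth_index // -mem_ys (stage_val fG).
  have [->|rq] := eqVneq r q; first by rewrite phiq /y nth_index // -mem_ys (stage_val fG).
  case/stageP: (vG) => aux _ _; case/stageP: (fG) => aux' _ _.
  by rewrite /phi !updN // aux ?aux' // AE !inE negb_or rp rq.
have psiV f : f \in G -> psi f \in verts4.
  move=> fG; have idx r : r \in A -> index (f r) ys < 4.
    by move=> rA; rewrite -[4]/(size ys) index_mem -mem_ys (stage_val fG).
  rewrite mem4; apply/and3P; split; [exact: idx|exact: idx|].
  apply: contraNneq pq => /(congr1 y); rewrite /y !nth_index -?mem_ys ?(stage_val fG) //.
  by move/eqP; rewrite (stage_inj fG).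
have phi_adj x x' : x \in verts4 -> x' \in verts4 -> adj4 x x' -> adj (phi x) (phi x').
  rewrite !mem4 /adj4 => /and3P[a4 b4 _] /and3P[a4' b4' _].
  case: eqVneq => [E1|n1 /eqP E2].
    by move=> n2; rewrite /phi E1; apply: hadj_upd2; rewrite y_inj.
  rewrite /phi E2 !(updC _ _ _ pq); apply: hadj_upd2; by rewrite y_inj.
have v4 : (0, 1) \in verts4 by [].
have phiv : phi (0, 1) = v by rewrite /phi /= upd_id /y /= upd_id.
have nbr f : f \in G -> adj f v -> psi f \in nbrs4.
  move=> fG; rewrite hadj_sym => /(hadj_stage vG fG)[r [c [rA + fE]]].
  have iq : index (v q) ys = 1 by rewrite /ys /= (stage_inj vG) // (negPf pq) eqxx.
  have i2 : index c2 ys = 2 by rewrite -[RHS](@index_uniq _ (v p) 2 ys).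
  have i3 : index c3 ys = 3 by rewrite -[RHS](@index_uniq _ (v p) 3 ys).
  rewrite memfr /psi fE; move: rA; rewrite AE !inE => /orP[] /eqP-> /orP[] /eqP->.
  - by rewrite updp updN' // i2 iq.
  - by rewrite updp updN' // i3 iq.
  - by rewrite updp updN // i2 /= eqxx.
  by rewrite updp updN // i3 /= eqxx.
pose u4 := psi u; pose ms := [seq phi x \in B | x <- nbrs4]; pose t := mask ms nbrs4.
have u4V : u4 \in verts4 by apply: psiV.
have phiu : phi u4 = u by apply: psiK.
have nV x : x \in nbrs4 -> x \in verts4 by rewrite !inE => /or4P[] /eqP->.
(* The targets form a sublist of [nbrs4] given by a mask, so the computation over all sixteen masks
   covers every [B]. *)
have tE : t = [seq x <- nbrs4 | phi x \in B] by rewrite filter_mask.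
have msb : ms \in bools4.
  by rewrite /ms /=; do 4![case: (_ \in B)].
have inj4 : {in verts4 &, injective phi} := can_in_inj phiK.
have tB : perm_eq (map phi t) (enum B).
  apply: uniq_perm; rewrite ?enum_uniq //.
    rewrite map_inj_in_uniq ?tE ?filter_uniq // => x x'; rewrite !mem_filter.
    by move=> /andP[_ /nV xV] /andP[_ /nV x'V]; apply: inj4.
  move=> b; rewrite mem_enum tE; apply/mapP/idP => [[x + ->]|bB]; first by rewrite mem_filter => /andP[].
  have bG := subsetP BG _ bB.
  by exists (psi b); rewrite ?psiK // mem_filter psiK // bB nbr // Bv.
have := allP good4_all _ u4V; case/orP=> [/eqP E0|/allP/(_ _ msb)].
  by case/eqP: uv; rewrite -phiu E0 phiv.
rewrite -/t; case/or3P=> [/nilP t0|ut|].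
- by have := perm_size tB; rewrite t0 /= => /esym/eqP; rewrite -cardE cards_eq0 (negPf B0).
- by case/negP: uB; rewrite -mem_enum -(perm_mem tB) -phiu map_f.
rewrite /good4; case: (cover4 u4 t) => // ps /and3P[wf pf pl].
have memo x : (x \in others4 u4) = ((x != u4) && (x != (0, 1))) && (x \in verts4).
  by rewrite mem_filter.
have oG : perm_eq (map phi (others4 u4)) (enum (G :\ u :\ v)).
  apply: uniq_perm; rewrite ?enum_uniq //.
    rewrite map_inj_in_uniq ?filter_uniq // => x x'; rewrite !memo.
    by move=> /andP[_ xV] /andP[_ x'V]; apply: inj4.
  move=> f; rewrite mem_enum !inE; apply/mapP/and3P => [[x + ->]|[fv fu fG]].
    rewrite memo => /andP[/andP[xu xv] xV]; rewrite phiG //; split=> //.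
      by rewrite -phiv; apply: contraNneq xv => /inj4->.
    by rewrite -phiu; apply: contraNneq xu => /inj4->.
  exists (psi f); rewrite ?psiK // memo psiV // andbT; apply/andP; split.
    by apply: contraNneq fu => E0; rewrite -phiu -E0 psiK.
  by apply: contraNneq fv => E0; rewrite -phiv -E0 psiK.
have mps x s : s \in ps -> x \in s -> x \in verts4.
  move=> sps xs; have : x \in others4 u4 by rewrite -(perm_mem pf); apply/flattenP; exists s.
  by rewrite memo => /andP[].
have pathphi x0 s : x0 \in verts4 -> {subset s <= verts4} -> path adj4 x0 s ->
    path adj (phi x0) (map phi s).
  elim: s x0 => //= x s IH x0 x0V sub /andP[xx ps'].
  have xV : x \in verts4 by apply: sub; rewrite mem_head.
  by rewrite phi_adj //= IH // => x' x's; apply: sub; rewrite inE x's orbT.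
have [S aS d] : exists2 S, all (adj u) S & dpc adj (G :\ u :\ v) S (map phi t).
  apply: (rooted_dpc (qs := map (map phi) ps)); split.
  - apply/allP => s /mapP[s' s's ->]; have /andP[n0 ps'] := allP wf _ s's.
    rewrite -size_eq0 size_map size_eq0 n0 /= -phiu.
    by apply: pathphi => // x; apply: mps.
  - by rewrite -map_flatten -(permPr oG) perm_map.
  rewrite -map_comp -(permPr (perm_map phi pl)) -map_comp (_ : map _ ps = map (phi \o last u4) ps) //.
  by apply: eq_map => s /=; rewrite -phiu last_map.
by exists S => //; apply: dpc_perm d _ _ tB.
Qed.

End Four.

(** * Conclusion *)

Section Induction.
Variables I Sg : finType.
Local Notation V := {ffun I -> Sg}.
Local Notation adj := (@hadj I Sg).
Implicit Types (A : {set I}) (Y : {set Sg}).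

Lemma span_copies A Y (f0 : V) m n : #|A| = n.+1 -> #|Y| = n.+1 + m ->
  (forall A' Y' f0', #|A'| = n -> #|Y'| = n + m -> span (stage A' Y' f0')) ->
  forall p c, p \in A -> c \in Y -> span (slice A Y f0 p [set c]).
Proof.
move=> cA cY IH p c pA cY'; rewrite stage_copy //; apply: IH.
  by move: cA; rewrite (cardsD1 p) pA => -[].
by move: cY; rewrite (cardsD1 c) cY' => -[].
Qed.

(** Induction on [m] from the computed case [m = 2], since dropping a symbol lowers [m] and keeps
    both positions. The copies have one position and are cliques, so the agreeing case can be reused
    as soon as [m > 2]. *)
Lemma span_pair m A Y (f0 : V) : 1 < m -> #|A| = 2 -> #|Y| = 2 + m -> span (stage A Y f0).
Proof.
elim: m Y => // m IH Y; rewrite ltnS => m1 cA cY; have [m2|m2] := leqP m 1.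
  have mE : m = 1 by apply/eqP; rewrite eqn_leq m2.
  by apply: span_four => //; rewrite cY mE.
have cop := span_copies cA cY (fun A' Y' f0' h1 _ => @span_one _ _ A' Y' f0' h1) (f0 := f0).
have cY' : #|Y| = #|A| + m.+1 by rewrite cA.
have cA' : 1 < #|A| by rewrite cA.
move=> u v B uG vG uv BG B0 uB Bv.
have [/existsP[p /andP[pA /eqP uvp]]|/existsPn dis] := boolP [exists p in A, u p == v p].
  by apply: (span_agree cY' _ cA' cop _ pA uvp) => //; rewrite ltnS m2 orbT.
apply: (span_two cY' _ cA' cop) => //.
- by move=> z zY; apply: IH => //; move: cY; rewrite (cardsD1 z) zY => -[].
by move=> q qA; have := dis q; rewrite qA.
Qed.

Lemma span_stage m n A Y (f0 : V) : 1 < m -> #|A| = n.+1 -> #|Y| = n.+1 + m -> span (stage A Y f0).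
Proof.
move=> m2; elim: n A Y f0 => [|n IH] A Y f0 cA cY; first exact: span_one.
case: n IH cA cY => [_|n IH] cA cY; first exact: span_pair m2 cA cY.
have cop := span_copies cA cY IH (f0 := f0).
have cY' : #|Y| = #|A| + m by rewrite cA.
have A3 : 2 < #|A| by rewrite cA.
have cA' : 1 < #|A| by rewrite cA.
have big : (2 < #|A|) || (2 < m) by rewrite A3.
move=> u v B uG vG uv BG B0 uB Bv.
have [/existsP[p /andP[pA /eqP uvp]]|/existsPn dis] := boolP [exists p in A, u p == v p].
  exact: (span_agree cY' m2 cA' cop big pA uvp).
have uvn q : q \in A -> u q != v q by move=> qA; have := dis q; rewrite qA.
have [/existsP[p /andP[pA pD]]|/existsPn full] := boolP [exists p in A, u p \notin dirs A Y p v B].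
  (* If no element of [B] lies in the copy of [v] at [p], all of [B] is obtained from [v] by
     changing the entry at [p]. Any other position [q] then meets the requirements of [span_far]. *)
  have [Bp|Bp] := eqVneq (B :&: slice A Y f0 p [set v p]) set0; last first.
    exact: (span_far cY' m2 cA' cop big A3 pA).
  have [q qA] := @ex_pos _ A [:: p] cA'; rewrite inE => qp.
  have Bv' b : b \in B -> exists2 c, c \in free A Y v & b = upd v p c.
    move=> bB; have bG := subsetP BG _ bB; have vb : adj v b by rewrite hadj_sym Bv.
    have [r [c [rA cv bE]]] := hadj_stage vG bG vb.
    have [E|rp] := eqVneq r p; first by exists c; rewrite // bE E.
    by move/setP/(_ b): Bp; rewrite !inE in_slice1 bB bG bE updN' // eqxx.
  apply: (span_far cY' m2 cA' cop big A3 qA) => //.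
    have [b bB] := set0Pn _ B0; apply/set0Pn; exists b; rewrite inE bB in_slice1 (subsetP BG _ bB).
    by have [c _ ->] := Bv' b bB; rewrite updN // eqxx.
  apply/negP; rewrite inE => /andP[uv' /Bv'[c cv /(congr1 (fun f : V => f q))]].
  rewrite updp updN // => E; move: (uvn q qA); by rewrite E eqxx.
have fullP q : q \in A -> u q \in free A Y v /\ upd v q (u q) \in B.
  by move=> qA; have := full q; rewrite qA negbK inE => /andP[].
by apply: (span_disjoint cY' m2 cA' cop big A3) => // q /fullP[].
Qed.

End Induction.

(** * From fans to containers *)

Lemma uniq_flatten_nth (T : eqType) (ss : seq (seq T)) i j x : uniq (flatten ss) ->
  i < size ss -> j < size ss -> x \in nth [::] ss i -> x \in nth [::] ss j -> i = j.
Proof.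
elim: ss i j => [|s ss IH] [|i] [|j] //=; rewrite cat_uniq => /and3P[_ /hasPn n u] // i1 j1 xi xj.
- have : x \in flatten ss by apply/flattenP; exists (nth [::] ss j) => //; apply: mem_nth.
  by move/n; rewrite xi.
- have : x \in flatten ss by apply/flattenP; exists (nth [::] ss i) => //; apply: mem_nth.
  by move/n; rewrite xj.
by congr _.+1; apply: IH xi xj.
Qed.

Lemma count_nth (T : Type) (a : pred T) (x0 : T) (s : seq T) i j : count a s <= 1 ->
  i < size s -> j < size s -> a (nth x0 s i) -> a (nth x0 s j) -> i = j.
Proof.
elim: s i j => [|x s IH] [|i] [|j] //= c i1 j1 ai aj.
- have : has a s by apply/(has_nthP x0); exists j.
  by rewrite has_count; move: c; rewrite ai; case: (count a s).
- have : has a s by apply/(has_nthP x0); exists i.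
  by rewrite has_count; move: c; rewrite aj; case: (count a s).
by congr _.+1; apply: IH => //; apply: leq_trans c; apply: leq_addl.
Qed.

Section Container.
Variables (V W : finType) (adj : rel V) (adjW : rel W) (w : W -> V) (G : {set V}).
Hypotheses (w_inj : injective w) (w_adj : forall x y, adjW x y = adj (w x) (w y)).
Hypotheses (wG : forall x, w x \in G) (Gw : forall f, f \in G -> exists x, w x = f).

(* [inner] lists the interiors of the paths; the empty one stands for the edge from [u] to [v]. *)
Lemma star_container u v (inner : seq (seq V)) : w u != w v ->
  perm_eq (flatten inner) (enum (G :\ w u :\ w v)) ->
  all (fun s => path adj (w u) (rcons s (w v))) inner -> count (@nilp V) inner <= 1 ->
  0 < size inner ->
  exists P : 'I_(size inner) -> seq W, is_star_container adjW u v P.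
Proof.
move=> uv pf wf c1 s0.
pose g f := odflt u [pick x | w x == f].
have gK f : f \in G -> w (g f) = f.
  by case/Gw=> x <-; rewrite /g; case: pickP => [y /eqP//|/(_ x)]; rewrite eqxx.
have wK x : g (w x) = x by apply: w_inj; apply: gK.
have uf : uniq (flatten inner) by rewrite (perm_uniq pf) enum_uniq.
have inG s x : s \in inner -> x \in s -> [/\ x \in G, x != w u & x != w v].
  move=> si xs; have : x \in flatten inner by apply/flattenP; exists s.
  by rewrite (perm_mem pf) mem_enum !inE => /and3P[].
exists (fun i => u :: rcons (map g (nth [::] inner i)) v); split; first split.
- move=> i; have si : nth [::] inner i \in inner by apply: mem_nth.
  move: si (allP wf _ si); set s := nth _ _ _ => si ps.
  exists (rcons (map g s) v); split=> //; first by rewrite last_rcons.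
    have key s' x : {subset s' <= G} -> path adj (w x) (rcons s' (w v)) -> path adjW x (rcons (map g s') v).
      elim: s' x => [|y s' IH] x sub /=; rewrite ?andbT w_adj //.
      have yG : y \in G by apply: sub; rewrite mem_head.
      rewrite gK // => /andP[-> py]; apply: IH; last by rewrite gK.
      by move=> z zs; apply: sub; rewrite inE zs orbT.
    by apply: key => // x xs; case: (inG s x si xs).
  rewrite /= mem_rcons inE rcons_uniq negb_or (contraNneq _ uv) => [|->//].
  have nx x : x \in [:: u; v] -> x \notin map g s.
    move=> xuv; apply/mapP => -[y ys E]; have [yG yu yv] := inG s y si ys.
    move: xuv; rewrite E !inE => /orP[] /eqP E'; [case/eqP: yu|case/eqP: yv]; by rewrite -E' gK.
  rewrite !nx ?inE ?eqxx ?orbT //= map_inj_in_uniq.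
    by move: uf; rewrite -(cat_take_drop i inner) (drop_nth [::]) // flatten_cat /= !cat_uniq => /and3P[_ _ /and3P[]].
  move=> x y xs ys E; have [xG _ _] := inG s x si xs; have [yG _ _] := inG s y si ys.
  by rewrite -(gK x) // E gK.
- move=> i j ij; have si : nth [::] inner i \in inner by apply: mem_nth.
  have sj : nth [::] inner j \in inner by apply: mem_nth.
  have dis x : x \in nth [::] inner i -> x \in nth [::] inner j -> False.
    move=> xi xj; case/eqP: ij; apply: val_inj => /=.
    exact: (uniq_flatten_nth uf (ltn_ord i) (ltn_ord j) xi xj).
  split=> [[/rcons_inj[E]]|x].
    have E' : nth [::] inner i = nth [::] inner j.
      have K s : s \in inner -> map w (map g s) = s.
        move=> si'; rewrite -map_comp -[RHS]map_id; apply/eq_in_map => x xs /=.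
        by rewrite gK //; case: (inG s x si' xs).
      by rewrite -(K _ si) -(K _ sj) E.
    case Ei : (nth [::] inner i) => [|x s]; last first.
      by apply: (dis x); rewrite -?E' Ei mem_head.
    have Ej : nth [::] inner j = [::] by rewrite -E'.
    by case/eqP: ij; apply: val_inj; apply: (count_nth (x0 := [::]) c1); rewrite ?ltn_ord ?Ei ?Ej.
  rewrite !inE !mem_rcons !inE.
  case/or3P=> [/eqP->|/eqP->|/mapP[y yi ->]]; [by left|by right|].
  have [yG yu yv] := inG _ y si yi.
  case/or3P=> [/eqP E|/eqP E|/mapP[z zj E]]; [by left|by right|].
  case: (dis y) => //; have [zG _ _] := inG _ z sj zj.
  by rewrite -(gK y) // E gK.
move=> x; have [->|xu] := eqVneq x u; first by exists (Ordinal s0); rewrite mem_head.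
have [->|xv] := eqVneq x v; first by exists (Ordinal s0); rewrite inE mem_rcons inE eqxx orbT.
have : w x \in flatten inner by rewrite (perm_mem pf) mem_enum !inE wG !(inj_eq w_inj) xu xv.
case/flattenP=> s si xs; have lt : index s inner < size inner by rewrite index_mem.
exists (Ordinal lt); rewrite inE mem_rcons inE /= nth_index //.
by rewrite -{3}(wK x) map_f ?orbT.
Qed.

End Container.

Theorem theorem1 (n k : nat) :
  4 <= n -> 1 <= k -> 2 <= n - k ->
  forall l : nat, 1 <= l <= k * (n - k) ->
  star_connected (@arr_adj n k) l.
Proof.
move=> _ k1 nk l /andP[l1 lk] u v uv.
pose V := {ffun 'I_k -> 'I_n}; pose adj : rel V := @hadj 'I_k 'I_n.
pose w (x : arr_vertex n k) : V := [ffun i => tnth (val x) i].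
pose A := [set: 'I_k]; pose Y := [set: 'I_n].
have cA : #|A| = k.-1.+1 by rewrite cardsT card_ord prednK.
have cY : #|Y| = k.-1.+1 + (n - k) by rewrite cardsT card_ord prednK // subnKC //; move: nk; clear; lia.
have sp := span_stage nk cA cY (f0 := w u); set G := stage A Y (w u) in sp.
have GP (f : V) : reflect (injective f) (f \in G).
  apply: (iffP (stageP _ _ _ _)) => [[_ _ H] x y E|H]; first by apply: H; rewrite ?inE.
  by split=> [q|q _|x y _ _ /H]; rewrite ?inE.
have wG x : w x \in G.
  by apply/GP => i j; rewrite !ffunE; apply/tuple_uniqP/(valP x).
have w_inj : injective w.
  move=> x y E; apply/val_inj/eq_from_tnth => i.
  by have := congr1 (fun f : V => f i) E; rewrite !ffunE.
have Gw (f : V) : f \in G -> exists x, w x = f.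
  move=> /GP fi; have ut : uniq [tuple f i | i < k].
    by apply/tuple_uniqP => i j; rewrite !tnth_mktuple; apply: fi.
  by exists (exist (fun s : k.-tuple 'I_n => uniq s) _ ut); apply/ffunP => i; rewrite ffunE /= tnth_mktuple.
have w_adj x y : arr_adj x y = adj (w x) (w y).
  by rewrite /arr_adj /adj /hadj; congr (_ == 1); apply: eq_card => i; rewrite !inE !ffunE.
have wuv : w u != w v by rewrite (inj_eq w_inj).
pose N := [set f : V in G | adj f (w v)].
(* Changing one of the [k] entries to one of the [n - k] free symbols gives pairwise distinct
   neighbours. *)
have cN : k * (n - k) <= #|N|.
  pose h (x : 'I_k * 'I_n) : V := upd (w v) x.1 x.2.
  have hi : {in setX A (free A Y (w v)) &, injective h}.
    move=> [p c] [q d]; rewrite !inE /= => cv dv E.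
    have [pq|pq] := eqVneq p q.
      by have := congr1 (fun f : V => f p) E; rewrite /h /= pq !updp => ->.
    have := congr1 (fun f : V => f p) E; rewrite /h /= updp updN // => cp.
    by have := fr_neq cv (in_setT p); rewrite cp eqxx.
  have cF : #|free A Y (w v)| = n - k by apply: (card_fr (wG v)); rewrite cA.
  rewrite -[k in k * _]card_ord -cardsT -cF -cardsX -(card_in_imset hi).
  apply/subset_leq_card/subsetP => _ /imsetP[[p c] + ->]; rewrite !inE /= => cv.
  by rewrite upd_stage ?inE //= /adj hadj_upd' // (fr_neq cv) ?inE.
have key (B : {set V}) (e : bool) : B \subset N :\ w u -> B != set0 -> (e -> adj (w u) (w v)) ->
    e + #|B| = l -> exists P : 'I_l -> seq (arr_vertex n k), is_star_container (@arr_adj n k) u v P.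
  move=> BN B0 ae sl; have [|||S aS [ps [wps fps hps lps]]] := sp (w u) (w v) B (wG u) (wG v) wuv _ B0.
  - by apply: subset_trans BN _; apply/subsetP => f; rewrite !inE => /and3P[].
  - by apply/negP => /(subsetP BN); rewrite !inE eqxx.
  - by move=> b /(subsetP BN); rewrite !inE => /and3P[].
  have sz : size (nseq e [::] ++ map (@verts _) ps) = l.
    by rewrite size_cat size_nseq size_map -sl cardE -(perm_size lps) size_map.
  rewrite -sz; apply: (star_container w_inj w_adj wG Gw) => //.
  - by case: (e).
  - rewrite all_cat; apply/andP; split.
      by case: (e) ae => //= ->.
    apply/allP => s /mapP[x xps ->]; rewrite rcons_path /=; apply/andP; split.
      rewrite [path _ _ _](allP wps _ xps) andbT; apply: (allP aS).
      by rewrite -(perm_mem hps); apply: map_f.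
    have /(subsetP BN) : last x.1 x.2 \in B by rewrite -mem_enum -(perm_mem lps); apply: (map_f (@endp _)).
    by rewrite !inE => /and3P[].
  - rewrite count_cat (_ : count _ (map (@verts _) ps) = 0) ?addn0.
      by case: (e).
    by elim: (ps) => //= x s ->.
  by rewrite sz.
have [le|lt] := leqP l #|N :\ w u|.
  have [B BN cB] := ex_subset le.
  by apply: (key B false) => //; rewrite -card_gt0 cB.
have lN := leq_trans lk cN; have cN1 := cardsD1 (w u) N.
(* If [u] were not a neighbour of [v], removing it would not shrink [N], which has at least
   [k * (n - k)] and hence at least [l] elements. So [l] is the full degree and the edge from [u] to
   [v] is one of the paths. *)
have uN : w u \in N.
  by apply: contraLR lt => n0; move: lN; rewrite cN1 (negPf n0) -leqNgt.
rewrite uN in cN1.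
apply: (key (N :\ w u) true) => //.
- have := leq_trans (leq_trans nk (leq_pmull _ k1)) cN.
  by rewrite cN1 -card_gt0.
- by move: uN; rewrite !inE => /andP[_ ->].
by apply/eqP; rewrite eqn_leq -cN1 lN andbT cN1.
Qed.
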